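(* Let $\big((M,V),(\beta,w)\big)\in L^1(\mathcal{J};\mathbb{H}\times\mathbb{Q})$ and $\big((M_h,V_h),(\beta_h,w_h)\big)\in L^1(\mathcal{J};\mathbb{H}_h\times\mathbb{Q}_h)$ be the solutions of the continuous and semi-discrete mixed formulations of the viscoelastic Timoshenko beam given in the context. If $(f,g)\in L^1(\mathcal{J};H^1(\Omega)\times H^1(\Omega))$, then $$\|(M,V)-(M_h,V_h)\|_{L^1(\mathcal{J};\mathbb{H})}+\|(\beta,w)-(\beta_h,w_h)\|_{L^1(\mathcal{J};\mathbb{Q})}\le Ch\big(\|f_E\|_{L^1(\mathcal{J};H^1(\Omega))}+\|g_E\|_{L^1(\mathcal{J};H^1(\Omega))}\big),$$ where $C$ is a positive constant independent of $h$ and $\varepsilon$.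
   Context: $\Omega=(0,L)$, $\mathcal{J}=[0,T]$ with $T\in[0,\infty)$, $(\cdot,\cdot)_{0,\Omega}$ is the $L^2(\Omega)$ inner product, $\mathbb{H}:=H^1(\Omega)\times H^1(\Omega)$, $\mathbb{Q}:=L^2(\Omega)\times L^2(\Omega)$ with their product norms, and $L^1(\mathcal{J};X)$ is the Bochner space. $\varepsilon\in(0,\varepsilon_{\max}]$ is the thickness parameter. $\hat I$ and $\hat A$ are the (scaled) moment of inertia and cross-section area, functions on $\Omega$ bounded above and below by positive constants independent of $\varepsilon$; $\kappa:=\hat A/(2(1+\nu))$, where $\nu$ is the Poisson ratio (so $1+\nu>0$). $E$ is the relaxation modulus, with $E(0)>0$, and $k(t,s):=\dot E(t-s)/E(0)$ is a continuous bounded kernel on $0\le s\le t\le T$. $f_E:=f/E(0)$, $g_E:=g/E(0)$. Continuous problem: find $\big((M,V),(\beta,w)\big)\in L^1(\mathcal{J};\mathbb{H}\times\mathbb{Q})$ such that for a.e. $t\in\mathcal{J}$ and all $\big((\tau,\xi),(\eta,v)\big)\in\mathbb{H}\times\mathbb{Q}$, $$\begin{aligned}&(M'-V,\eta)_{0,\Omega}-(V',v)_{0,\Omega}=-(f_E,v)_{0,\Omega}-(g_E,\eta)_{0,\Omega}+\int_0^t k(t,s)\big[(M'(s)-V(s),\eta)_{0,\Omega}-(V'(s),v)_{0,\Omega}\big]ds,\\ &(M/\hat I,\tau)_{0,\Omega}+\varepsilon^2(\kappa^{-1}V,\xi)_{0,\Omega}+(\beta,\tau'-\xi)_{0,\Omega}-(w,\xi')_{0,\Omega}=0,\end{aligned}$$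 where primes are derivatives in $x\in\Omega$. Finite element spaces: given a partition of $\Omega$ into consecutive subintervals $\Omega_i=(x_{i-1},x_i)$, $i=1,\dots,n$, of lengths $h_i=x_i-x_{i-1}$ and $h:=\max_i h_i$, let $\mathcal{V}_h:=\{v\in H^1(\Omega): v|_{\Omega_i}\in\mathbb{P}_1(\Omega_i)\ \forall i\}$, $\mathcal{Q}_h:=\{q\in L^2(\Omega): q|_{\Omega_i}\in\mathbb{P}_0(\Omega_i)\ \forall i\}$, $\mathbb{H}_h:=\mathcal{V}_h\times\mathcal{V}_h$, $\mathbb{Q}_h:=\mathcal{Q}_h\times\mathcal{Q}_h$. Semi-discrete problem: find $\big((M_h,V_h),(\beta_h,w_h)\big)\in L^1(\mathcal{J};\mathbb{H}_h\times\mathbb{Q}_h)$ satisfying the same equations with $(M,V,\beta,w)$ replaced by $(M_h,V_h,\beta_h,w_h)$, for a.e. $t\in\mathcal{J}$ and all $\big((\tau,\xi),(\eta,v)\big)\in\mathbb{H}_h\times\mathbb{Q}_h$. Standing regularity assumption: there is a constant $C$ independent of $\varepsilon$ such that the solution of the continuous problem satisfies $$\|M\|_{L^1(\mathcal{J};H^2(\Omega))}+\|V\|_{L^1(\mathcal{J};H^2(\Omega))}+\|\beta\|_{L^1(\mathcal{J};H^1(\Omega))}+\|w\|_{L^1(\mathcal{J};H^1(\Omega))}\le C\big(\|f_E\|_{L^1(\mathcal{J};H^1(\Omega))}+\|g_E\|_{L^1(\mathcal{J};H^1(\Omega))}\big).$$ *)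

(* Defs.v *)
From HB Require Import structures.
From mathcomp Require Import all_boot all_order all_algebra.
From mathcomp Require Import all_classical all_reals all_analysis.
Set Implicit Arguments.
Unset Strict Implicit.
Unset Printing Implicit Defensive.
Import Order.TTheory GRing.Theory Num.Theory.
Import numFieldNormedType.Exports.
Local Open Scope classical_set_scope.
Local Open Scope ring_scope.

(* A Lebesgue or Sobolev space is described by representatives: a set of
   functions (or tuples of functions) together with its norm. Membership and
   norm are invariant under modification on a null set, and the norm is only
   meaningful on the carrier. *)
Record nspace (R : realType) (U : zmodType) := NSpace {
  carrier : set U ;
  nnorm : U -> R }.

Definition subspace_of (R : realType) (U : zmodType) (X : nspace R U)
    (S : set U) : nspace R U :=
  NSpace (carrier X `&` S) (nnorm X).

Definition prod_space (R : realType) (U V : zmodType) (X : nspace R U)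
    (Y : nspace R V) : nspace R (U * V)%type :=
  NSpace (carrier X `*` carrier Y)
    (fun p => Num.sqrt (nnorm X p.1 ^+ 2 + nnorm Y p.2 ^+ 2)).

Section Bochner.
Context {R : realType} {U : zmodType}.
Local Notation mu := (@lebesgue_measure R).

Definition simple_on (J : set R) (X : nspace R U) (s : R -> U) : Prop :=
  [/\ finite_set (s @` J), s @` J `<=` carrier X &
      forall y, measurable (J `&` s @^-1` [set y])].

Definition strongly_measurable (J : set R) (X : nspace R U) (u : R -> U) :=
  exists2 s : nat -> R -> U, (forall n, simple_on J X (s n)) &
    {ae mu, forall t, J t -> carrier X (u t) /\
      (fun n => nnorm X (s n t - u t)) @ \oo --> (0 : R)}.

Definition L1_norm (J : set R) (X : nspace R U) (u : R -> U) : \bar R :=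
  (\int[mu]_(t in J) (nnorm X (u t))%:E)%E.

Definition L1_Bochner (J : set R) (X : nspace R U) (u : R -> U) : Prop :=
  strongly_measurable J X u /\ (L1_norm J X u < +oo)%E.

End Bochner.

Section Sobolev.
Context {R : realType}.
Variable L : R.
Local Notation mu := (@lebesgue_measure R).
Local Notation Omega := `]0, L[%classic.

Definition L2_inner (f g : R -> R) : R := \int[mu]_(x in Omega) (f x * g x).

Definition L2 : nspace R (R -> R) :=
  NSpace [set f | f \_ Omega \in Lfun mu 2%:E]
    (fun f => fine ('N[mu]_2%:E [EFin \o f \_ Omega])).

Definition test_function (phi : R -> R) : Prop :=
  (forall n x, derivable (derive1n n phi) x 1) /\
  exists c d, [/\ 0 < c, d < L & forall x, x \notin `[c, d] -> phi x = 0].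

Definition is_weak_derivative (u v : R -> R) : Prop :=
  carrier L2 v /\
  forall phi, test_function phi ->
    L2_inner u (derive1 phi) = - L2_inner v phi.

Definition weak_derivative (u : R -> R) : R -> R :=
  get (is_weak_derivative u).

Definition H1 : nspace R (R -> R) :=
  NSpace [set u | carrier L2 u /\ exists v, is_weak_derivative u v]
    (fun u => Num.sqrt (nnorm L2 u ^+ 2 + nnorm L2 (weak_derivative u) ^+ 2)).

Definition H2 : nspace R (R -> R) :=
  NSpace [set u | carrier H1 u /\ carrier H1 (weak_derivative u)]
    (fun u => Num.sqrt (nnorm L2 u ^+ 2 + nnorm L2 (weak_derivative u) ^+ 2
       + nnorm L2 (weak_derivative (weak_derivative u)) ^+ 2)).

End Sobolev.

Section FiniteElements.
Context {R : realType}.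
Variables (L : R) (s : seq R).
Local Notation mu := (@lebesgue_measure R).

(* For [itv_partition 0 L s], the nodes are x_0 = 0 and the entries of [s]. *)
Definition node (i : nat) : R := (0 :: s)`_i.

Definition mesh_size : R :=
  \big[Num.max/0]_(i < size s) (node i.+1 - node i).

Definition piecewise_poly (k : nat) : set (R -> R) :=
  [set v | forall i, (i < size s)%N -> exists2 p : {poly R}, (size p <= k.+1)%N &
    {ae mu, forall x, node i < x < node i.+1 -> v x = p.[x]}].

Definition Vh : nspace R (R -> R) := subspace_of (H1 L) (piecewise_poly 1).

Definition Qh : nspace R (R -> R) := subspace_of (L2 L) (piecewise_poly 0).

End FiniteElements.

(* [f'] is the derivative of [f] relative to [D], hence one-sided at the
   endpoints of an interval. *)
Definition derivative_on (R : realType) (D : set R) (f f' : R -> R) : Prop :=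
  forall x, D x ->
    (f y - f x) / (y - x) @[y --> within (D `\ x) (nbhs x)] --> f' x.

Section Beam.
Context {R : realType}.
Variables (L T : R).
Local Notation mu := (@lebesgue_measure R).
Local Notation J := `[0, T]%classic.
Local Notation inner := (L2_inner L).
Local Notation wd := (weak_derivative L).
Local Notation F := (R -> R).

Definition mixed_equation1 (k : R -> R -> R) (fE gE : R -> F)
    (u : R -> (F * F) * (F * F)) (t : R) (eta v : F) : Prop :=
  let M s := (u s).1.1 in let V s := (u s).1.2 in
  let b s := inner (wd (M s) - V s) eta - inner (wd (V s)) v in
  b t = - inner (fE t) v - inner (gE t) eta
        + \int[mu]_(s in `[0, t]) (k t s * b s).

Definition mixed_equation2 (eps : R) (I kappa : F)
    (u : R -> (F * F) * (F * F)) (t : R) (tau xi : F) : Prop :=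
  let M := (u t).1.1 in let V := (u t).1.2 in
  let beta := (u t).2.1 in let w := (u t).2.2 in
  inner (fun x => M x / I x) tau
  + eps ^+ 2 * inner (fun x => (kappa x)^-1 * V x) xi
  + inner beta (wd tau - xi) - inner w (wd xi) = 0.

(* The continuous problem for [X], [Y] = [H1 L], [L2 L], the semi-discrete one
   for [X], [Y] = [Vh L s], [Qh L s]. *)
Definition mixed_solution (X Y : nspace R F) (eps : R) (I kappa : F)
    (k : R -> R -> R) (fE gE : R -> F) (u : R -> (F * F) * (F * F)) : Prop :=
  L1_Bochner J (prod_space (prod_space X X) (prod_space Y Y)) u /\
  {ae mu, forall t, J t -> forall tau xi eta v : F,
     carrier X tau -> carrier X xi -> carrier Y eta -> carrier Y v ->
     mixed_equation1 k fE gE u t eta v /\ mixed_equation2 eps I kappa u t tau xi}.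

Definition regularity_estimate (C : R) (fE gE : R -> F)
    (u : R -> (F * F) * (F * F)) : Prop :=
  let M t := (u t).1.1 in let V t := (u t).1.2 in
  let beta t := (u t).2.1 in let w t := (u t).2.2 in
  [/\ L1_Bochner J (H2 L) M, L1_Bochner J (H2 L) V,
      L1_Bochner J (H1 L) beta, L1_Bochner J (H1 L) w &
      (L1_norm J (H2 L) M + L1_norm J (H2 L) V
       + L1_norm J (H1 L) beta + L1_norm J (H1 L) w
       <= C%:E * (L1_norm J (H1 L) fE + L1_norm J (H1 L) gE))%E].

End Beam.

(* Main.v *)
Require Import Defs.
From HB Require Import structures.
From mathcomp Require Import all_boot all_order all_algebra.
From mathcomp Require Import all_classical all_reals all_analysis.
From mathcomp Require Import measurable_realfun simple_functions.
From mathcomp Require Import ring lra.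
Set Implicit Arguments.
Unset Strict Implicit.
Unset Printing Implicit Defensive.
Import Order.TTheory GRing.Theory Num.Theory.
Import numFieldNormedType.Exports.
Local Open Scope classical_set_scope.
Local Open Scope ring_scope.

(** The proof separates time from space. Subtracting the two first equations,
    tested with one fixed pair of piecewise constants, shows that the error in
    [(M' - V, eta) - (V', v)] solves a homogeneous Volterra equation of the
    second kind with bounded kernel, so it vanishes for almost every time
    ([volterra_unique], [flux_eq]). Piecewise constants are spanned by the
    finitely many cell indicators, hence a single null set of times serves all
    of them ([flux_eq_steps]): at almost every time [V' - V_h'] and
    [(M' - V) - (M_h' - V_h)] are orthogonal to the piecewise constants. What
    remains is a family of stationary problems in which time is a parameter.

    Stresses ([stress_estimate]). Orthogonality makes [V_h'] the cellwise mean
    of [V'], so [V - V_h = c + r] with [c] a constant and [r] the primitive of a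
    function of size [h |V''|]. In the same way [M_h' - V_h] is determined, and
    [M - M_h = d + c x + q] with the same [c] and with [q = O(h)]. The pair
    [(d + c x, c)] consists of finite element functions and satisfies
    [tau' - xi = 0] and [xi' = 0]. Used as a test pair in the difference of the
    second equations it removes [beta] and [w], and what is left is an energy
    identity that bounds [|d + c x|] by the norms of [q] and [r]. The term
    carrying [eps ^ 2] has the favourable sign on the left and is bounded with
    the largest thickness on the right, which is why the constant does not
    depend on [eps]. Finally [|c|] is bounded by a multiple of [|d + c x|]
    ([affine_slope]).

    Multipliers ([multiplier_estimate]). The discrete inf-sup condition is
    realized by explicit test functions: [xi] is minus the primitive of
    [P w - w_h], and [tau] the primitive of [P xi + (P beta - beta_h)], where [P]
    takes cellwise means. They give [|P beta - beta_h|^2 + |P w - w_h|^2] on one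
    side and products with the stress errors and with [beta - P beta] on the
    other.

    All distances to the piecewise constants come from the Poincare inequality
    on a cell ([poincare_cell_mean]). It needs the description of functions with
    a square integrable weak derivative as primitives ([weak_primitive]), which
    follows from the lemma of du Bois-Reymond and Fubini's theorem; smooth
    functions of compact support are built from [exp (- 1 / x)].

    Integrating the bounds in time and inserting the regularity hypothesis
    concludes. The norms of Bochner integrable maps are only almost everywhere
    equal to Borel functions, so integrals are compared by
    [ge0_ae_le_integral_nomeas], which holds for arbitrary nonnegative
    functions. *)

(** * Integration without measurability, strong measurability, and a Volterra lemma *)

Section IntegralAE.
Context d (T : measurableType d) (R : realType).
Variable mu : {measure set T -> \bar R}.
Import HBNNSimple.

(** The integral of a nonnegative function is the supremum of the integrals of
    the simple functions below it, whether or not the function is measurable.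
    Cutting such a simple function off on the exceptional null set does not
    change its integral and puts it below [g]. *)
Lemma ge0_ae_le_integral_nomeas (D : set T) (f g : T -> \bar R) :
  measurable D ->
  (forall x, D x -> 0 <= f x)%E -> (forall x, D x -> 0 <= g x)%E ->
  {ae mu, forall x, D x -> (f x <= g x)%E} ->
  (\int[mu]_(x in D) f x <= \int[mu]_(x in D) g x)%E.
Proof.
move=> mD f0 g0 [N [mN N0 fgN]].
rewrite ge0_integralE// [leRHS]ge0_integralE//.
apply: ge_ereal_sup => _ [h /= hf <-].
have mNC : measurable (~` N) by exact: measurableC.
apply: ereal_sup_ubound; exists (proj_nnsfun h mNC).
  move=> x; rewrite -mrestrict patchE; case: ifPn => xN; last first.
    exact: erestrict_ge0.
  apply: le_trans (hf x) _.
  rewrite !patchE; case: ifPn => // xD.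
  apply: contrapT => fgx; move: xN; rewrite inE; apply.
  by apply: fgN => /= fg; apply: fgx; apply: fg; rewrite inE in xD.
have E (k : {nnsfun T >-> R}) : sintegral mu k = (\int[mu]_x (k x)%:E)%E.
  by rewrite integral_nnsfun// patch_setT.
rewrite !E; apply: ge0_ae_eq_integral => //.
- exact/measurable_EFinP.
- exact/measurable_EFinP.
- by move=> x _; rewrite lee_fin.
- by move=> x _; rewrite lee_fin.
exists N; split => // x /= hx; apply: contrapT => Nx; apply: hx => _.
by rewrite /= mindicE mem_set//= mulr1.
Qed.

Lemma ae_eq_integral_nomeas (D : set T) (f g : T -> \bar R) :
  measurable D -> {ae mu, forall x, D x -> f x = g x} ->
  (\int[mu]_(x in D) f x = \int[mu]_(x in D) g x)%E.
Proof.
move=> mD fg; rewrite integralE [RHS]integralE; congr (_ - _)%E;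
apply/eqP; rewrite eq_le; apply/andP; split; apply: ge0_ae_le_integral_nomeas => //.
all: by apply: filterS fg => x fg Dx; rewrite ?funeposE ?funenegE fg.
Qed.

Lemma ae_eq_Rintegral_nomeas (D : set T) (f g : T -> R) :
  measurable D -> {ae mu, forall x, D x -> f x = g x} ->
  \int[mu]_(x in D) f x = \int[mu]_(x in D) g x.
Proof.
move=> mD fg; congr fine; apply: ae_eq_integral_nomeas => //.
by apply: filterS fg => x /[apply] ->.
Qed.

End IntegralAE.

Section LebesgueAE.
Context {R : realType}.
Local Notation mu := (@lebesgue_measure R).
Implicit Types P Q S : R -> Prop.

Lemma ae_imply P Q : (forall x, P x -> Q x) ->
  {ae mu, forall x, P x} -> {ae mu, forall x, Q x}.
Proof. by move=> PQ; apply: filterS; first exact: (ae_filter_ringOfSetsType mu). Qed.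

Lemma ae_imply2 P Q S : (forall x, P x -> Q x -> S x) ->
  {ae mu, forall x, P x} -> {ae mu, forall x, Q x} -> {ae mu, forall x, S x}.
Proof. by move=> PQ; apply: filterS2; first exact: (ae_filter_ringOfSetsType mu). Qed.

Lemma ae_conj (J : set R) P Q : {ae mu, forall x, J x -> P x} ->
  {ae mu, forall x, J x -> Q x} -> {ae mu, forall x, J x -> P x /\ Q x}.
Proof. by apply: ae_imply2 => x hP hQ Jx; split; [exact: hP|exact: hQ]. Qed.

End LebesgueAE.

Section Bochner.
Context {R : realType} {U : zmodType}.
Local Notation mu := (@lebesgue_measure R).

(** A simple map has finitely many values, so the preimage of any set under
    [p \o s] is a finite union of measurable level sets. *)
Lemma simple_on_measurable (J : set R) (X : nspace R U) (s : R -> U) (p : U -> R) :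
  measurable J -> simple_on J X s -> measurable_fun J (p \o s).
Proof.
move=> mJ [fs _ ms] _ B _.
have -> : J `&` (p \o s) @^-1` B =
    \bigcup_(y in s @` J `&` p @^-1` B) (J `&` s @^-1` [set y]).
  apply/seteqP; split => [t [Jt /= Bt]|t [y [[t' Jt' <-] /= By] [Jt /= ->]]] //.
  by exists (s t) => //; split => //; exists t.
by apply: fin_bigcup_measurable => //; apply: finite_setIl.
Qed.

(** Composed with the approximating simple maps [p] is measurable, and the
    Lipschitz bound carries their convergence in norm over to the real-valued
    compositions. *)
Lemma strongly_measurable_lipschitz (J : set R) (X : nspace R U) (u : R -> U)
    (p : U -> R) (C : R) : measurable J -> strongly_measurable J X u ->
  (forall a b, carrier X a -> carrier X b -> `|p a - p b| <= C * nnorm X (a - b)) ->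
  exists m : R -> R, measurable_fun J m /\ {ae mu, forall t, J t -> p (u t) = m t}.
Proof.
move=> mJ [s ss [N [mN N0 uN]]] pC.
have good t : J t -> ~ N t ->
    carrier X (u t) /\ (fun n => nnorm X (s n t - u t)) @ \oo --> (0 : R).
  by move=> Jt Nt; apply: contrapT => h; apply: Nt; apply: uN => /= /(_ Jt).
(* setting everything to 0 on the null set N makes the convergence hold everywhere *)
exists (fun t => if t \in N then 0 else p (u t)); split; last first.
  exists N; split => // t /= h; apply: contrapT => Nt; apply: h => Jt.
  by rewrite memNset.
apply: (@measurable_fun_cvg _ _ _ J
  (fun n t => if t \in N then 0 else p (s n t))).
  move=> n; apply: measurable_fun_if => //=.
  - apply: (measurable_fun_bool true).
    rewrite (_ : _ @^-1` _ = N); first exact: measurableI.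
    by apply/seteqP; split => t /=; [move/set_mem|move/mem_set].
  - apply: measurable_funS (simple_on_measurable p mJ (ss n)) => //.
move=> t Jt /=; case: (boolP (t \in N)) => tN; first exact: cvg_cst.
rewrite notin_setE in tN.
have [cu cv] := good t Jt tN.
apply/cvgrPdist_le => e e0.
have: (C * nnorm X (s n t - u t)) @[n --> \oo] --> C * 0.
  by apply: cvgM => //; exact: cvg_cst.
rewrite mulr0 => /cvgrPdist_le /(_ e e0); apply: filterS => n.
rewrite sub0r normrN => h.
have sc : carrier X (s n t) by have [_ sX _] := ss n; apply: sX; exists t.
by rewrite distrC (le_trans (pC _ _ sc cu))// (le_trans _ h)// ler_norm.
Qed.

End Bochner.

Section Volterra.
Context {R : realType}.
Local Notation mu := (@lebesgue_measure R).

(** Gronwall's argument in finitely many time steps. Over a step of length [e]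
    with [K * e <= 1 / 2], if [d] vanishes before the step, the integral of [|d|]
    up to the end of the step is at most half of itself, hence zero. *)
Lemma volterra_zero (T K : R) (d : R -> R) : 0 <= T ->
  mu.-integrable `[0, T] (EFin \o d) ->
  {ae mu, forall t, `[0, T]%classic t ->
     `|d t| <= K * \int[mu]_(s in `[0, t]) `|d s|} ->
  {ae mu, forall t, `[0, T]%classic t -> d t = 0}.
Proof.
move=> T0 id dK.
have iad : mu.-integrable `[0, T] (EFin \o (fun s => `|d s|)).
  exact: integrable_norm.
pose D s := \int[mu]_(x in `[0, s]) `|d x|.
have D0 s : 0 <= D s by apply: Rintegral_ge0.
pose K' := `|K| + 1.
have K'0 : 0 < K' by rewrite ltr_wpDl.
have KK' : K <= K' by rewrite /K' (le_trans (ler_norm _))// lerDl.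
(* the length of a time step; K' replaces K to be positive *)
pose e := (2 * K')^-1.
have e0 : 0 < e by rewrite invr_gt0 mulr_gt0.
have Ke : K' * e = 1 / 2 by rewrite /e; field; rewrite gt_eqF.
pose a n := Num.min (n%:R * e) T.
have aT n : a n <= T by rewrite ge_min lexx orbT.
have a0 n : 0 <= a n by rewrite le_min T0 mulr_ge0// ltW.
have aS n : a n <= a n.+1.
  rewrite /a -[n.+1%:R]natr1 mulrDl mul1r.
  by have [h1|h1] := leP (n%:R * e) T; have [h2|h2] := leP (n%:R * e + e) T; lra.
have aSe n : a n.+1 - a n <= e.
  rewrite /a -[n.+1%:R]natr1 mulrDl mul1r.
  by have [h1|h1] := leP (n%:R * e) T; have [h2|h2] := leP (n%:R * e + e) T; lra.
have Da n : D (a n) = 0.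
  elim: n => [|n IH]; first by rewrite /a mul0r min_l// /D set_itv1 Rintegral_set1.
  have sub : `]a n, a n.+1] `<=` `[0, T].
    by apply: subset_itv; rewrite bnd_simp.
  have E : D (a n.+1) = \int[mu]_(x in `]a n, a n.+1]) `|d x|.
    have h0 : mu.-integrable `[0, a n.+1] (EFin \o (fun s => `|d s|)).
      by apply: integrableS iad => //; apply: subset_itv; rewrite bnd_simp.
    have := Rintegral_itvB h0; move=> /(_ (a n)).
    rewrite -/(D _) -/(D _) IH subr0 => h; apply: h.
      by rewrite bnd_simp.
    by rewrite bnd_simp.
  have : D (a n.+1) <= K' * D (a n.+1) * e.
    apply: (@le_trans _ _ (K' * D (a n.+1) * (a n.+1 - a n))); last first.
      by rewrite ler_wpM2l// mulr_ge0// ltW.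
    rewrite -lee_fin {1}E /Rintegral fineK; last first.
      apply: integrable_fin_num => //.
      exact: integrableS iad.
    apply: (@le_trans _ _ (\int[mu]_(x in `]a n, a n.+1]) (K' * D (a n.+1))%:E)%E).
      apply: ge0_ae_le_integral_nomeas => //.
      + by move=> x _; rewrite lee_fin mulr_ge0// ltW.
      + apply: ae_imply dK => x + xa => /(_ (sub _ xa)) h; rewrite lee_fin.
        apply: (le_trans h).
        apply: (@le_trans _ _ (K' * D x)).
          exact: ler_wpM2r (D0 x) _ _ KK'.
        apply: ler_wpM2l; first exact: ltW.
        rewrite -lee_fin /D /Rintegral.
        have ix y : y <= a n.+1 -> mu.-integrable `[0, y] (EFin \o (fun s => `|d s|)).
          move=> ya; apply: integrableS iad => //; apply: subset_itv; rewrite ?bnd_simp//.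
          exact: le_trans (aT n.+1).
        move: xa => /=; rewrite in_itv/= => /andP[_ xa].
        rewrite !fineK ?integrable_fin_num ?ix//.
        apply: ge0_subset_integral => //.
        * by apply: (measurable_int mu); apply: ix.
        * by apply: subset_itv; rewrite ?bnd_simp.
    rewrite integral_cst//= lebesgue_measure_itv/= lte_fin.
    case: ltP => h; first by rewrite lee_fin.
    by rewrite mule0 lee_fin mulr_ge0 ?subr_ge0// mulr_ge0// ltW.
  rewrite mulrAC Ke => h; apply/eqP; rewrite eq_le D0 andbT; lra.
have DT : D T = 0.
  have [n hn] : exists n, a n = T.
    exists (Num.truncn (T / e)).+1; rewrite /a min_r//.
    by rewrite -ler_pdivrMr// ltW// truncnS_gt.
  by rewrite -hn.
have := (ae_eq_integral_abs mu (measurable_itv `[0, T]) (measurable_int mu id)).1.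
have -> : (\int[mu]_(x in `[0%R, T]) `|(EFin \o d) x| = 0)%E.
  have := DT; rewrite /D /Rintegral => /eqP; rewrite fine_eq0 ?integrable_fin_num//.
  by move=> /eqP.
move=> /(_ erefl); apply: ae_imply => t h Tt; by have [] := h Tt.
Qed.

End Volterra.

(** * Smooth cutoff functions *)

Section Smooth.
Context {R : realType}.
Implicit Types (f g : R -> R) (p : {poly R}).

(** Every derivative is witnessed by a function instead of being an iterate of
    [derive1]; closure under products and affine substitutions is then a plain
    induction on [n]. *)
Fixpoint nsmooth (n : nat) (f : R -> R) : Prop :=
  if n is m.+1 then
    exists2 f' : R -> R, (forall x : R, is_derive x (1 : R) f (f' x)) & nsmooth m f'
  else True.

Lemma nsmoothW n f : nsmooth n.+1 f -> nsmooth n f.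
Proof.
by elim: n f => [//|n IH] f [f' df sf']; exists f' => //; exact: IH.
Qed.

Lemma nsmooth_cst n (c : R) : nsmooth n (cst c).
Proof. by elim: n c => [//|n IH] c; exists (cst 0) => // x; exact: is_derive_cst. Qed.

Lemma nsmoothD n f g : nsmooth n f -> nsmooth n g -> nsmooth n (f + g).
Proof.
elim: n f g => [//|n IH] f g [f' df sf] [g' dg sg]; exists (f' + g').
  by move=> x; exact: is_deriveD.
exact: IH.
Qed.

Lemma nsmoothM n f g : nsmooth n f -> nsmooth n g -> nsmooth n (f * g).
Proof.
elim: n f g => [//|n IH] f g hf hg; have [f' df sf] := hf; have [g' dg sg] := hg.
exists (f * g' + g * f'); first by move=> x; exact: is_deriveM.
by apply: nsmoothD; apply: IH => //; exact: nsmoothW.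
Qed.

Lemma is_derive_affine (a b x : R) : is_derive x 1 (fun y => a * y + b) a.
Proof.
have h : is_derive x 1 ((a \*: id) + cst b) (a *: 1 + 0) by exact: is_deriveD.
by move: h; rewrite addr0 /GRing.scale/= mulr1.
Qed.

Lemma nsmooth_affine n f (a b : R) : nsmooth n f -> nsmooth n (fun x => f (a * x + b)).
Proof.
elim: n f => [//|n IH] f [f' df sf]; exists ((fun x => f' (a * x + b)) * cst a).
  move=> x; have d1 := df (a * x + b); have d2 := is_derive_affine a b x.
  exact: (@is_derive1_comp _ f (fun y => a * y + b) x _ _ d1 d2).
apply: nsmoothM; [exact: IH|exact: nsmooth_cst].
Qed.

Lemma nsmooth_derive1n n f : nsmooth n.+1 f -> forall x, derivable (derive1n n f) x 1.
Proof.
elim: n f => [|n IH] f [f' df sf'] x; first by have [] := df x.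
have -> : derive1n n.+1 f = derive1n n f'.
  rewrite /derive1n iterSr; congr iter; apply/funext => y.
  by rewrite derive1E; exact: derive_val.
exact: IH.
Qed.

(** From [x <= expR x] at [x = y / k], raised to the power [k]. *)
Lemma pow_expR_bounded k : exists2 C : R, 0 <= C &
  forall y, 0 < y -> y ^+ k * expR (- y) <= C.
Proof.
case: k => [|k].
  by exists 1 => // y y0; rewrite expr0 mul1r expR_le1 oppr_le0 ltW.
exists (k.+1%:R ^+ k.+1) => [|y y0]; first exact: exprn_ge0.
rewrite expRN ler_pdivrMr ?expR_gt0//.
have k0 : (0 : R) < k.+1%:R by rewrite ltr0n.
have yE : y = k.+1%:R * (y / k.+1%:R) by rewrite mulrCA divff ?mulr1// gt_eqF.
have h : y / k.+1%:R <= expR (y / k.+1%:R).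
  by apply: le_trans (expR_ge1Dx _); rewrite lerDr.
rewrite [in leRHS]yE expRM_natl -exprMn.
apply: lerXn2r; rewrite ?nnegrE ?mulr_ge0 ?expR_ge0//; try exact: ltW.
by rewrite {1}yE; apply: ler_wpM2l; first exact: ltW.
Qed.

Lemma poly_expR_bounded p k : exists2 C : R, 0 <= C &
  forall y, 0 < y -> `|p.[y]| * y ^+ k * expR (- y) <= C.
Proof.
elim/poly_ind: p k => [|p c IH] k.
  by exists 0 => // y y0; rewrite horner0 normr0 !mul0r.
have [C1 C10 h1] := IH k.+1; have [C2 C20 h2] := pow_expR_bounded k.
exists (C1 + `|c| * C2) => [|y y0]; first by rewrite addr_ge0// mulr_ge0.
rewrite hornerD hornerMX hornerC.
apply: (@le_trans _ _ ((`|p.[y]| * y + `|c|) * y ^+ k * expR (- y))).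
  do 2 (apply: ler_wpM2r; first by rewrite ?expR_ge0// exprn_ge0// ltW).
  by rewrite (le_trans (ler_normD _ _))// normrM (gtr0_norm y0).
rewrite !mulrDl lerD//.
  by rewrite -(mulrA `|p.[y]|) -exprS; exact: h1.
by rewrite -mulrA ler_wpM2l//; exact: h2.
Qed.

(** The functions [p (1 / x) exp (- 1 / x)], continued by zero. The polynomial
    factor is there to make the family closed under differentiation. *)
Definition flat p (x : R) : R := if 0 < x then p.[x^-1] * expR (- x^-1) else 0.

(** At the origin the difference quotient is [O(h)], because every polynomial
    times [expR (- y)] is bounded on the positive half-line. *)
Lemma is_derive_flat p (x : R) :
  is_derive x 1 (flat p) (flat ('X^2 * (p - p^`())) x).
Proof.
have [x0|x0|->] := ltgtP x 0.
- rewrite {2}/flat ltNge (ltW x0)/=.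
  have h : is_derive x (1 : R) (cst (0 : R)) 0 by exact: is_derive_cst.
  apply: near_eq_is_derive h.
  near=> z; rewrite /flat ltNge ltW//=.
  by near: z; exact: lt_nbhsl.
- rewrite {2}/flat x0.
  pose g := (horner p \o (fun z => z^-1)) * (expR \o (- (fun z : R => z^-1))).
  have dV : is_derive x 1 (fun z : R => z^-1) (- x ^- 2).
    have := @is_deriveV R id x 1 1; rewrite /= /GRing.scale/= mulr1; apply.
    by rewrite gt_eqF.
  have dg := is_deriveM (is_derive1_comp (is_derive_poly p x^-1) dV)
    (is_derive1_comp (f := expR) (g := - (fun z : R => z^-1)) (is_derive_expR (- x^-1)) (is_deriveN dV)).
  apply: (@near_eq_is_derive _ _ _ g).
    near=> z; rewrite /flat.
    suff -> : 0 < z by [].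
    by near: z; exact: lt_nbhsr.
  apply: is_derive_eq dg _.
  rewrite /GRing.scale/= !hornerE/= exprVn; ring.
rewrite {2}/flat ltxx.
have [C C0 hC] := poly_expR_bounded p 2.
have lim0 : h^-1 *: (flat p (h *: 1 + 0) - flat p 0) @[h --> 0^'] --> (0 : R).
  apply/cvgrPdist_le => e e0.
  have eC : 0 < e / (C + 1) by rewrite divr_gt0// ltr_wpDl.
  near=> h.
  rewrite /GRing.scale/= mulr1 addr0 sub0r normrN {2}/flat ltxx subr0.
  rewrite /flat; case: ifPn => h0; last by rewrite mulr0 normr0 ltW.
  rewrite normrM gtr0_norm ?invr_gt0// normrM (ger0_norm (expR_ge0 _)).
  have hi : 0 < h^-1 by rewrite invr_gt0.
  have := hC _ hi.
  set A := `|_|; set B := expR _ => hAB.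
  have -> : h^-1 * (A * B) = A * h^-1 ^+ 2 * B * h.
    by rewrite expr2; field; rewrite gt_eqF.
  apply: (@le_trans _ _ (C * h)); first by rewrite ler_wpM2r// ltW.
  have : h <= e / (C + 1).
    have : `|h| < e / (C + 1) by near: h; apply: dnbhs0_lt.
    by rewrite gtr0_norm// => /ltW.
  rewrite ler_pdivlMr ?ltr_wpDl// => hh.
  by apply: le_trans hh; rewrite mulrC ler_wpM2l ?lerDl// ltW.
have dv : derivable (flat p) 0 1 by apply/cvg_ex; exists 0.
by apply: DeriveDef => //; apply/cvg_lim.
Unshelve. all: by end_near. Qed.

Lemma nsmooth_flat n p : nsmooth n (flat p).
Proof.
by elim: n p => [//|n IH] p; exists (flat ('X^2 * (p - p^`()))) => //; exact: is_derive_flat.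
Qed.

(** The factors [n.+1] make these functions converge pointwise to the indicator
    of the open interval from [a] to [b] as [n] grows. *)
Definition cutoff (a b : R) (n : nat) (x : R) : R :=
  flat 1 (n.+1%:R * (x - a)) * flat 1 (n.+1%:R * (b - x)).

Lemma nsmooth_cutoff m a b n : nsmooth m (cutoff a b n).
Proof.
have -> : cutoff a b n = (fun x => flat 1 (n.+1%:R * x + - (n.+1%:R * a))) *
    (fun x => flat 1 (- n.+1%:R * x + n.+1%:R * b)).
  by apply/funext => x; rewrite /cutoff/=; congr (flat _ _ * flat _ _); ring.
by apply: nsmoothM; apply: nsmooth_affine; exact: nsmooth_flat.
Qed.

Lemma flat1_ge0 x : 0 <= flat 1 x.
Proof. by rewrite /flat; case: ifP; rewrite // hornerE mul1r expR_ge0. Qed.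

Lemma flat1_le1 x : flat 1 x <= 1.
Proof.
rewrite /flat; case: ifP; rewrite // hornerE mul1r expR_le1 oppr_le0 => x0.
by rewrite invr_ge0 ltW.
Qed.

Lemma cutoff_ge0 a b n x : 0 <= cutoff a b n x.
Proof. by rewrite mulr_ge0// flat1_ge0. Qed.

Lemma cutoff_le1 a b n x : cutoff a b n x <= 1.
Proof. by rewrite mulr_ile1 ?flat1_ge0 ?flat1_le1. Qed.

Lemma cutoff_gt0 a b n x : a < x < b -> 0 < cutoff a b n x.
Proof.
move=> /andP[ax xb]; rewrite /cutoff /flat !(pmulr_rgt0 _ (ltr0Sn _ n)) !subr_gt0 ax xb.
by rewrite !hornerE; do 2 rewrite ?mulr_gt0 ?expR_gt0 ?ltr01.
Qed.

Lemma cutoff_out a b n x : ~~ (a < x < b) -> cutoff a b n x = 0.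
Proof.
rewrite negb_and -!leNgt /cutoff /flat => /orP[h|h].
  by rewrite ltNge pmulr_rle0 ?ltr0n// subr_le0 h/= mul0r.
by rewrite [X in _ * X]ifF ?mulr0// ltNge pmulr_rle0 ?ltr0n// subr_le0 h.
Qed.

Lemma flat1_cvg x : 0 < x -> flat 1 (n.+1%:R * x) @[n --> \oo] --> (1 : R).
Proof.
move=> x0.
have -> : (fun n : nat => flat 1 (n.+1%:R * x)) =
    (fun n : nat => expR (- x^-1 * n.+1%:R^-1)).
  apply/funext => n; rewrite /flat pmulr_rgt0 ?ltr0n// x0 hornerE mul1r.
  by rewrite invfM mulrC mulNr.
rewrite -[X in _ --> X]expR0 -[X in expR X](mulr0 (- x^-1)).
apply: continuous_cvg; first exact: continuous_expR.
apply: cvgM; first exact: cvg_cst.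
exact: cvg_harmonic.
Qed.

Lemma cutoff_cvg a b x : cutoff a b n x @[n --> \oo] --> (\1_(`]a, b[%classic) x : R).
Proof.
rewrite indicE; case: (boolP (a < x < b)) => h.
  rewrite mem_set ?in_itv//=; have /andP[ax xb] := h.
  rewrite -[true%:R]mulr1.
  by apply: cvgM; apply: flat1_cvg; rewrite subr_gt0.
rewrite memNset ?in_itv//=; last by rewrite in_itv/=; apply/negP.
under eq_fun do rewrite cutoff_out//.
exact: cvg_cst.
Qed.

End Smooth.

Lemma test_function_cutoff {R : realType} (L a b : R) n : 0 < a -> b < L ->
  test_function L (cutoff a b n).
Proof.
move=> a0 bL; split.
  by move=> m x; apply: nsmooth_derive1n; exact: nsmooth_cutoff.
exists a, b; split => // x; rewrite in_itv/= => h; apply: cutoff_out.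
by apply: contra h => /andP[/ltW -> /ltW ->].
Qed.

(** * The inner product of square integrable functions *)

Section RealIntegrable.
Context {R : realType}.
Local Notation mu := (@lebesgue_measure R).
Implicit Types (D : set R) (f g : R -> R).

Lemma le_integrableR D f g : measurable D -> measurable_fun D f ->
  mu.-integrable D (EFin \o g) -> (forall x : R, D x -> `|f x| <= g x) ->
  mu.-integrable D (EFin \o f).
Proof.
move=> mD mf ig fg; apply: (@le_integrable _ _ _ mu D mD _ (EFin \o g)) => //.
  exact/measurable_EFinP.
by move=> x Dx /=; rewrite lee_fin (le_trans (fg _ Dx))// ler_norm.
Qed.

Lemma integrable_mkcondR D f : measurable D ->
  mu.-integrable D (EFin \o f) <-> mu.-integrable setT (EFin \o (f \_ D)).
Proof.
move=> mD; rewrite -restrict_EFin; exact: (@integrable_mkcond _ _ _ mu D).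
Qed.

Lemma integrable_measR D f : mu.-integrable D (EFin \o f) -> measurable_fun D f.
Proof. by move=> /integrableP[/measurable_EFinP]. Qed.

End RealIntegrable.

Section L2Theory.
Context {R : realType}.
Variable L : R.
Local Notation mu := (@lebesgue_measure R).
Local Notation Omega := `]0, L[%classic.
Local Notation inner := (L2_inner L).
Local Notation N := (nnorm (L2 L)).
Local Notation inL2 := (carrier (L2 L)).
Implicit Types f g h : R -> R.

Lemma L2P f : inL2 f <-> measurable_fun Omega f /\
  mu.-integrable Omega (EFin \o (fun x => f x ^+ 2)).
Proof.
rewrite /=; split.
- move=> Lf; have := Lf; rewrite inE => /andP[/[!inE]/= mf _].
  split; first exact/measurable_restrictT.
  have := Lfun2_integrable_sqr Lf.
  move=> h; apply/integrable_mkcondR => //; move: h.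
  congr (mu.-integrable _ _); apply/funext => x /=; congr EFin.
  by rewrite !patchE; case: ifPn => // _; rewrite expr0n.
- move=> [mf if2]; rewrite inE; apply/andP; split; rewrite inE/=.
    have [h _] := measurable_restrictT f (measurable_itv `]0, L[); exact: h.
  rewrite /finite_norm unlock; apply: poweR_lty.
  have /integrableP[_] := if2; apply: le_lt_trans.
  rewrite [leRHS]integral_mkcond; rewrite le_eqVlt; apply/predU1P; left.
  apply: eq_integral => x _ /=.
  rewrite !patchE; case: ifPn => _ /=; last first.
    by rewrite normr0 powR0.
  by rewrite powR_mulrn// normrX.
Qed.

Lemma nnormL2E f : N f = Num.sqrt (inner f f).
Proof.
rewrite /= unlock fine_poweR -powR12_sqrt; last first.
  by apply: Rintegral_ge0 => x _; rewrite -expr2 sqr_ge0.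
congr (_ `^ _); rewrite /L2_inner /Rintegral [in RHS]integral_mkcond.
congr fine; apply: eq_integral => x _ /=.
rewrite !patchE; case: ifPn => _ /=; last by rewrite normr0 powR0.
by rewrite powR_mulrn// -normrX ger0_norm ?sqr_ge0// expr2.
Qed.

Lemma inL2_meas f : inL2 f -> measurable_fun Omega f.
Proof. by move=> /L2P[]. Qed.

Lemma L2_mul_integrable f g : inL2 f -> inL2 g ->
  mu.-integrable Omega (EFin \o (fun x => f x * g x)).
Proof.
move=> /L2P[mf if2] /L2P[mg ig2].
have ifg : mu.-integrable Omega (EFin \o (fun x => f x ^+ 2 + g x ^+ 2)).
  have -> : EFin \o (fun x => f x ^+ 2 + g x ^+ 2) =
    ((EFin \o (fun x => f x ^+ 2)%R) \+ (EFin \o (fun x => g x ^+ 2)%R))%E.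
    by apply/funext => x /=; rewrite EFinD.
  exact: integrableD.
apply: le_integrableR ifg _ => //; first exact: measurable_funM.
move=> x _ /=; rewrite normrM.
rewrite -[f x ^+ 2]real_normK ?num_real// -[g x ^+ 2]real_normK ?num_real//.
have := sqr_ge0 (`|f x| - `|g x|); have := sqr_ge0 (`|f x| + `|g x|); nra.
Qed.

(** Comparison is between absolute values, so that this also serves for
    products with bounded functions. *)
Lemma inL2_dom f g : measurable_fun Omega f -> inL2 g ->
  (forall x, Omega x -> `|f x| <= `|g x|) -> inL2 f.
Proof.
move=> mf /L2P[mg ig2] fg; apply/L2P; split => //.
apply: le_integrableR ig2 _ => //; first exact: measurable_funX.
move=> x Ox /=; rewrite normrX -[leRHS]real_normK ?num_real//.
by rewrite lerXn2r ?nnegrE//; exact: fg.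
Qed.

Lemma inL2Z c f : inL2 f -> inL2 (fun x => c * f x).
Proof.
move=> /L2P[mf if2]; apply/L2P; split; first exact: measurable_funM.
have -> : EFin \o (fun x => (c * f x) ^+ 2) =
    (fun x => (c ^+ 2)%:E * (EFin \o (fun x => (f x ^+ 2)%R)) x)%E.
  by apply/funext => x /=; rewrite exprMn EFinM.
exact: integrableZl.
Qed.

Lemma inL2D f g : inL2 f -> inL2 g -> inL2 (f + g).
Proof.
move=> Lf Lg; have := Lf; have := Lg => /L2P[mg ig2] /L2P[mf if2].
apply/L2P; split; first exact: measurable_funD.
have -> : EFin \o (fun x => (f + g) x ^+ 2) =
    ((EFin \o (fun x => f x ^+ 2)%R) \+ (EFin \o (fun x => g x ^+ 2)%R) \+
     (fun x => 2%:E * (EFin \o (fun x => (f x * g x)%R)) x))%E.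
  by apply/funext => x /=; rewrite -!EFinM -!EFinD; congr EFin; rewrite sqrrD mulr_natl; ring.
apply: integrableD => //; first exact: integrableD.
by apply: integrableZl => //; exact: L2_mul_integrable.
Qed.

Lemma inL2N f : inL2 f -> inL2 (- f).
Proof.
by move=> /(inL2Z (-1)); congr inL2; apply/funext => x /=; rewrite mulN1r.
Qed.

Lemma inL2B f g : inL2 f -> inL2 g -> inL2 (f - g).
Proof. by move=> Lf Lg; apply: inL2D => //; exact: inL2N. Qed.

Lemma inL2_bounded f (C : R) : measurable_fun Omega f ->
  (forall x : R, Omega x -> `|f x| <= C) -> inL2 f.
Proof.
move=> mf fC; apply/L2P; split => //.
apply: measurable_bounded_integrable => //.
- have : (mu Omega < +oo)%E; last by [].
  by rewrite lebesgue_measure_itv/=; case: ifP => _; rewrite ?ltry// -EFinB ltry.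
- exact: measurable_funX.
exists (C ^+ 2); split; first by rewrite num_real.
move=> M CM x Ox; apply: le_trans (ltW CM).
by rewrite normrX lerXn2r ?nnegrE// ?fC// (le_trans _ (fC _ Ox)).
Qed.

Lemma inL2_cst c : inL2 (cst c).
Proof. by apply: (@inL2_bounded _ `|c|). Qed.

Lemma inL2_mulb f (b : R -> R) (C : R) : inL2 f -> measurable_fun Omega b ->
  (forall x : R, Omega x -> `|b x| <= C) -> inL2 (fun x => b x * f x).
Proof.
move=> Lf mb bC.
apply: (inL2_dom _ (inL2Z C Lf)).
  by apply: measurable_funM => //; exact: inL2_meas.
by move=> x Ox; rewrite !normrM ler_wpM2r// (le_trans (bC _ Ox))// ler_norm.
Qed.

Lemma inL2_integrable f : inL2 f -> mu.-integrable Omega (EFin \o f).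
Proof.
move=> Lf; have := L2_mul_integrable Lf (inL2_cst 1).
by congr (mu.-integrable _ _); apply/funext => x /=; rewrite mulr1.
Qed.

Lemma innerC f g : inner f g = inner g f.
Proof. by apply: eq_Rintegral => x _; rewrite mulrC. Qed.

Lemma inner0r f : inner f (cst 0) = 0.
Proof.
rewrite /L2_inner (@eq_Rintegral _ _ _ _ _ (cst 0)) ?Rintegral_cst ?mul0r//.
by move=> x _; rewrite mulr0.
Qed.

Lemma innerDl f g h : inL2 f -> inL2 g -> inL2 h ->
  inner (f + g) h = inner f h + inner g h.
Proof.
move=> Lf Lg Lh; rewrite /L2_inner -RintegralD//; try exact: L2_mul_integrable.
by apply: eq_Rintegral => x _; rewrite -mulrDl.
Qed.

Lemma innerZl c f g : inL2 f -> inL2 g -> inner (fun x => c * f x) g = c * inner f g.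
Proof.
move=> Lf Lg; rewrite /L2_inner -RintegralZl//; last exact: L2_mul_integrable.
by apply: eq_Rintegral => x _; rewrite mulrA.
Qed.

Lemma innerNl f g : inL2 f -> inL2 g -> inner (- f) g = - inner f g.
Proof.
move=> Lf Lg; rewrite -[RHS]mulN1r -(innerZl _ Lf Lg).
by apply: eq_Rintegral => x _; rewrite mulN1r.
Qed.

Lemma innerBl f g h : inL2 f -> inL2 g -> inL2 h ->
  inner (f - g) h = inner f h - inner g h.
Proof. by move=> Lf Lg Lh; rewrite innerDl ?innerNl//; exact: inL2N. Qed.

Lemma innerDr f g h : inL2 f -> inL2 g -> inL2 h ->
  inner h (f + g) = inner h f + inner h g.
Proof. by move=> Lf Lg Lh; rewrite !(innerC h) innerDl. Qed.

Lemma innerZr c f g : inL2 f -> inL2 g -> inner g (fun x => c * f x) = c * inner g f.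
Proof. by move=> Lf Lg; rewrite !(innerC g) innerZl. Qed.

Lemma innerNr f g : inL2 f -> inL2 g -> inner g (- f) = - inner g f.
Proof. by move=> Lf Lg; rewrite !(innerC g) innerNl. Qed.

Lemma innerBr f g h : inL2 f -> inL2 g -> inL2 h ->
  inner h (f - g) = inner h f - inner h g.
Proof. by move=> Lf Lg Lh; rewrite !(innerC h) innerBl. Qed.

Definition ae_on f g := {ae mu, forall x, Omega x -> f x = g x}.

Lemma inner_ael f f' g : ae_on f f' -> inner f g = inner f' g.
Proof.
by move=> ff; apply: ae_eq_Rintegral_nomeas => //; apply: ae_imply ff => x /[apply] ->.
Qed.

Lemma inner_aer f f' g : ae_on f f' -> inner g f = inner g f'.
Proof. by move=> ff; rewrite !(innerC g); exact: inner_ael. Qed.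

Lemma L2norm_ae f g : ae_on f g -> N f = N g.
Proof. by move=> fg; rewrite !nnormL2E (inner_ael _ fg) (inner_aer _ fg). Qed.

Lemma inner_ge0 f : 0 <= inner f f.
Proof. by apply: Rintegral_ge0 => x _; rewrite -expr2 sqr_ge0. Qed.

Lemma L2norm_ge0 f : 0 <= N f.
Proof. by rewrite nnormL2E sqrtr_ge0. Qed.

Lemma L2norm_sqr f : N f ^+ 2 = inner f f.
Proof. by rewrite nnormL2E sqr_sqrtr// inner_ge0. Qed.

(** The quadratic form in two variables avoids dividing by a coefficient that may
    vanish. *)
Lemma discriminant_le (a b c : R) :
  (forall s t, 0 <= s ^+ 2 * a - 2 * s * t * b + t ^+ 2 * c) -> b ^+ 2 <= a * c.
Proof.
move=> H; have c0 : 0 <= c by have := H 0 1; rewrite expr0n/= expr1n; lra.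
have a0 : 0 <= a by have := H 1 0; rewrite expr0n/= expr1n; lra.
move: c0; rewrite le_eqVlt => /predU1P[c0|c0].
  (* for c = 0 this choice yields 0 <= - (a + 2) * b ^ 2 *)
  have := H b (a + 1); rewrite -c0 !mulr0 addr0 => h.
  have b0 := sqr_ge0 b; nra.
have := H c b => h.
have : 0 <= c * (a * c - b ^+ 2) by move: h; congr (_ <= _); ring.
by rewrite pmulr_rge0// subr_ge0.
Qed.

Lemma cauchy_schwarz f g : inL2 f -> inL2 g -> `|inner f g| <= N f * N g.
Proof.
move=> Lf Lg; rewrite !nnormL2E -sqrtrM ?inner_ge0// -sqrtr_sqr ler_wsqrtr//.
apply: discriminant_le => s t.
have := inner_ge0 ((fun x => s * f x) - (fun x => t * g x)).
have Ls := inL2Z s Lf; have Lt := inL2Z t Lg.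
rewrite innerBl ?innerBr//; try exact: inL2B.
rewrite !innerZl ?innerZr// (innerC g f); move: (inner f f) (inner f g) (inner g g) => a b c.
by congr (_ <= _); ring.
Qed.

Lemma ler_inner f g : inL2 f -> inL2 g -> inner f g <= N f * N g.
Proof. by move=> Lf Lg; rewrite (le_trans (ler_norm _))// cauchy_schwarz. Qed.

Lemma L2normD f g : inL2 f -> inL2 g -> N (f + g) <= N f + N g.
Proof.
move=> Lf Lg; rewrite -(@ler_pXn2r _ 2)// ?nnegrE ?addr_ge0 ?L2norm_ge0//.
rewrite L2norm_sqr innerDl ?innerDr//; try exact: inL2D.
have := ler_inner Lf Lg; rewrite (innerC g f) sqrrD !L2norm_sqr; lra.
Qed.

Lemma L2normZ c f : inL2 f -> N (fun x => c * f x) = `|c| * N f.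
Proof.
move=> Lf; rewrite !nnormL2E innerZl ?innerZr//; last exact: inL2Z.
by rewrite mulrA -expr2 sqrtrM ?sqr_ge0// sqrtr_sqr.
Qed.

Lemma L2normN f : N (- f) = N f.
Proof.
rewrite !nnormL2E; congr Num.sqrt; apply: eq_Rintegral => x _.
by rewrite mulrNN.
Qed.

Lemma L2norm_distC f g : N (f - g) = N (g - f).
Proof. by rewrite -L2normN opprB. Qed.

Lemma L2norm_lipschitz f g : inL2 f -> inL2 g -> `|N f - N g| <= N (f - g).
Proof.
move=> Lf Lg.
have h1 : N f <= N (f - g) + N g by rewrite -{1}[f](subrK g) L2normD//; exact: inL2B.
have h2 : N g <= N (f - g) + N f.
  by rewrite L2norm_distC -{1}[g](subrK f) L2normD//; exact: inL2B.
by rewrite ler_norml; apply/andP; split; lra.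
Qed.

Lemma le_L2norm f g : inL2 g -> measurable_fun Omega f ->
  (forall x, Omega x -> `|f x| <= `|g x|) -> N f <= N g.
Proof.
move=> Lg mf fg; have Lf := inL2_dom mf Lg fg.
rewrite !nnormL2E ler_wsqrtr// le_Rintegral//; try exact: L2_mul_integrable.
move=> x Ox; rewrite -!expr2 -[leLHS]real_normK ?num_real//.
by rewrite -[leRHS]real_normK ?num_real// lerXn2r ?nnegrE//; exact: fg.
Qed.

Lemma L2norm_cst c : 0 <= L -> N (cst c) = `|c| * Num.sqrt L.
Proof.
move=> L0; rewrite nnormL2E.
have -> : inner (cst c) (cst c) = \int[mu]_(x in Omega) (c * c) by [].
rewrite Rintegral_cst//= lebesgue_measure_itv/= lte_fin -expr2 sqrtrM ?sqr_ge0// sqrtr_sqr; congr (_ * Num.sqrt _).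
case: ltP => h /=; first by rewrite oppr0 addr0.
by apply/eqP; rewrite eq_le L0 h.
Qed.

Lemma L2norm_le_bound f (C : R) : 0 <= L -> measurable_fun Omega f ->
  (forall x : R, Omega x -> `|f x| <= C) -> 0 <= C -> N f <= C * Num.sqrt L.
Proof.
move=> L0 mf fC C0; rewrite -[C]ger0_norm// -L2norm_cst//; apply: le_L2norm => //.
  exact: inL2_cst.
by move=> x Ox; rewrite /= (ger0_norm C0); exact: fC.
Qed.

Lemma inner_eq0 f : inL2 f -> inner f f = 0 -> ae_on f (cst 0).
Proof.
move=> Lf; rewrite /L2_inner /Rintegral => /eqP.
have If := L2_mul_integrable Lf Lf.
rewrite fine_eq0 ?integrable_fin_num// => /eqP h.
have := (ae_eq_integral_abs mu (measurable_itv `]0, L[) (measurable_int mu If)).1.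
have -> : (\int[mu]_(x in Omega) `|(EFin \o (fun x => (f x * f x)%R)) x| = 0)%E.
  rewrite -[RHS]h; apply: eq_integral => x _ /=.
  by rewrite ger0_norm// -expr2 sqr_ge0.
move=> /(_ erefl); apply: ae_imply => x /[apply] /= -[] /eqP.
by rewrite mulf_eq0 orbb => /eqP.
Qed.

End L2Theory.

(** * Functions determined by their test integrals *)

Section Intervals.
Context {R : realType}.
Local Notation mu := (@lebesgue_measure R).
Implicit Types f g : R -> R.

(** The primitive of [f] is constant on the interval, and by Lebesgue's
    differentiation theorem its derivative is [f] almost everywhere. *)
Lemma ae0_of_itv (c d : R) f : mu.-integrable `]c, d[ (EFin \o f) ->
  (forall a b, c < a -> a < b -> b < d -> \int[mu]_(x in `]a, b[) f x = 0) ->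
  {ae mu, forall x, c < x < d -> f x = 0}.
Proof.
move=> intf f0; pose g := f \_ `]c, d[.
have intg : mu.-integrable setT (EFin \o g) by exact: (integrable_mkcondR f (measurable_itv _)).1 intf.
have sub (A : set R) : measurable A -> mu.-integrable A (EFin \o g).
  by move=> mA; exact: (integrableS (mu := mu) measurableT mA).
have locg : locally_integrable [set: R] g by exact: integrable_locally.
have := FTC1Ny (fun y => sub `]-oo, y]%classic (measurable_itv _)) locg.
set F := fun x => \int[mu]_(t in _) _.
apply: ae_imply => x [dF F'] /andP[cx xd].
have step y z : c < y -> y < z -> z < d -> F y = F z.
  move=> cy yz zd; apply/eqP; rewrite eq_sym -subr_eq0; apply/eqP.
  rewrite /F (@Rintegral_itvB _ g (BInfty _ true) (BRight z) y)//.
  - rewrite -(Rintegral_itv_bndo_bndc (a := BRight y)); last exact: sub.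
    rewrite -[RHS](f0 y z)//; apply: eq_Rintegral => t.
    rewrite inE/= in_itv/= => /andP[yt tz].
    by rewrite /g patchE mem_set//= in_itv/= (lt_trans cy yt) (lt_trans tz zd).
  - exact: sub.
  - by rewrite bnd_simp ltW.
have -> : f x = g x by rewrite /g patchE mem_set//= in_itv/= cx xd.
rewrite -F' derive1E.
rewrite -(@near_eq_derive _ _ _ (cst (F x)) F).
  by rewrite derive_cst.
near=> y; rewrite /=.
have cy : c < y by near: y; exact: lt_nbhsr.
have yd : y < d by near: y; exact: lt_nbhsl.
by have [xy|yx|->//] := ltgtP x y; [|apply/esym]; apply: step.
Unshelve. all: by end_near. Qed.

End Intervals.

Section Sobolev.
Context {R : realType}.
Variable L : R.
Hypothesis L0 : 0 < L.
Local Notation mu := (@lebesgue_measure R).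
Local Notation Omega := `]0, L[%classic.
Local Notation inner := (L2_inner L).
Local Notation N := (nnorm (L2 L)).
Local Notation inL2 := (carrier (L2 L)).
Local Notation test := (test_function L).
Local Notation ae_on := (ae_on L).
Implicit Types f g u v phi : R -> R.

Lemma ae_on_refl f : ae_on f f. Proof. by apply: aeW => x. Qed.

Lemma ae_on_sym f g : ae_on f g -> ae_on g f.
Proof. by apply: ae_imply => x /[apply] ->. Qed.

Lemma ae_on_trans g f h : ae_on f g -> ae_on g h -> ae_on f h.
Proof. by apply: ae_imply2 => x fg gh Ox; rewrite fg// gh. Qed.

Lemma ae_onD f f' g g' : ae_on f f' -> ae_on g g' -> ae_on (f + g) (f' + g').
Proof.
by apply: ae_imply2 => x fg gh Ox; rewrite /GRing.add/= fg// gh.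
Qed.

Lemma ae_onB f f' g g' : ae_on f f' -> ae_on g g' -> ae_on (f - g) (f' - g').
Proof.
by apply: ae_imply2 => x fg gh Ox; rewrite /GRing.add/= /GRing.opp/= fg// gh.
Qed.

Lemma continuous_inL2 f : continuous f -> inL2 f.
Proof.
move=> cf; apply/L2P; split.
  exact: measurable_funS (continuous_measurable_fun cf).
apply: (@integrableS _ _ _ mu `[0, L]) => //; first exact: subset_itv_oo_cc.
apply: continuous_compact_integrable; first exact: segment_compact.
apply: continuous_subspaceT => x; apply: continuousM; exact: cf.
Qed.

Lemma derivable_cont f : (forall x, derivable f x 1) -> continuous f.
Proof. by move=> df x; apply/differentiable_continuous/derivable1_diffP. Qed.

Lemma test_cont phi : test phi -> continuous phi.
Proof. by move=> [d _]; apply: derivable_cont => x; exact: (d 0%N). Qed.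

Lemma test_cont' phi : test phi -> continuous (derive1 phi).
Proof. by move=> [d _]; apply: derivable_cont => x; exact: (d 1%N). Qed.

Lemma test_inL2 phi : test phi -> inL2 phi.
Proof. by move=> /test_cont; exact: continuous_inL2. Qed.

Lemma test_inL2' phi : test phi -> inL2 (derive1 phi).
Proof. by move=> /test_cont'; exact: continuous_inL2. Qed.

(** A test function vanishes at [L]. *)
Lemma test_FTC phi y : test phi -> y < L ->
  \int[mu]_(x in `]y, L[) derive1 phi x = - phi y.
Proof.
move=> tphi yL; have [d [a [b [a0 bL out]]]] := tphi.
have cphi := test_cont tphi.
have := @continuous_FTC2 R (derive1 phi) phi y L yL.
rewrite (out L) ?sub0e; last by rewrite in_itv/= [L <= b]leNgt bL andbF.
move=> h; rewrite /Rintegral integral_itv_bndo_bndc; last first.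
  apply/measurable_EFinP.
  exact: measurable_funS (continuous_measurable_fun (test_cont' tphi)).
rewrite integral_itv_obnd_cbnd; last first.
  apply/measurable_EFinP.
  exact: measurable_funS (continuous_measurable_fun (test_cont' tphi)).
rewrite h// ?sub0e//.
- exact/continuous_subspaceT/test_cont'.
- split.
  + by move=> x _; exact: (d 0%N).
  + exact/cvg_at_right_filter/cphi.
  + exact/cvg_at_left_filter/cphi.
Qed.

Lemma cutoff_inL2 a b n : inL2 (cutoff a b n).
Proof.
apply: continuous_inL2; apply: derivable_cont => x.
exact: (@nsmooth_derive1n _ 0 _ (nsmooth_cutoff 1 a b n)).
Qed.

(** The cutoffs converge to the indicator of a subinterval and [|u|] dominates,
    so all integrals of [u] over subintervals vanish. The statement is local, for
    use on a single cell. *)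
Lemma fundamental_lemma (c d : R) u : 0 <= c -> d <= L ->
  mu.-integrable Omega (EFin \o u) ->
  (forall a b n, c < a -> a < b -> b < d -> inner u (cutoff a b n) = 0) ->
  {ae mu, forall x, c < x < d -> u x = 0}.
Proof.
move=> c0 dL iu u0.
have mu' : measurable_fun Omega u := integrable_measR iu.
apply: ae0_of_itv => [|a b ca ab bd].
  apply: integrableS iu => //.
  by apply: subset_itv; rewrite bnd_simp.
have a0 : 0 < a := le_lt_trans c0 ca.
have bL : b < L := lt_le_trans bd dL.
have mb n : measurable_fun Omega (cutoff a b n) by exact: inL2_meas (cutoff_inL2 _ _ _).
have sub : `]a, b[ `<=` Omega by apply: subset_itv; rewrite bnd_simp ltW.
have mub n : measurable_fun Omega (EFin \o (fun x => u x * cutoff a b n x)).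
  by apply/measurable_EFinP; exact: measurable_funM.
have mui : measurable_fun Omega (EFin \o (fun x => u x * \1_(`]a, b[%classic) x)).
  by apply/measurable_EFinP; apply: measurable_funM.
have cvg : {ae mu, forall x, Omega x ->
    (EFin \o (fun x => u x * cutoff a b n x)) x @[n --> \oo] -->
    (EFin \o (fun x => u x * \1_(`]a, b[%classic) x)) x}.
  apply: aeW => x Ox; apply/fine_cvgP; split; first exact: nearW.
  by apply: cvgM; [exact: cvg_cst|exact: cutoff_cvg].
have dom : {ae mu, forall x n, Omega x ->
    (`|(EFin \o (fun x => (u x * cutoff a b n x)%R)) x| <= (EFin \o (fun x => `|u x|%R)) x)%E}.
  apply: aeW => x n Ox /=; rewrite lee_fin.
  by rewrite normrM ler_piMr// ger0_norm ?cutoff_ge0 ?cutoff_le1.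
have [_ _ h] := @dominated_convergence _ _ _ mu Omega (measurable_itv _) _ _ _
  mub mui cvg (integrable_norm iu) dom.
have E n : (\int[mu]_(x in Omega) (EFin \o (fun x => (u x * cutoff a b n x)%R)) x = 0)%E.
  have := u0 a b n ca ab bd; rewrite /L2_inner /Rintegral => /eqP.
  rewrite fine_eq0 ?integrable_fin_num// => [/eqP //|].
  apply: le_integrableR (integrable_norm iu) _ => //.
    by apply: measurable_funM.
  by move=> x _ /=; rewrite normrM ler_piMr// ger0_norm ?cutoff_ge0 ?cutoff_le1.
rewrite /Rintegral.
have -> : (\int[mu]_(x in `]a, b[) (u x)%:E)%E =
    (\int[mu]_(x in Omega) (EFin \o (fun x => (u x * \1_(`]a, b[%classic) x)%R)) x)%E.
  rewrite -{1}(setIidr sub) integral_mkcondr; apply: eq_integral => x _.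
  by rewrite /= indicE patchE; case: ifPn => _; rewrite ?mulr1 ?mulr0.
suff -> : (\int[mu]_(x in Omega) (EFin \o (fun x => (u x * \1_(`]a, b[%classic) x)%R)) x = 0)%E by [].
have : (0%E @[n --> \oo] --> (\int[mu]_(x in Omega) (EFin \o (fun x => (u x * \1_(`]a, b[%classic) x)%R)) x)%E).
  rewrite (_ : (fun=> 0%E) = (fun n => (\int[mu]_(x in Omega) (EFin \o (fun x => (u x * cutoff a b n x)%R)) x)%E)); last first.
    by apply/funext => n; rewrite E.
  exact: h.
by move=> /cvg_lim <- //; rewrite lim_cst.
Qed.

Lemma fundamental_lemma_Omega u : mu.-integrable Omega (EFin \o u) ->
  (forall a b n, 0 < a -> a < b -> b < L -> inner u (cutoff a b n) = 0) ->
  ae_on u (cst 0).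
Proof.
move=> iu u0; have := fundamental_lemma (lexx 0) (lexx L) iu u0.
by apply: ae_imply => x h; rewrite /= in_itv/=.
Qed.

(** The zero mean makes the primitive vanish to the right of [b]. *)
Lemma smooth_antiderivative (a b : R) phi : 0 < a -> b < L ->
  (forall n, nsmooth n phi) -> (forall x, x \notin `[a, b] -> phi x = 0) ->
  \int[mu]_(x in Omega) phi x = 0 ->
  exists2 Phi, test Phi & derive1 Phi = phi.
Proof.
move=> a0 bL sphi out int0.
have cphi : continuous phi.
  by apply: derivable_cont => x; exact: (@nsmooth_derive1n _ 0 _ (sphi 1%N)).
have iphi0 : mu.-integrable `[0, L] (EFin \o phi).
  apply: continuous_compact_integrable; first exact: segment_compact.
  exact: continuous_subspaceT.
have iphi : mu.-integrable setT (EFin \o phi).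
  have := (integrable_mkcondR phi (measurable_itv `[0, L])).1 iphi0.
  congr (mu.-integrable _ _); apply/funext => x /=; congr EFin.
  rewrite patchE; case: ifPn => //; rewrite notin_setE/= in_itv/= => h.
  rewrite out//; apply/negP; rewrite in_itv/= => /andP[ax xb]; apply: h.
  by rewrite (le_trans (ltW a0) ax) (le_trans xb (ltW bL)).
have iA (A : set R) : measurable A -> mu.-integrable A (EFin \o phi).
  by move=> mA; exact: (integrableS (mu := mu) measurableT mA).
pose Phi x := \int[mu]_(t in `]-oo, x]) phi t.
have dPhi (x : R) : is_derive x (1 : R) Phi (phi x).
  have x1 : x < x + 1 by rewrite ltrDl.
  have [h1 h2] := @continuous_FTC1 R phi (BInfty _ true) x (x + 1) x1
    (iA _ (measurable_itv _)) (ltNyr _) (cphi x).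
  by apply: DeriveDef; [exact: h1|rewrite -derive1E; exact: h2].
exists Phi; last first.
  by apply/funext => x; rewrite derive1E; exact: derive_val.
split; first by move=> n; apply: nsmooth_derive1n => //; exists phi.
exists a, b; split => // x; rewrite in_itv/= negb_and -!ltNge => /orP[xa|bx].
  rewrite /Phi (@eq_Rintegral _ _ _ _ _ (cst 0)) ?Rintegral_cst ?mul0r// => t.
  rewrite inE/= in_itv/= => tx.
  by rewrite out// in_itv/= leNgt (le_lt_trans tx xa).
rewrite -int0 /Phi Rintegral_mkcond [RHS]Rintegral_mkcond.
apply: eq_Rintegral => t _; rewrite !patchE.
have [tab|tab] := boolP (t \in `[a, b]); last first.
  by rewrite !(out _ tab); case: ifP; case: ifP.
move: tab; rewrite in_itv/= => /andP[at_ tb].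
rewrite !mem_set//= in_itv/= ?(lt_le_trans a0)//= ?(le_lt_trans tb)//.
by rewrite (le_trans tb)// ltW.
Qed.

(** A cutoff with zero integral would vanish almost everywhere, although it is
    positive on an interval. *)
Lemma cutoff_mass (a b : R) : 0 < a -> a < b -> b < L ->
  \int[mu]_(x in Omega) cutoff a b 0 x != 0.
Proof.
move=> a0 ab bL; apply/eqP => h.
have ib := inL2_integrable (cutoff_inL2 a b 0).
have := (ae_eq_integral_abs mu (measurable_itv `]0, L[) (measurable_int mu ib)).1.
have -> : (\int[mu]_(x in Omega) `|(EFin \o cutoff a b 0) x| = 0)%E.
  move/eqP: h; rewrite /Rintegral fine_eq0 ?integrable_fin_num// => /eqP h.
  rewrite -[RHS]h; apply: eq_integral => x _ /=.
  by rewrite ger0_norm// cutoff_ge0.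
move=> /(_ erefl) [Z [mZ Z0 hZ]].
have sub : `]a, b[ `<=` Z.
  move=> x /=; rewrite in_itv/= => xab; apply: hZ => /= hx.
  have /andP[ax xb] := xab.
  have Ox : Omega x by rewrite /= in_itv/= (lt_trans a0 ax) (lt_trans xb bL).
  have := cutoff_gt0 0 xab; have [->] := hx Ox.
  by rewrite ltxx.
have : (mu `]a, b[ <= mu Z)%E by apply: le_measure; rewrite ?inE.
have -> : mu Z = 0%E by [].
by rewrite lebesgue_measure_itv/= lte_fin ab -EFinB lee_fin subr_le0 leNgt ab.
Qed.

(** Fix a cutoff [psi] and let [c] be the mean of [u] weighted by [psi]. Every
    other cutoff differs from a multiple of [psi] by the derivative of a test
    function, so [u - c] is orthogonal to all cutoffs. *)
Lemma du_bois_reymond u : inL2 u ->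
  (forall phi, test phi -> inner u (derive1 phi) = 0) ->
  exists c, ae_on u (cst c).
Proof.
move=> Lu u0.
pose psi := cutoff (L / 4) (L / 2) 0.
have q1 : 0 < L / 4 by rewrite divr_gt0.
have q2 : L / 4 < L / 2 by lra.
have q3 : L / 2 < L by lra.
have := cutoff_mass q1 q2 q3; rewrite -/psi.
set Z := \int[mu]_(x in _) _ => Z0.
have Lpsi : inL2 psi := cutoff_inL2 _ _ _.
pose c := inner u psi / Z; exists c.
suff : ae_on (u - cst c) (cst 0).
  apply: ae_imply => x /[apply]; rewrite /GRing.add/= /GRing.opp/= => /eqP.
  by rewrite subr_eq0 => /eqP.
have Lc := inL2_cst L c.
apply: fundamental_lemma_Omega; first exact: inL2_integrable (inL2B _ _).
move=> a b n a0 ab bL.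
set eta := cutoff a b n; have Leta : inL2 eta := cutoff_inL2 _ _ _.
pose k := \int[mu]_(x in Omega) eta x / Z.
(* k gives phi integral zero *)
pose phi : R -> R := eta - (cst k * psi).
have sphi m : nsmooth m phi.
  have -> : phi = eta + cst (- k) * psi.
    by apply/funext => x; rewrite /phi /GRing.add/= /GRing.opp/= /GRing.mul/= mulNr.
  apply: nsmoothD; first exact: nsmooth_cutoff.
  by apply: nsmoothM; [exact: nsmooth_cst|exact: nsmooth_cutoff].
have [Phi tPhi dPhi] : exists2 Phi, test Phi & derive1 Phi = phi.
  apply: (@smooth_antiderivative (Num.min a (L / 4)) (Num.max b (L / 2))) => //.
  - by rewrite lt_min a0.
  - by rewrite gt_max bL.
  - move=> x; rewrite in_itv/= ge_min le_max negb_and !negb_or -!ltNge => hx.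
    rewrite /phi /GRing.add/= /GRing.opp/= /GRing.mul/= /eta /psi !cutoff_out ?mulr0 ?subr0//.
      by apply/negP => /andP[h1 h2]; move: hx => /orP[] /andP[h3 h4]; lra.
    by apply/negP => /andP[h1 h2]; move: hx => /orP[] /andP[h3 h4]; lra.
  - rewrite /phi (_ : (fun x => _) = (fun x => eta x - k * psi x))//.
    rewrite RintegralB//; [|exact: inL2_integrable|exact: inL2_integrable (inL2Z _ _)].
    rewrite RintegralZl//; last exact: inL2_integrable.
    by rewrite -/Z /k divfK ?subrr.
have := u0 _ tPhi; rewrite dPhi.
have -> : phi = eta - (fun x => k * psi x) by [].
rewrite innerBr// ?innerZr//; last exact: inL2Z.
move=> /eqP; rewrite subr_eq0 => /eqP E.
rewrite innerBl// E.
have -> : inner (cst c) eta = c * \int[mu]_(x in Omega) eta x.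
  by rewrite -RintegralZl//; exact: inL2_integrable.
by rewrite /k /c; ring.
Qed.

End Sobolev.

(** * Primitives and weak derivatives *)

Section Primitive.
Context {R : realType}.
Variable L : R.
Hypothesis L0 : 0 < L.
Local Notation mu := (@lebesgue_measure R).
Local Notation Omega := `]0, L[%classic.
Local Notation inner := (L2_inner L).
Local Notation N := (nnorm (L2 L)).
Local Notation inL2 := (carrier (L2 L)).
Local Notation inH1 := (carrier (H1 L)).
Local Notation ae_on := (ae_on L).
Local Notation wd := (weak_derivative L).
Implicit Types f g h u v phi : R -> R.

(** The kernel of integration from the left endpoint. Writing a primitive as an
    inner product with it gives linearity, the Cauchy-Schwarz bound and Fubini's
    theorem at once. *)
Definition below (x y : R) : R := (y < x)%R%:R.

Definition primitive g (x : R) : R := inner g (below x).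

Lemma measurable_below_pair d (T : measurableType d) (D : set T) (p q : T -> R) :
  measurable_fun D p -> measurable_fun D q ->
  measurable_fun D (fun z => below (p z) (q z)).
Proof.
move=> mp mq.
have -> : (fun z => below (p z) (q z)) = (fun z => if q z < p z then 1 else 0).
  by apply/funext => z; rewrite /below; case: (_ < _).
move=> mD; move: (mD); apply: measurable_fun_if => //; exact: measurable_fun_ltr.
Qed.

Lemma below_ge0 (x y : R) : 0 <= below x y.
Proof. by rewrite /below; case: (_ < _). Qed.

Lemma below_le1 (x y : R) : `|below x y| <= 1.
Proof. by rewrite /below; case: (_ < _); rewrite ?normr1 ?normr0. Qed.

Lemma below_inL2 x : inL2 (below x).
Proof.
apply: (@inL2_bounded _ _ _ 1); last by move=> y _; exact: below_le1.
exact: (@measurable_below_pair _ _ Omega (cst x) id).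
Qed.

Lemma above_inL2 y : inL2 (below^~ y).
Proof.
apply: (@inL2_bounded _ _ _ 1); last by move=> x _; exact: below_le1.
exact: (@measurable_below_pair _ _ Omega id (cst y)).
Qed.

Lemma primitive_ae g g' : ae_on g g' -> primitive g = primitive g'.
Proof. by move=> gg'; apply/funext => x; exact: inner_ael. Qed.

Lemma primitiveD g g' x : inL2 g -> inL2 g' -> primitive (g + g') x = primitive g x + primitive g' x.
Proof. by move=> Lg Lg'; rewrite /primitive innerDl//; exact: below_inL2. Qed.

Lemma primitive_bound g x : inL2 g -> `|primitive g x| <= N g * Num.sqrt L.
Proof.
move=> Lg; apply: (le_trans (cauchy_schwarz Lg (below_inL2 x))).
rewrite ler_wpM2l ?L2norm_ge0// -[leRHS]mul1r; apply: L2norm_le_bound => //.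
- exact: ltW.
- exact: inL2_meas (below_inL2 x).
- by move=> y _; exact: below_le1.
Qed.

Let H h g (z : R * R) : R := (h \_ Omega) z.1 * ((g \_ Omega) z.2 * below z.1 z.2).

Let measurable_H h g : inL2 h -> inL2 g -> measurable_fun setT (EFin \o H h g).
Proof.
move=> /inL2_meas mh /inL2_meas mg; apply/measurable_EFinP.
have [h1 _] := measurable_restrictT h (measurable_itv `]0, L[).
have [g1 _] := measurable_restrictT g (measurable_itv `]0, L[).
apply: measurable_funM.
  exact: measurableT_comp (h1 mh) measurable_fst.
apply: measurable_funM.
  exact: measurableT_comp (g1 mg) measurable_snd.
exact: (@measurable_below_pair _ _ setT fst snd measurable_fst measurable_snd).
Qed.

Let Hx h g x : inL2 g ->
  (\int[mu]_y (EFin \o H h g) (x, y) = ((h \_ Omega) x * primitive g x)%:E)%E.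
Proof.
move=> Lg; have I := L2_mul_integrable Lg (below_inL2 x).
rewrite EFinM /primitive /L2_inner /Rintegral fineK ?integrable_fin_num//.
rewrite -integralZl// integral_mkcond; apply: eq_integral => y _ /=.
rewrite /H /= [(g \_ _) y]patchE [RHS]patchE.
by case: ifPn => _; rewrite ?mul0r ?mulr0 -?EFinM.
Qed.

Let Hy h g y : inL2 h ->
  (\int[mu]_x (EFin \o H h g) (x, y) = ((g \_ Omega) y * inner h (below^~ y))%:E)%E.
Proof.
move=> Lh; have I := L2_mul_integrable Lh (above_inL2 y).
rewrite EFinM /L2_inner /Rintegral fineK ?integrable_fin_num//.
rewrite -integralZl// integral_mkcond; apply: eq_integral => x _ /=.
rewrite /H /= [(h \_ _) x]patchE [RHS]patchE.
by case: ifPn => _; rewrite ?mul0r// -?EFinM mulrCA.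
Qed.

Let abs_inL2 g : inL2 g -> inL2 (fun x => `|g x|).
Proof.
move=> Lg; apply: (inL2_dom _ Lg); last by move=> x _; rewrite normr_id.
by apply: measurableT_comp => //; exact: inL2_meas.
Qed.

Let integrable_H h g : inL2 h -> inL2 g ->
  (mu \x mu)%E.-integrable setT (EFin \o H h g).
Proof.
move=> Lh Lg; apply/integrable12ltyP; first exact: measurable_H.
have Lh' := abs_inL2 Lh; have Lg' := abs_inL2 Lg.
pose C := N (fun x => `|g x|) * Num.sqrt L.
have C0 : 0 <= C by rewrite mulr_ge0 ?L2norm_ge0 ?sqrtr_ge0.
have E x : (\int[mu]_y `|(EFin \o H h g) (x, y)| =
    (((fun x => `|h x|) \_ Omega) x * primitive (fun x => `|g x|) x)%:E)%E.
  rewrite -Hx//; apply: eq_integral => y _ /=; rewrite /H /= !normrM.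
  rewrite (ger0_norm (below_ge0 _ _)) !patchE /=.
  by case: ifPn => _; case: ifPn => _; rewrite ?normr0.
under eq_integral do rewrite E.
have I := inL2_integrable (inL2Z C Lh').
have /integrableP[_ I'] := I; apply: le_lt_trans I'.
rewrite [leRHS]integral_mkcond; apply: ge0_ae_le_integral_nomeas => //.
- move=> x _; rewrite lee_fin mulr_ge0//.
    by rewrite patchE; case: ifPn.
  by apply: Rintegral_ge0 => y _; rewrite mulr_ge0// below_ge0.
- by move=> x _; apply: erestrict_ge0 => y _; exact: abse_ge0.
apply: aeW => x _; rewrite !patchE; case: ifPn => _ /=; last by rewrite mul0r.
rewrite lee_fin normrM normr_id (ger0_norm C0) mulrC ler_wpM2r//.
exact: le_trans (ler_norm _) (primitive_bound _ Lg').
Qed.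

(** Fubini's theorem with first factor 1 says that the partial integrals are
    measurable. *)
Lemma primitive_meas g : inL2 g -> measurable_fun Omega (primitive g).
Proof.
move=> Lg; have I := integrable_fubini_F (integrable_H (inL2_cst L 1) Lg).
have E : fubini_F mu (EFin \o H (cst 1) g) = EFin \o ((primitive g) \_ Omega).
  apply/funext => x; rewrite /fubini_F Hx//= !patchE.
  by case: ifPn => _; rewrite ?mul1r ?mul0r.
have I' : mu.-integrable setT (EFin \o ((primitive g) \_ Omega)) by rewrite -E; exact: I.
have [_] := measurable_restrictT (primitive g) (measurable_itv `]0, L[); apply.
exact: integrable_measR I'.
Qed.

Lemma primitive_inL2 g : inL2 g -> inL2 (primitive g).
Proof.
move=> Lg; apply: (inL2_bounded (primitive_meas Lg)) => x _; exact: primitive_bound.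
Qed.

Lemma L2norm_primitive g : inL2 g -> N (primitive g) <= L * N g.
Proof.
move=> Lg; apply: (@le_trans _ _ (N g * Num.sqrt L * Num.sqrt L)).
  apply: L2norm_le_bound; first exact: ltW.
  - exact: primitive_meas.
  - by move=> x _; exact: primitive_bound.
  - by rewrite mulr_ge0 ?L2norm_ge0 ?sqrtr_ge0.
by rewrite -mulrA -expr2 sqr_sqrtr; [rewrite mulrC|exact: ltW].
Qed.

(** Fubini's theorem for [h x * g y] on the triangle [y < x]. *)
Lemma inner_primitive h g : inL2 h -> inL2 g ->
  inner h (primitive g) = inner g (fun y => inner h (below^~ y)).
Proof.
move=> Lh Lg; have := Fubini (integrable_H Lh Lg).
under eq_integral do rewrite Hx//.
under [RHS]eq_integral do rewrite Hy//.
move=> /(congr1 fine) E; rewrite /L2_inner.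
rewrite [LHS]Rintegral_mkcond [RHS]Rintegral_mkcond.
transitivity (\int[mu]_x ((h \_ Omega) x * primitive g x)).
  by apply: eq_Rintegral => x _; rewrite !patchE; case: ifPn; rewrite ?mul0r.
apply: etrans E _.
by apply: eq_Rintegral => x _; rewrite !patchE; case: ifPn; rewrite ?mul0r.
Qed.

Local Notation iwd := (is_weak_derivative L).

Lemma iwd_primitive g : inL2 g -> iwd (primitive g) g.
Proof.
move=> Lg; split => // phi tphi.
rewrite innerC inner_primitive//; last exact: test_inL2'.
rewrite -innerNr//; last exact: test_inL2.
apply: eq_Rintegral => y; rewrite inE/= in_itv/= => /andP[y0 yL]; congr (_ * _).
rewrite -[RHS](test_FTC tphi yL) /L2_inner.
have sub : `]y, L[ `<=` Omega by apply: subset_itv; rewrite bnd_simp// ltW.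
rewrite -[in RHS](setIidr sub) Rintegral_mkcondr; apply: eq_Rintegral => x.
rewrite inE/= in_itv/= => /andP[_ xL].
rewrite patchE /below; case: ifPn; rewrite ?notin_setE ?inE/= in_itv/= xL andbT => h.
  by rewrite h mulr1.
by move/negP/negbTE: h => ->; rewrite mulr0.
Qed.

Lemma iwdD u u' v v' : inL2 u -> inL2 u' -> iwd u v -> iwd u' v' -> iwd (u + u') (v + v').
Proof.
move=> Lu Lu' [Lv h] [Lv' h']; split; first exact: inL2D.
move=> phi tphi; have t1 := test_inL2 tphi; have t2 := test_inL2' tphi.
by rewrite !innerDl// h// h'// opprD.
Qed.

Lemma iwdZ c u v : inL2 u -> iwd u v -> iwd (fun x => c * u x) (fun x => c * v x).
Proof.
move=> Lu [Lv h]; split; first exact: inL2Z.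
move=> phi tphi; have t1 := test_inL2 tphi; have t2 := test_inL2' tphi.
by rewrite !innerZl// h// mulrN.
Qed.

Lemma iwdN u v : inL2 u -> iwd u v -> iwd (- u) (- v).
Proof.
move=> Lu /(iwdZ (-1) Lu); congr iwd; apply/funext => x; by rewrite mulN1r.
Qed.

Lemma iwdB u u' v v' : inL2 u -> inL2 u' -> iwd u v -> iwd u' v' -> iwd (u - u') (v - v').
Proof. by move=> Lu Lu' uv uv'; apply: iwdD => //; [exact: inL2N|exact: iwdN]. Qed.

Lemma iwd_ae u u' v v' : ae_on u u' -> ae_on v v' -> inL2 v' -> iwd u v -> iwd u' v'.
Proof.
move=> uu vv Lv' [Lv h]; split => // phi tphi.
by rewrite -(inner_ael _ uu) -(inner_ael _ vv) h.
Qed.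

Lemma iwd_cst (c : R) : iwd (cst c) (cst 0).
Proof.
split; first exact: inL2_cst.
move=> phi tphi; have t1 := test_inL2 tphi; have t2 := test_inL2' tphi.
have -> : inner (cst 0) phi = 0.
  rewrite /L2_inner (@eq_Rintegral _ _ _ _ _ (cst 0)) ?Rintegral_cst ?mul0r//.
  by move=> x _; rewrite mul0r.
have -> : inner (cst c) (derive1 phi) = c * \int[mu]_(x in Omega) derive1 phi x.
  by rewrite -RintegralZl//; exact: inL2_integrable.
rewrite (test_FTC tphi L0).
have [_ [a [b [a0 bL ->]]]] := tphi; first by rewrite oppr0 mulr0.
by rewrite in_itv/= leNgt a0.
Qed.

Lemma iwd_unique u v v' : inL2 u -> iwd u v -> iwd u v' -> ae_on v v'.
Proof.
move=> Lu [Lv h] [Lv' h'].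
suff : ae_on (v - v') (cst 0).
  apply: ae_imply => x /[apply]; rewrite /GRing.add/= /GRing.opp/= => /eqP.
  by rewrite subr_eq0 => /eqP.
apply: fundamental_lemma_Omega => //; first exact: inL2_integrable (inL2B Lv Lv').
move=> a b n a0 ab bL; have tb := test_function_cutoff n a0 bL.
have t1 := test_inL2 tb.
by rewrite innerBl//; apply/eqP; rewrite subr_eq0 -eqr_opp -h// -h'.
Qed.

(** The difference between [u] and the primitive of its weak derivative has weak
    derivative zero. *)
Lemma weak_primitive u v : inL2 u -> iwd u v ->
  exists c, ae_on u (fun x => c + primitive v x).
Proof.
move=> Lu uv; have Lv := uv.1.
have LP := primitive_inL2 Lv.
have [c hc] : exists c, ae_on (u - primitive v) (cst c).
  apply: du_bois_reymond => //; first exact: inL2B.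
  move=> phi tphi; have [_ h] := iwdB Lu LP uv (iwd_primitive Lv).
  rewrite h//; have t1 := test_inL2 tphi.
  by rewrite innerBl// subrr oppr0.
exists c; apply: ae_imply hc => x /[apply].
by rewrite (_ : (u - primitive v) x = u x - primitive v x)//= => <-; rewrite subrK.
Qed.

Lemma inH1_inL2 u : inH1 u -> inL2 u. Proof. by case. Qed.

Lemma wdP u : inH1 u -> iwd u (wd u).
Proof. by move=> [_ uv]; exact: getPex. Qed.

Lemma wd_inL2 u : inH1 u -> inL2 (wd u).
Proof. by move=> /wdP[]. Qed.

Lemma iwd_inH1 u v : inL2 u -> iwd u v -> inH1 u.
Proof. by move=> Lu uv; split => //; exists v. Qed.

Lemma wd_ae u v : inL2 u -> iwd u v -> ae_on (wd u) v.
Proof. by move=> Lu uv; exact: (iwd_unique Lu (wdP (iwd_inH1 Lu uv)) uv). Qed.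

Lemma inH1B u v : inH1 u -> inH1 v -> inH1 (u - v).
Proof.
move=> hu hv; apply: iwd_inH1 (iwdB hu.1 hv.1 (wdP hu) (wdP hv)).
by apply: inL2B; [exact: hu.1|exact: hv.1].
Qed.

Lemma inH1_primitive g : inL2 g -> inH1 (primitive g).
Proof. by move=> Lg; exact: iwd_inH1 (primitive_inL2 Lg) (iwd_primitive Lg). Qed.

Lemma wd_primitive g : inL2 g -> ae_on (wd (primitive g)) g.
Proof. by move=> Lg; exact: wd_ae (primitive_inL2 Lg) (iwd_primitive Lg). Qed.

(** The weak derivative is a chosen representative, so it is additive only almost
    everywhere. *)
Lemma wdB u v : inH1 u -> inH1 v -> ae_on (wd (u - v)) (wd u - wd v).
Proof.
move=> hu hv; apply: wd_ae (iwdB hu.1 hv.1 (wdP hu) (wdP hv)).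
by apply: inL2B; [exact: hu.1|exact: hv.1].
Qed.

Lemma nnormH1_ge u : N u <= nnorm (H1 L) u /\ N (wd u) <= nnorm (H1 L) u.
Proof.
split; rewrite /= -[leLHS]ger0_norm ?L2norm_ge0// -sqrtr_sqr ler_wsqrtr//.
  by rewrite lerDl sqr_ge0.
by rewrite lerDr sqr_ge0.
Qed.

Lemma nnormH1_le u : nnorm (H1 L) u <= N u + N (wd u).
Proof.
rewrite /= -[leRHS]ger0_norm ?addr_ge0 ?L2norm_ge0// -sqrtr_sqr ler_wsqrtr// sqrrD.
by rewrite lerD2r lerDl mulrn_wge0// mulr_ge0 ?L2norm_ge0.
Qed.

End Primitive.

(** * Piecewise constants and continuous piecewise affine functions *)

Section FiniteElements.
Context {R : realType}.
Variables (L : R) (s : seq R).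
Hypothesis L0 : 0 < L.
Hypothesis hs : itv_partition 0 L s.
Local Notation mu := (@lebesgue_measure R).
Local Notation Omega := `]0, L[%classic.
Local Notation inner := (L2_inner L).
Local Notation N := (nnorm (L2 L)).
Local Notation inL2 := (carrier (L2 L)).
Local Notation inH1 := (carrier (H1 L)).
Local Notation ae_on := (ae_on L).
Local Notation wd := (weak_derivative L).
Local Notation iwd := (is_weak_derivative L).
Local Notation node := (node s).
Local Notation n := (size s).
Local Notation h := (mesh_size s).
Local Notation Prim := (primitive L).
Implicit Types (f g u v : R -> R) (i j : nat) (c : nat -> R) (x y : R).

Definition cell i : set R := `]node i, node i.+1[%classic.

Lemma node0 : node 0 = 0. Proof. by []. Qed.

Lemma nodeL : node n = L.
Proof. by have [_ /eqP <-] := hs; rewrite /Defs.node -[n]/(size (0 :: s)).-1 nth_last. Qed.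

Lemma node_lt i : (i < n)%N -> node i < node i.+1.
Proof. by have [/(pathP 0) h _] := hs; move=> /h. Qed.

Lemma node_le i j : (i <= j)%N -> (j <= n)%N -> node i <= node j.
Proof.
elim: j => [|j IH]; first by rewrite leqn0 => /eqP ->.
rewrite leq_eqVlt => /predU1P[->//|]; rewrite ltnS => ij jn.
by rewrite (le_trans (IH ij (ltnW jn)))// ltW// node_lt.
Qed.

Lemma node_ge0 i : (i <= n)%N -> 0 <= node i.
Proof. by move=> i_n; rewrite -node0 node_le. Qed.

Lemma node_leL i : (i <= n)%N -> node i <= L.
Proof. by move=> i_n; rewrite -nodeL node_le. Qed.

Lemma cell_sub i : (i < n)%N -> cell i `<=` Omega.
Proof.
move=> i_n; apply: subset_itv; rewrite bnd_simp ?node_leL//.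
exact: node_ge0 (ltnW i_n).
Qed.

Lemma cell_inj i j x : (i < n)%N -> (j < n)%N -> cell i x -> cell j x -> i = j.
Proof.
rewrite /cell /= !in_itv/= => i_n j_n /andP[i1 i2] /andP[j1 j2].
have [ij|ji|//] := ltngtP i j.
  by have := lt_le_trans i2 (le_trans (node_le ij (ltnW j_n)) (ltW j1)); rewrite ltxx.
by have := lt_le_trans j2 (le_trans (node_le ji (ltnW i_n)) (ltW i1)); rewrite ltxx.
Qed.

Lemma mesh_size_ge i : (i < n)%N -> node i.+1 - node i <= h.
Proof.
by move=> i_n; exact: (le_bigmax _ (fun i : 'I_n => node i.+1 - node i) (Ordinal i_n)).
Qed.

Lemma cell_measure i : (i < n)%N -> fine (mu (cell i)) = node i.+1 - node i.
Proof. by move=> i_n; rewrite lebesgue_measure_itv/= lte_fin node_lt. Qed.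

Lemma Rintegral_cells f : mu.-integrable Omega (EFin \o f) ->
  \int[mu]_(x in Omega) f x = \sum_(i < n) \int[mu]_(x in cell i) f x.
Proof.
move=> iF.
have sub i : (i <= n)%N -> mu.-integrable `]0, node i[ (EFin \o f).
  move=> i_n; apply: integrableS iF => //.
  by apply: subset_itv; rewrite bnd_simp// node_leL.
suff H k : (k <= n)%N -> \int[mu]_(x in `]0, node k[) f x = \sum_(i < k) \int[mu]_(x in cell i) f x.
  by rewrite -H// nodeL.
elim: k => [_|k IH kn].
  by rewrite big_ord0 set_itvoo0 Rintegral_set0.
rewrite big_ord_recr -(IH (ltnW kn)).
have := @Rintegral_itvB R f (BRight 0) (BLeft (node k.+1)) (node k) (sub _ kn).
rewrite !bnd_simp => /(_ (node_ge0 (ltnW kn)) (node_lt kn)) <-.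
rewrite -(Rintegral_itv_bndo_bndc (sub _ (ltnW kn))).
by rewrite /= addrC subrK.
Qed.

(** The cells cover the beam up to the nodes, which form a null set. *)
Lemma ae_cells (P : R -> Prop) :
  (forall i, (i < n)%N -> {ae mu, forall x, cell i x -> P x}) ->
  {ae mu, forall x, Omega x -> P x}.
Proof.
move=> H.
have h1 : {ae mu, forall x, forall i, (i < n)%N -> cell i x -> P x}.
  apply: (@ae_foralln _ _ R mu (fun i x => (i < n)%N -> cell i x -> P x)) => i.
  have [i_n|i_n] := boolP (i < n)%N; last by apply: aeW.
  by apply: ae_imply (H i i_n).
have h2 : {ae mu, forall x, forall i, x <> node i}.
  apply: (@ae_foralln _ _ R mu (fun i x => x <> node i)) => i.
  exists [set node i]; split => //; first exact: lebesgue_measure_set1.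
  by move=> x /= /contrapT ->.
apply: ae_imply2 h1 h2 => x h1 h2; rewrite /= in_itv/= => /andP[x0 xL].
suff [i i_n xi] : exists2 i, (i < n)%N & cell i x by exact: h1 xi.
have H' k : (k <= n)%N -> x < node k -> exists2 i, (i < k)%N & cell i x.
  elim: k => [_|k IH kn xk]; first by rewrite node0 ltNge ltW.
  have [xk'|xk'|/h2//] := ltgtP x (node k).
    have [i ik xi] := IH (ltnW kn) xk'; by exists i => //; exact: ltnW.
  by exists k => //; rewrite /cell/= in_itv/= xk'.
by apply: H' => //; rewrite nodeL.
Qed.

Definition step_fun c x : R := \sum_(i < n) c i * \1_(cell i) x.

Lemma step_funE c i x : (i < n)%N -> cell i x -> step_fun c x = c i.
Proof.
move=> i_n xi; rewrite /step_fun (bigD1 (Ordinal i_n))//= big1 ?addr0.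
  by rewrite indicE mem_set// mulr1.
move=> j ji; rewrite indicE memNset ?mulr0// => xj.
by case/negP: ji; apply/eqP/val_inj => /=; exact: cell_inj xj xi.
Qed.

Lemma step_funN c : step_fun (fun i => - c i) = - step_fun c.
Proof.
apply/funext => x; rewrite (_ : (- step_fun c) x = - step_fun c x)// /step_fun -sumrN.
by apply: eq_bigr => i _; rewrite mulNr.
Qed.

Lemma measurable_step_fun c : measurable_fun setT (step_fun c).
Proof.
apply: measurable_sum => i; apply: measurable_funM => //.
by apply: measurable_indic; exact: measurable_itv.
Qed.

Lemma step_fun_inL2 c : inL2 (step_fun c).
Proof.
apply: (@inL2_bounded _ _ _ (\sum_(i < n) `|c i|)).
  exact: measurable_funS (measurable_step_fun c).
move=> x _; apply: (le_trans (ler_norm_sum _ _ _)); apply: ler_sum => i _.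
by rewrite normrM ler_piMr// indicE; case: (_ \in _); rewrite ?normr1 ?normr0.
Qed.

Lemma integrable_cell i f : (i < n)%N -> mu.-integrable Omega (EFin \o f) -> mu.-integrable (cell i) (EFin \o f).
Proof.
by move=> i_n; apply: integrableS => //; [exact: measurable_itv|exact: cell_sub].
Qed.


Lemma inner_step_fun f c : inL2 f ->
  inner f (step_fun c) = \sum_(i < n) c i * \int[mu]_(x in cell i) f x.
Proof.
move=> Lf; rewrite /L2_inner Rintegral_cells; last first.
  exact: L2_mul_integrable (step_fun_inL2 c).
apply: eq_bigr => i _; rewrite -RintegralZl; first last.
- exact: integrable_cell (inL2_integrable Lf).
- exact: measurable_itv.
apply: eq_Rintegral => x /set_mem xi.
by rewrite (step_funE _ _ xi)// mulrC.
Qed.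

Definition is_step q := exists c, ae_on q (step_fun c).

Definition cell_indicator i : R -> R := \1_(cell i).

Lemma cell_indicatorE i : (i < n)%N -> cell_indicator i = step_fun (fun j => (j == i)%:R).
Proof.
move=> i_n; apply/funext => x; rewrite /step_fun (bigD1 (Ordinal i_n))//= big1 ?addr0 ?eqxx ?mul1r//.
by move=> j; rewrite -val_eqE /= => /negbTE ->; rewrite mul0r.
Qed.

Lemma cell_indicator_in i x : cell i x -> cell_indicator i x = 1.
Proof. by move=> xi; rewrite /cell_indicator indicE mem_set. Qed.

Lemma cell_indicator_inL2 i : (i < n)%N -> inL2 (cell_indicator i).
Proof. by move=> i_n; rewrite cell_indicatorE//; exact: step_fun_inL2. Qed.



Lemma inner_cell_indicator f i : inL2 f -> (i < n)%N ->
  inner f (cell_indicator i) = \int[mu]_(x in cell i) f x.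
Proof.
move=> Lf i_n; rewrite cell_indicatorE// inner_step_fun// (bigD1 (Ordinal i_n))//= big1 ?addr0 ?eqxx ?mul1r//.
by move=> j; rewrite -val_eqE /= => /negbTE ->; rewrite mul0r.
Qed.

(** The cell indicators span the step functions. *)
Lemma orthogonal_steps f : inL2 f ->
  (forall i, (i < n)%N -> inner f (cell_indicator i) = 0) ->
  forall c, inner f (step_fun c) = 0.
Proof.
move=> Lf H c; rewrite inner_step_fun// big1// => i _.
by rewrite -inner_cell_indicator// H// mulr0.
Qed.

Lemma step_fun_pw c : piecewise_poly s 0 (step_fun c).
Proof.
move=> i i_n; exists (c i)%:P; first by rewrite size_polyC; case: (_ != _).
by apply: aeW => x xi; rewrite hornerC (step_funE _ i_n)// /cell/= in_itv.
Qed.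

Lemma step_fun_Qh c : carrier (Qh L s) (step_fun c).
Proof. by split; [exact: step_fun_inL2|exact: step_fun_pw]. Qed.

(** Puts the cellwise constants into one family of coefficients, so that linear
    algebra with piecewise constants becomes algebra of coefficients. *)
Lemma Qh_step q : carrier (Qh L s) q -> is_step q.
Proof.
move=> [_ pq].
have H i : exists a, (i < n)%N -> {ae mu, forall x, cell i x -> q x = a}.
  have [i_n|i_n] := boolP (i < n)%N; last by exists 0.
  have [p sp h] := pq i i_n; exists p`_0 => _.
  apply: ae_imply h => x h; rewrite /cell/= in_itv/= => /h ->.
  by rewrite [p]size1_polyC// hornerC coefC.
have [c hc] := choice H; exists c; apply: ae_cells => i i_n.
by apply: ae_imply (hc i i_n) => x h xi; rewrite (step_funE _ _ xi)// h.
Qed.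

Lemma is_step_B q q' : is_step q -> is_step q' -> is_step (q - q').
Proof.
move=> [c hc] [c' hc']; exists (fun i => c i - c' i).
apply: ae_on_trans (ae_onB hc hc') _; apply: aeW => x _.
rewrite /GRing.add/= /GRing.opp/= /step_fun -sumrB; apply: eq_bigr => i _.
by rewrite mulrBl.
Qed.

Lemma is_step_D q q' : is_step q -> is_step q' -> is_step (q + q').
Proof.
move=> [c hc] [c' hc']; exists (fun i => c i + c' i).
apply: ae_on_trans (ae_onD hc hc') _; apply: aeW => x _.
rewrite /GRing.add/= /step_fun -big_split; apply: eq_bigr => i _.
by rewrite mulrDl.
Qed.

Lemma is_step_cst a : is_step (cst a).
Proof.
exists (fun=> a); apply: ae_cells => i i_n.
by apply: aeW => x xi; rewrite (step_funE _ i_n xi).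
Qed.

Definition cell_mean f : R -> R :=
  step_fun (fun i => (\int[mu]_(x in cell i) f x) / (node i.+1 - node i)).

Lemma cell_mean_inL2 f : inL2 (cell_mean f). Proof. exact: step_fun_inL2. Qed.

Lemma cell_mean_step f : is_step (cell_mean f).
Proof. by exists (fun i => (\int[mu]_(x in cell i) f x) / (node i.+1 - node i)); exact: ae_on_refl. Qed.

Lemma inner_cell_mean f q : inL2 f -> is_step q -> inner (f - cell_mean f) q = 0.
Proof.
move=> Lf [c qc]; rewrite (inner_aer _ qc); move: c {qc}; apply: orthogonal_steps.
  by apply: inL2B => //; exact: cell_mean_inL2.
move=> i i_n; rewrite innerBl//; [|exact: cell_mean_inL2|exact: cell_indicator_inL2].
rewrite !inner_cell_indicator//; last exact: cell_mean_inL2.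
rewrite (@eq_Rintegral _ _ _ mu (cell i) (cst ((\int[mu]_(x in cell i) f x) / (node i.+1 - node i))) (cell_mean f)).
  rewrite Rintegral_cst//; last exact: measurable_itv.
  by rewrite cell_measure// divfK ?subrr// subr_eq0 gt_eqF// node_lt.
by move=> x /set_mem xi; rewrite /cell_mean (step_funE _ _ xi).
Qed.

Lemma L2norm_cell_mean f : inL2 f -> N (cell_mean f) <= N f.
Proof.
move=> Lf; have LP := cell_mean_inL2 f.
have E : N (cell_mean f) ^+ 2 = inner f (cell_mean f).
  have := inner_cell_mean Lf (cell_mean_step f); rewrite innerBl// L2norm_sqr => /eqP.
  by rewrite subr_eq0 => /eqP.
have := ler_inner Lf LP; rewrite -E => H.
have := L2norm_ge0 L (cell_mean f); rewrite le_eqVlt => /predU1P[<-|cell_mean]; first exact: L2norm_ge0.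
by rewrite -(ler_pM2r cell_mean) -expr2.
Qed.

(** The difference of two such step functions is a step function orthogonal to
    all step functions, in particular to itself. *)
Lemma best_approximation f q : inL2 f -> is_step q -> inL2 q ->
  (forall c, inner (f - q) (step_fun c) = 0) -> ae_on q (cell_mean f).
Proof.
move=> Lf sq Lq H; have LP := cell_mean_inL2 f.
suff : ae_on (q - cell_mean f) (cst 0).
  apply: ae_imply => x /[apply].
  rewrite (_ : (q - cell_mean f) x = q x - cell_mean f x)// => /eqP.
  by rewrite subr_eq0 => /eqP.
have sd := is_step_B sq (cell_mean_step f).
apply: inner_eq0; first exact: inL2B.
have h1 : inner (f - q) (q - cell_mean f) = 0 by have [c hc] := sd; rewrite (inner_aer _ hc).
have h2 := inner_cell_mean Lf sd.
have Ld := inL2B Lq LP.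
move: h1 h2; rewrite !innerBl//; lra.
Qed.

Lemma L2norm_cell_indicator i : (i < n)%N -> N (cell_indicator i) = Num.sqrt (node i.+1 - node i).
Proof.
move=> i_n; rewrite nnormL2E inner_cell_indicator//; last exact: cell_indicator_inL2.
congr Num.sqrt; rewrite -cell_measure// -[RHS]mul1r -Rintegral_cst//; last exact: measurable_itv.
apply: eq_Rintegral => x /set_mem xi.
by rewrite cell_indicator_in.
Qed.

(** Between two points of a cell the difference of the integration kernels is
    supported in that cell and bounded by its indicator, so only the restriction
    of [g] to the cell enters the Cauchy-Schwarz inequality. *)
Lemma primitive_osc g i x y : inL2 g -> (i < n)%N -> cell i x -> cell i y ->
  `|Prim g x - Prim g y| <=
    N (fun z => cell_indicator i z * g z) * Num.sqrt (node i.+1 - node i).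
Proof.
move=> Lg i_n xi yi.
have Lu := cell_indicator_inL2 i_n.
have u1 z : 0 <= cell_indicator i z <= 1.
  by rewrite /cell_indicator indicE; case: (_ \in _); rewrite ?lexx ?ler01.
have Lug : inL2 (fun z => cell_indicator i z * g z).
  apply: (@inL2_mulb _ _ _ _ 1) => //; first exact: inL2_meas Lu.
  by move=> z _; have /andP[? ?] := u1 z; rewrite ger0_norm.
have bx := below_inL2 L x; have by_ := below_inL2 L y.
have Lb := inL2B bx by_.
rewrite /primitive -innerBr//.
have out z : ~ cell i z -> (below x - below y) z = 0.
  rewrite (_ : (below x - below y) z = below x z - below y z)// => zi.
  move: xi yi; rewrite /cell/= !in_itv/= => /andP[x1 x2] /andP[y1 y2].
  rewrite /below; have [zx|zx] := ltP z x; have [zy|zy] := ltP z y;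
    rewrite ?subrr//; exfalso; apply: zi; rewrite /cell/= in_itv/=; apply/andP; split; lra.
have -> : inner g (below x - below y) =
    inner (fun z => cell_indicator i z * g z) (below x - below y).
  apply: eq_Rintegral => z _; have [zi|zi] := pselect (cell i z).
    by rewrite cell_indicator_in// mul1r.
  by rewrite out// !mulr0.
apply: (le_trans (cauchy_schwarz Lug Lb)).
rewrite -L2norm_cell_indicator// ler_wpM2l ?L2norm_ge0//; apply: le_L2norm => //.
  exact: inL2_meas Lb.
move=> z _; have [zi|zi] := pselect (cell i z); last by rewrite out// normr0.
rewrite cell_indicator_in// normr1 (_ : (below x - below y) z = below x z - below y z)//.
by rewrite /below; case: (z < x); case: (z < y); rewrite ?subrr ?subr0 ?sub0r ?normrN ?normr1 ?normr0.
Qed.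

Lemma L2norm_cell_indicatorM g i : inL2 g -> (i < n)%N ->
  N (fun z => cell_indicator i z * g z) ^+ 2 = \int[mu]_(x in cell i) (g x * g x).
Proof.
move=> Lg i_n; rewrite L2norm_sqr /L2_inner -(setIidr (cell_sub i_n)) Rintegral_mkcondr.
apply: eq_Rintegral => x _; rewrite patchE /cell_indicator indicE.
by case: ifPn => _; rewrite ?mul1r ?mul0r.
Qed.

Lemma ae_le_Rintegral (D : set R) f g : measurable D ->
  (forall x, D x -> 0 <= f x) -> (forall x, D x -> 0 <= g x) ->
  mu.-integrable D (EFin \o f) -> mu.-integrable D (EFin \o g) ->
  {ae mu, forall x, D x -> f x <= g x} ->
  \int[mu]_(x in D) f x <= \int[mu]_(x in D) g x.
Proof.
move=> mD f0 g0 iF ig fg; rewrite /Rintegral fine_le ?integrable_fin_num//.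
apply: ge0_ae_le_integral_nomeas => //.
Qed.

Lemma integrable_cell_cst i (a : R) : (i < n)%N -> mu.-integrable (cell i) (EFin \o cst a).
Proof.
move=> i_n; apply: (integrableS (mu := mu) (measurable_itv _)  (measurable_itv _) (cell_sub i_n)).
exact: inL2_integrable (inL2_cst L a).
Qed.

(** The deviation from the mean is the mean of the differences. *)
Lemma cell_mean_osc u i (D : R) x : inL2 u -> (i < n)%N -> cell i x ->
  {ae mu, forall y, cell i y -> `|u x - u y| <= D} ->
  `|(u - cell_mean u) x| <= D.
Proof.
move=> Lu i_n xi uD.
have hi : 0 < node i.+1 - node i by rewrite subr_gt0 node_lt.
have mi : measurable (cell i) by exact: measurable_itv.
have iu := integrable_cell i_n (inL2_integrable Lu).
have ix := integrable_cell_cst (u x) i_n.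
have iux : mu.-integrable (cell i) (EFin \o (fun y => u x - u y)).
  have -> : EFin \o (fun y => u x - u y) = ((EFin \o cst (u x)) \- (EFin \o u))%E.
    by apply/funext => y /=; rewrite EFinB.
  exact: integrableB.
have E : (u - cell_mean u) x = (\int[mu]_(y in cell i) (u x - u y)) / (node i.+1 - node i).
  rewrite RintegralB// (_ : (u - cell_mean u) x = u x - cell_mean u x)// /cell_mean (step_funE _ i_n xi).
  rewrite Rintegral_cst// cell_measure//; field.
  by rewrite gt_eqF.
rewrite E normrM normfV (gtr0_norm hi) ler_pdivrMr//.
have h1 := @le_normr_Rintegral _ _ _ mu (cell i) _ mi iux; apply: (le_trans h1).
rewrite -cell_measure// -Rintegral_cst//.
have D0 : 0 <= D.
  apply: contrapT => /negP; rewrite -ltNge => D0.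
  have : (mu (cell i) = 0)%E.
    apply/negligibleP => //; case: uD => Z [mZ Z0 hZ]; exists Z; split => //.
    move=> y yi; apply: hZ => /= /(_ yi) h2.
    by have := le_lt_trans h2 D0; rewrite ltNge normr_ge0.
  by move/(congr1 fine); rewrite cell_measure//= => h2; move: hi; rewrite h2 ltxx.
apply: ae_le_Rintegral => //; first exact: integrable_norm.
exact: integrable_cell_cst.
Qed.

(** On a cell of length [l] a function varies by at most [sqrt l] times the norm
    of its derivative there; squaring and integrating over the cell yields
    [l ^ 2] times the squared norm, and the cells are summed. *)
Lemma poincare_cell_mean u : inH1 u -> N (u - cell_mean u) <= h * N (wd u).
Proof.
move=> hu; have Lu := hu.1; have Lg := wd_inL2 hu.
set g := wd u in Lg *.
have [k uk] := weak_primitive L0 Lu (wdP hu); have uk' := uk.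
have Lw := inL2B Lu (cell_mean_inL2 u).
have h0 : 0 <= h by exact: bigmax_ge_id.
(* a bound for the oscillation of u on the cell i *)
pose D i := N (fun z => cell_indicator i z * g z) * Num.sqrt (node i.+1 - node i).
have D0 i : 0 <= D i by rewrite mulr_ge0 ?L2norm_ge0 ?sqrtr_ge0.
have wD i : (i < n)%N -> {ae mu, forall x, cell i x -> `|(u - cell_mean u) x| <= D i}.
  move=> i_n; apply: ae_imply uk => x ux xi.
  apply: (cell_mean_osc (i := i)) => //; apply: ae_imply uk' => y uy yi.
  rewrite (ux (cell_sub i_n xi)) (uy (cell_sub i_n yi)) opprD addrACA subrr add0r.
  exact: primitive_osc.
rewrite -(@ler_pXn2r _ 2)// ?nnegrE ?mulr_ge0 ?L2norm_ge0//.
rewrite L2norm_sqr exprMn L2norm_sqr /L2_inner !Rintegral_cells; [|exact: L2_mul_integrable..].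
rewrite mulr_sumr; apply: ler_sum => i _.
have i_n := ltn_ord i.
have mi : measurable (cell i) by exact: measurable_itv.
have hi : 0 < node i.+1 - node i by rewrite subr_gt0 node_lt.
apply: (@le_trans _ _ (\int[mu]_(x in cell i) (cst (D i ^+ 2) x))).
  apply: ae_le_Rintegral => //.
  - by move=> x _; rewrite -expr2 sqr_ge0.
  - by move=> x _; rewrite /= sqr_ge0.
  - exact: integrable_cell i_n (L2_mul_integrable Lw Lw).
  - exact: integrable_cell_cst.
  - apply: ae_imply (wD i i_n) => x + xi => /(_ xi) wx.
    by rewrite -expr2 -real_normK ?num_real// lerXn2r ?nnegrE.
rewrite Rintegral_cst// cell_measure// /D exprMn L2norm_cell_indicatorM// sqr_sqrtr; last exact: ltW.
set G := \int[mu]_(x in cell i) _; have G0 : 0 <= G.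
  by apply: Rintegral_ge0 => x _; rewrite -expr2 sqr_ge0.
rewrite -mulrA -expr2 mulrC ler_wpM2r// lerXn2r ?nnegrE//; first exact: ltW.
exact: mesh_size_ge.
Qed.

Lemma affine_primitive (a b x : R) : Omega x -> a + b * x = a + Prim (cst b) x.
Proof.
rewrite /= in_itv/= => /andP[x0 xL]; congr (_ + _).
have sub : `]0, x[ `<=` Omega by apply: subset_itv; rewrite bnd_simp// ltW.
transitivity (\int[mu]_(y in `]0, x[) cst b y).
  by rewrite Rintegral_cst//= lebesgue_measure_itv/= lte_fin x0 oppr0 addr0.
rewrite -(setIidr sub) Rintegral_mkcondr; apply: eq_Rintegral => y.
rewrite inE/= in_itv/= => /andP[y0 _]; rewrite patchE /below /=.
case: ifPn; rewrite ?notin_setE ?inE/= in_itv/= y0/= => h1; first by rewrite h1 mulr1.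
by move/negP/negbTE: h1 => ->; rewrite mulr0.
Qed.

Lemma iwd_affine (a b : R) : iwd (fun x => a + b * x) (cst b).
Proof.
have Lb := inL2_cst L b; have La := inL2_cst L a.
have Lb' := primitive_inL2 L0 Lb.
have := iwdD La Lb' (iwd_cst L0 a) (iwd_primitive L0 Lb).
apply: iwd_ae => //.
- by apply: aeW => x Ox; rewrite (affine_primitive _ _ Ox).
- by apply: aeW => x _; rewrite /= (_ : (cst 0 + cst b) x = 0 + b)// add0r.
Qed.

Lemma affine_inL2 (a b : R) : inL2 (fun x => a + b * x).
Proof.
apply: (inL2_dom _ (inL2D (inL2_cst L `|a|) (inL2_cst L (`|b| * L)))).
  by apply: measurable_funD => //; exact: measurable_funM.
move=> x; rewrite /= in_itv/= => /andP[x0 xL].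
rewrite (_ : (cst `|a| + cst (`|b| * L)) x = `|a| + `|b| * L)//.
rewrite [leRHS]ger0_norm; last by rewrite addr_ge0// mulr_ge0// ltW.
rewrite (le_trans (ler_normD _ _))// lerD2l normrM ler_wpM2l//.
by rewrite gtr0_norm// ltW.
Qed.

Lemma affine_inH1 (a b : R) : inH1 (fun x => a + b * x).
Proof. exact: iwd_inH1 (affine_inL2 a b) (iwd_affine a b). Qed.

Lemma wd_affine (a b : R) : ae_on (wd (fun x => a + b * x)) (cst b).
Proof. exact: wd_ae (affine_inL2 a b) (iwd_affine a b). Qed.

Lemma size_affine (a b : R) : (size (a%:P + b *: 'X : {poly R})%R <= 2)%N.
Proof.
rewrite (leq_trans (size_polyD _ _))// geq_max (leq_trans (size_polyC_leq1 _))//=.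
by rewrite (leq_trans (size_scale_leq _ _))// size_polyX.
Qed.

Lemma affine_Vh (a b : R) : carrier (Vh L s) (fun x => a + b * x).
Proof.
split; first exact: affine_inH1.
move=> i i_n; exists (a%:P + b *: 'X); first exact: size_affine.
by apply: aeW => x _; rewrite !hornerE.
Qed.

(** On the cell of [x] the integral of the step function collects the full cells
    to the left and a part of the current one that is linear in [x]. *)
Lemma primitive_step_fun_Vh c : carrier (Vh L s) (Prim (step_fun c)).
Proof.
have Ls := step_fun_inL2 c.
split; first exact: inH1_primitive.
move=> i i_n.
pose a := \sum_(j < n) c j * (if (j < i)%N then node j.+1 - node j else 0) - c i * node i.
exists (a%:P + c i *: 'X); first exact: size_affine.
apply: aeW => x xi; rewrite !hornerE /primitive innerC inner_step_fun; last exact: below_inL2.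
rewrite /a addrAC -addrA -mulrBr.
have xi' : cell i x by rewrite /cell/= in_itv.
have /andP[x1 x2] := xi.
rewrite (bigD1 (Ordinal i_n))//= [X in _ = X + _](bigD1 (Ordinal i_n))//= ltnn mulr0 add0r addrC.
congr (_ + _).
  apply: eq_bigr => j ji; congr (_ * _).
  have j_n := ltn_ord j.
  have mj : measurable (cell j) by exact: measurable_itv.
  have nij : (j : nat) != i by [].
  have [ij|ij|E] := ltngtP (j : nat) i; last by rewrite E eqxx in nij.
    rewrite (@eq_Rintegral _ _ _ mu (cell j) (cst 1)).
      by rewrite Rintegral_cst// mul1r cell_measure.
    move=> y /set_mem; rewrite /cell/= in_itv/= => /andP[_ yj].
    by rewrite /below (lt_le_trans yj)// (le_trans (node_le ij (ltnW i_n)))// ltW.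
  rewrite (@eq_Rintegral _ _ _ mu (cell j) (cst 0)) ?Rintegral_cst ?mul0r//.
  move=> y /set_mem; rewrite /cell/= in_itv/= => /andP[yj _].
  rewrite /below ltNge (le_trans (ltW x2))// (le_trans (node_le ij (ltnW j_n)))// ltW//.
congr (_ * _).
have sub : `]node i, x[ `<=` cell i by apply: subset_itv; rewrite bnd_simp// ltW.
transitivity (\int[mu]_(y in `]node i, x[) cst 1 y); last first.
  by rewrite Rintegral_cst//= lebesgue_measure_itv/= lte_fin x1 mul1r.
rewrite -(setIidr sub) Rintegral_mkcondr; apply: eq_Rintegral => y.
rewrite inE/= /cell/= in_itv/= => /andP[y0 _]; rewrite patchE /below /=.
case: ifPn; rewrite ?notin_setE ?inE/= in_itv/= y0/= => h1; first by rewrite h1.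
by move/negP/negbTE: h1 => ->.
Qed.

Lemma cutoff_derive_out (a b x : R) m : (x < a) || (b < x) ->
  derive1 (cutoff a b m) x = 0.
Proof.
move=> hx; rewrite derive1E.
rewrite -(@near_eq_derive _ _ _ (cst (0 : R)) (cutoff a b m)).
  by rewrite derive_cst.
case/orP: hx => hx; near=> y; rewrite /= cutoff_out//.
  by rewrite negb_and -!leNgt; apply/orP; left; apply: ltW; near: y; exact: lt_nbhsl.
by rewrite negb_and -!leNgt; apply/orP; right; apply: ltW; near: y; exact: lt_nbhsr.
Unshelve. all: by end_near. Qed.

(** Cutoffs supported in one cell only see the affine piece of [v] on it, whose
    derivative is constant. *)
Lemma wd_Vh v : carrier (Vh L s) v -> is_step (wd v).
Proof.
move=> [hv pv]; have Lg := wd_inL2 hv; have Lv := hv.1.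
suff H i : exists a, (i < n)%N -> {ae mu, forall x, cell i x -> wd v x = a}.
  have [c hc] := choice H; exists c; apply: ae_cells => i i_n.
  by apply: ae_imply (hc i i_n) => x h1 xi; rewrite (step_funE _ i_n xi) h1.
have [i_n|i_n] := boolP (i < n)%N; last by exists 0.
have [p sp vp] := pv i i_n; exists p`_1 => _.
have pE x : p.[x] = p`_0 + p`_1 * x.
  rewrite (horner_coef_wide _ sp) !big_ord_recl big_ord0 /= expr0 mulr1 addr0.
  by rewrite /bump/= addn0 expr1.
have Lc := inL2_cst L p`_1.
suff : {ae mu, forall x, node i < x < node i.+1 -> (wd v - cst p`_1) x = 0}.
  apply: ae_imply => x h1; rewrite /cell/= in_itv/= => /h1.
  by rewrite (_ : (wd v - cst p`_1) x = wd v x - p`_1)// => /eqP; rewrite subr_eq0 => /eqP.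
apply: (fundamental_lemma (u := wd v - cst p`_1) (node_ge0 (ltnW i_n)) (node_leL i_n)).
  exact: inL2_integrable (inL2B Lg Lc).
move=> a b m ca ab bd.
have a0 : 0 < a := le_lt_trans (node_ge0 (ltnW i_n)) ca.
have bL : b < L := lt_le_trans bd (node_leL i_n).
have tb := test_function_cutoff m a0 bL.
have t1 := test_inL2 tb; have t2 := test_inL2' tb.
rewrite innerBl//; apply/eqP; rewrite subr_eq0 -eqr_opp.
rewrite -(wdP hv).2// -(iwd_affine p`_0 p`_1).2//; apply/eqP.
apply: ae_eq_Rintegral_nomeas => //; apply: ae_imply vp => x vp Ox.
have [/andP[ax xb]|] := boolP (a <= x <= b).
  by rewrite vp ?pE// (lt_le_trans ca ax) (le_lt_trans xb bd).
by rewrite negb_and -!ltNge => hx; rewrite cutoff_derive_out// !mulr0.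
Qed.

End FiniteElements.

(** * Error estimates at a fixed time *)

Section Estimates.
Context {R : realType}.
Variable L : R.
Hypothesis L0 : 0 < L.
Local Notation mu := (@lebesgue_measure R).
Local Notation Omega := `]0, L[%classic.
Local Notation inner := (L2_inner L).
Local Notation N := (nnorm (L2 L)).
Local Notation inL2 := (carrier (L2 L)).
Local Notation inH1 := (carrier (H1 L)).
Local Notation ae_on := (ae_on L).
Local Notation wd := (weak_derivative L).
Local Notation iwd := (is_weak_derivative L).
Local Notation Prim := (primitive L).
Implicit Types (f g u v : R -> R) (x y : R).

(** By convexity of the square, [(x + y) ^ 2 <= 2 * (x ^ 2 + y ^ 2)]. *)
Lemma sum_le_of_sqr (x y S : R) : 0 <= x -> 0 <= y -> 0 <= S ->
  x ^+ 2 + y ^+ 2 <= S * (x + y) -> x + y <= 2 * S.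
Proof.
move=> x0 y0 S0 h; have xy0 : 0 <= x + y by rewrite addr_ge0.
move: xy0; rewrite le_eqVlt => /predU1P[<-|xy0]; first by rewrite mulr_ge0.
rewrite -(ler_pM2r xy0); have := sqr_ge0 (x - y).
by rewrite sqrrB -expr2 sqrrD; lra.
Qed.

(** This and the next two facts are linear arithmetic on inner products, isolated
    on real variables. *)
Lemma moment_balance (x1 x2 x3 x4 x5 x6 : R) : x1 - x2 = 0 ->
  x1 - x3 - (x4 - x5) = 0 -> x3 - x5 - x6 - (x2 - x4 - x6) = 0.
Proof. by lra. Qed.

Lemma energy_balance (x y e A1 A2 B1 B2 z : R) : A1 + A2 + e * (B1 + B2) = 0 ->
  z <= A1 -> - A2 <= x -> e * - B2 <= y -> 0 <= e * B1 -> z <= x + y.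
Proof. by rewrite mulrN mulrDr; lra. Qed.

Lemma multiplier_balance (x y z e A B C p q : R) :
  A + e * B + (- C + p) - - q = 0 -> - A <= x -> e * - B <= y -> C <= z ->
  p + q <= x + y + z.
Proof. by rewrite mulrN; lra. Qed.

Lemma L2norm_triangle m f g : inL2 f -> inL2 g -> inL2 m -> N (f - g) <= N (f - m) + N (m - g).
Proof.
move=> Lf Lg Lm; have -> : f - g = (f - m) + (m - g) by rewrite addrA subrK.
by apply: L2normD; exact: inL2B.
Qed.

Lemma L2norm_coef (a f : R -> R) amax : inL2 f -> measurable_fun Omega a ->
  (forall x, Omega x -> `|a x| <= amax) -> 0 <= amax ->
  inL2 (fun x => a x * f x) /\ N (fun x => a x * f x) <= amax * N f.
Proof.
move=> Lf ma aM M0; have La := inL2_mulb Lf ma aM; split => //.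
rewrite -[amax]ger0_norm// -L2normZ//; apply: le_L2norm; first exact: inL2Z.
  exact: inL2_meas La.
by move=> x Ox; rewrite !normrM ler_wpM2r// (ger0_norm M0) aM.
Qed.

Lemma coef_coercive (a f : R -> R) amin amax : inL2 f -> measurable_fun Omega a ->
  (forall x, Omega x -> amin <= a x <= amax) -> 0 <= amin ->
  amin * N f ^+ 2 <= inner (fun x => a x * f x) f.
Proof.
move=> Lf ma aM a0.
have La : inL2 (fun x => a x * f x).
  apply: (inL2_mulb (C := amax)) => // x Ox; have /andP[h1 h2] := aM x Ox.
  by rewrite ger0_norm// (le_trans a0).
rewrite L2norm_sqr -innerZl//; apply: le_Rintegral => //.
- exact: L2_mul_integrable (inL2Z _ Lf) Lf.
- exact: L2_mul_integrable.
move=> x Ox; rewrite -!mulrA -expr2 ler_wpM2r ?sqr_ge0//.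
by have /andP[] := aM x Ox.
Qed.

(** The slope is the weak derivative, so it can be read off by pairing the affine
    function with the derivative of one fixed test function. *)
Lemma affine_slope : exists2 k : R, 0 <= k &
  forall a b : R, `|b| <= k * N (fun x => a + b * x).
Proof.
have q1 : 0 < L / 4 by rewrite divr_gt0.
have q2 : L / 4 < L / 2 by have := L0; lra.
have q3 : L / 2 < L by have := L0; lra.
pose psi := cutoff (L / 4) (L / 2) 0.
have tpsi : test_function L psi := test_function_cutoff 0 q1 q3.
have := cutoff_mass q1 q2 q3; rewrite -/psi.
set Z := \int[mu]_(x in _) _ => Z0.
exists (N (derive1 psi) / `|Z|); first by rewrite divr_ge0 ?L2norm_ge0.
move=> a b; have [_ h] := iwd_affine L0 a b.
have := h _ tpsi.
have -> : inner (cst b) psi = b * Z.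
  by rewrite -RintegralZl//; exact: inL2_integrable (test_inL2 tpsi).
move=> E; rewrite mulrAC ler_pdivlMr ?normr_gt0// -normrM -normrN -E mulrC.
by apply: cauchy_schwarz; [exact: affine_inL2|exact: test_inL2'].
Qed.

(* Unification is kept from unfolding integrals when it compares two norms. *)
Local Opaque weak_derivative L2 L2_inner cell_mean step_fun primitive.

Section Solution.
Variables (amin amax bmax E2 : R).
Hypotheses (amin0 : 0 < amin) (amax0 : 0 <= amax) (bmax0 : 0 <= bmax) (E20 : 0 <= E2).

(** The kernel argument, with the distances of [M'] and [V'] to the piecewise
    constants bounded by an abstract [D]. Here [a] and [b] stand for the inverse
    moment of inertia and the inverse of [kappa], and [e2] for [eps ^ 2]; only
    the upper bound [E2] of [e2] enters the constant. The functions [eb] and [ew]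
    are arbitrary, since the test pair does not see the multipliers. *)
Lemma stress_core : exists2 K : R, 0 <= K &
  forall (s : seq R) (a b : R -> R) (e2 D : R) (M V Mh Vt eb ew : R -> R),
  itv_partition 0 L s -> measurable_fun Omega a -> measurable_fun Omega b ->
  (forall x, Omega x -> amin <= a x <= amax) ->
  (forall x, Omega x -> 0 <= b x <= bmax) ->
  0 <= e2 <= E2 ->
  inH1 M -> inH1 (wd M) -> inH1 V -> inH1 (wd V) ->
  carrier (Vh L s) Mh -> carrier (Vh L s) Vt -> inL2 eb -> inL2 ew ->
  (forall c, inner (wd V - wd Vt) (step_fun s c) = 0) ->
  (forall c, inner ((wd M - V) - (wd Mh - Vt)) (step_fun s c) = 0) ->
  (forall tau xi, carrier (Vh L s) tau -> carrier (Vh L s) xi ->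
    inner (fun x => a x * (M - Mh) x) tau + e2 * inner (fun x => b x * (V - Vt) x) xi
    + inner eb (wd tau - xi) - inner ew (wd xi) = 0) ->
  0 <= D -> N (wd M - cell_mean s (wd M)) <= D -> N (wd V - cell_mean s (wd V)) <= D ->
  N (M - Mh) + N (wd M - wd Mh) + N (V - Vt) + N (wd V - wd Vt) <= K * D.
Proof.
have [k k0 slope] := affine_slope.
have sL0 : 0 <= Num.sqrt L by exact: sqrtr_ge0.
have LL : 0 <= L by exact: ltW.
pose K1 := (amax * (L * (1 + L)) + E2 * bmax * L * (k * Num.sqrt L)) / amin.
have K10 : 0 <= K1.
  rewrite divr_ge0//; last exact: ltW.
  by rewrite addr_ge0// !mulr_ge0// addr_ge0.
exists ((K1 + L * (1 + L)) + (k * K1 * Num.sqrt L + (1 + L)) + (k * K1 * Num.sqrt L + L) + 1).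
  by repeat first [done | apply: addr_ge0 | apply: mulr_ge0].
have K1E : K1 * amin = amax * (L * (1 + L)) + E2 * bmax * L * (k * Num.sqrt L).
  by rewrite /K1 divfK// gt_eqF.
clearbody K1.
move=> s a b e2 D M V Mh Vt eb ew hs ma mb aB bB /andP[e20 e2E] hM hM' hV hV' hMh hVt Leb Lew
  O1 O2 E D0 PM PV.
have hMh1 : inH1 Mh := hMh.1; have hVt1 : inH1 Vt := hVt.1.
have [LM LV LMh LVt] : [/\ inL2 M, inL2 V, inL2 Mh & inL2 Vt].
  by split; [exact: hM.1|exact: hV.1|exact: hMh1.1|exact: hVt1.1].
have [LM' LV' LMh' LVt'] : [/\ inL2 (wd M), inL2 (wd V), inL2 (wd Mh) & inL2 (wd Vt)].
  by split; exact: wd_inL2.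
have sMh := wd_Vh L0 hs hMh; have sVt := wd_Vh L0 hs hVt.
(* shear force: V' - Vt' is V' minus its cell means *)
have NGV : N (wd V - wd Vt) <= D.
  have hq := best_approximation hs LV' sVt LVt' O1.
  by rewrite (L2norm_ae (ae_onB (ae_on_refl L (wd V)) hq)).
have LGV := inL2B LV' LVt'.
have LeV := inL2B LV LVt.
have [c hc] := weak_primitive L0 LeV (iwdB LV LVt (wdP hV) (wdP hVt1)).
set r := Prim (wd V - wd Vt) in hc.
have Lr : inL2 r by exact: primitive_inL2.
have Nr : N r <= L * D by rewrite (le_trans (L2norm_primitive L0 LGV))// ler_wpM2l.
(* bending moment: P M' - Mh' - c is the cell mean of r, whence M' - Mh' = c + Q *)
have LP := cell_mean_inL2 L s (wd M); have Lc := inL2_cst L c.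
have LPr := cell_mean_inL2 L s r.
have sq1 := is_step_B (cell_mean_step L s (wd M)) sMh.
have Lq1 := inL2B LP LMh'.
have hq1 : ae_on (cell_mean s (wd M) - wd Mh - cst c) (cell_mean s r).
  apply: (best_approximation hs) => //.
  - exact: is_step_B sq1 (is_step_cst hs c).
  - exact: inL2B.
  - move=> c'; set q := step_fun s c'; have Lq : inL2 q := step_fun_inL2 L s c'.
    have sq : is_step L s q by exists c'; exact: ae_on_refl.
    have hr : ae_on r ((V - Vt) - cst c).
      apply: ae_imply hc => x /[apply] Ex.
      by rewrite (_ : ((V - Vt) - cst c) x = (V - Vt) x - c)// Ex addrAC subrr add0r.
    have := O2 c'; have := inner_cell_mean hs LM' sq.
    rewrite -/q (innerBl Lr (inL2B Lq1 Lc) Lq) (inner_ael _ hr) !innerBl//; try exact: inL2B.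
    exact: moment_balance.
pose Q := (wd M - cell_mean s (wd M)) + cell_mean s r.
have LQ : inL2 Q by apply: inL2D => //; exact: inL2B.
have NQ : N Q <= (1 + L) * D.
  apply: (le_trans (L2normD (inL2B LM' LP) LPr)); rewrite mulrDl mul1r.
  exact: lerD PM (le_trans (L2norm_cell_mean hs Lr) Nr).
have LGM := inL2B LM' LMh'.
have GME : ae_on (wd M - wd Mh) (cst c + Q).
  apply: ae_imply hq1 => x /[apply] Ex.
  rewrite (_ : (cst c + Q) x = c + ((wd M x - cell_mean s (wd M) x) + cell_mean s r x))// -Ex.
  rewrite (_ : (cell_mean s (wd M) - wd Mh - cst c) x = cell_mean s (wd M) x - wd Mh x - c)//.
  by rewrite (_ : (wd M - wd Mh) x = wd M x - wd Mh x)//; ring.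
have LeM := inL2B LM LMh.
have [d hd] := weak_primitive L0 LeM (iwdB LM LMh (wdP hM) (wdP hMh1)).
pose p x := d + c * x.
have Lp : inL2 p by exact: affine_inL2.
have LPQ := primitive_inL2 L0 LQ.
have eME : ae_on (M - Mh) (p + Prim Q).
  apply: ae_imply hd => x h1 Ox; rewrite h1// (primitive_ae GME) primitiveD// addrA.
  by rewrite -affine_primitive.
have NPQ : N (Prim Q) <= L * ((1 + L) * D).
  by rewrite (le_trans (L2norm_primitive L0 LQ))// ler_wpM2l.
have eVE : ae_on (V - Vt) (cst c + r) by exact: hc.
(* the pair (p, c) satisfies p' - c = 0 and c' = 0, so eb and ew drop out *)
have Np : N p <= K1 * D.
  have := E p (fun x => c + 0 * x) (affine_Vh s L0 d c) (affine_Vh s L0 c 0).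
  have z1 : ae_on (wd p - (fun x => c + 0 * x)) (cst 0).
    apply: ae_imply (wd_affine L0 d c) => x /[apply] h1.
    rewrite (_ : (wd p - (fun x => c + 0 * x)) x = wd p x - (c + 0 * x))// h1 /=.
    by rewrite mul0r addr0 subrr.
  have xiE : (fun x => c + 0 * x) = cst c by apply/funext => x /=; rewrite mul0r addr0.
  rewrite (inner_aer _ z1) (inner_aer _ (wd_affine L0 c 0)) !inner0r addr0 subr0 xiE.
  have bB' x : Omega x -> `|b x| <= bmax.
    by move=> Ox; have /andP[h1 h2] := bB x Ox; rewrite ger0_norm.
  have aB' x : Omega x -> `|a x| <= amax.
    move=> Ox; have /andP[h1 h2] := aB x Ox; rewrite ger0_norm//.
    by rewrite (le_trans (ltW amin0)).
  have [Lap Nap] := L2norm_coef Lp ma aB' amax0.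
  have [LaQ NaQ] := L2norm_coef LPQ ma aB' amax0.
  have [Lbc Nbc] := L2norm_coef Lc mb bB' bmax0.
  have [Lbr Nbr] := L2norm_coef Lr mb bB' bmax0.
  have e1 : ae_on (fun x => a x * (M - Mh) x) ((fun x => a x * p x) + (fun x => a x * Prim Q x)).
    apply: ae_imply eME => x /[apply] ->.
    by rewrite (_ : (p + Prim Q) x = p x + Prim Q x)// mulrDr.
  have e2' : ae_on (fun x => b x * (V - Vt) x) ((fun x => b x * cst c x) + (fun x => b x * r x)).
    apply: ae_imply eVE => x /[apply] ->.
    by rewrite (_ : (cst c + r) x = c + r x)// mulrDr.
  rewrite (inner_ael _ e1) (inner_ael _ e2') !innerDl//.
  have t1 := coef_coercive Lp ma aB (ltW amin0).
  have t2 := coef_coercive Lc mb bB (lexx 0).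
  have t3 : - inner (fun x => a x * Prim Q x) p <= amax * (L * ((1 + L) * D)) * N p.
    rewrite (le_trans (ler_norm _))// normrN (le_trans (cauchy_schwarz LaQ Lp))//.
    by rewrite ler_wpM2r ?L2norm_ge0// (le_trans NaQ)// ler_wpM2l.
  have t4 : - inner (fun x => b x * r x) (cst c) <= bmax * (L * D) * (k * N p * Num.sqrt L).
    rewrite (le_trans (ler_norm _))// normrN (le_trans (cauchy_schwarz Lbr Lc))//.
    rewrite ler_pM ?L2norm_ge0//; first by rewrite (le_trans Nbr)// ler_wpM2l.
    by rewrite L2norm_cst// ler_wpM2r// slope.
  move: t2; rewrite mul0r => t2 EE.
  have Np0 := L2norm_ge0 L p.
  have X0 : 0 <= bmax * (L * D) * (k * N p * Num.sqrt L).
    by do 3 (rewrite ?mulr_ge0//).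
  have t5 : amin * N p ^+ 2 <= (K1 * amin * D) * N p.
    rewrite K1E.
    have t6 : e2 * - inner (fun x => b x * r x) (cst c) <= E2 * (bmax * (L * D) * (k * N p * Num.sqrt L)).
      by rewrite (le_trans (ler_wpM2l e20 t4))// ler_wpM2r.
    have t7 : 0 <= e2 * inner (fun x => b x * cst c x) (cst c) by rewrite mulr_ge0.
    have -> : (amax * (L * (1 + L)) + E2 * bmax * L * (k * Num.sqrt L)) * D * N p =
       amax * (L * ((1 + L) * D)) * N p + E2 * (bmax * (L * D) * (k * N p * Num.sqrt L)).
      by move: (N p) (Num.sqrt L) => n1 n2; ring.
    exact: energy_balance EE t1 t3 t6 t7.
  move: Np0; rewrite le_eqVlt => /predU1P[<-|Np0]; first by rewrite mulr_ge0.
  rewrite -(ler_pM2l amin0) -(ler_pM2r Np0) -mulrA -expr2.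
  by apply: (le_trans t5); rewrite le_eqVlt; apply/orP; left; apply/eqP; ring.
have cB : `|c| * Num.sqrt L <= k * K1 * Num.sqrt L * D.
  have -> : k * K1 * Num.sqrt L * D = k * (K1 * D) * Num.sqrt L by ring.
  by rewrite ler_wpM2r// (le_trans (slope d c))// ler_wpM2l.
have f1 : N (M - Mh) <= (K1 + L * (1 + L)) * D.
  rewrite (L2norm_ae eME) (le_trans (L2normD Lp LPQ))// mulrDl lerD//.
  by rewrite -mulrA.
have f2 : N (wd M - wd Mh) <= (k * K1 * Num.sqrt L + (1 + L)) * D.
  by rewrite (L2norm_ae GME) (le_trans (L2normD Lc LQ))// mulrDl lerD// L2norm_cst.
have f3 : N (V - Vt) <= (k * K1 * Num.sqrt L + L) * D.
  by rewrite (L2norm_ae eVE) (le_trans (L2normD Lc Lr))// mulrDl lerD// L2norm_cst.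
rewrite mulrDl mul1r [X in _ <= X + _]mulrDl [X in _ <= X + _ + _]mulrDl.
exact: lerD (lerD (lerD f1 f2) f3) NGV.
Qed.

Lemma stress_estimate : exists2 K : R, 0 <= K &
  forall (s : seq R) (a b : R -> R) (e2 : R) (M V Mh Vt eb ew : R -> R),
  itv_partition 0 L s -> measurable_fun Omega a -> measurable_fun Omega b ->
  (forall x, Omega x -> amin <= a x <= amax) ->
  (forall x, Omega x -> 0 <= b x <= bmax) ->
  0 <= e2 <= E2 ->
  inH1 M -> inH1 (wd M) -> inH1 V -> inH1 (wd V) ->
  carrier (Vh L s) Mh -> carrier (Vh L s) Vt -> inL2 eb -> inL2 ew ->
  (forall c, inner (wd V - wd Vt) (step_fun s c) = 0) ->
  (forall c, inner ((wd M - V) - (wd Mh - Vt)) (step_fun s c) = 0) ->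
  (forall tau xi, carrier (Vh L s) tau -> carrier (Vh L s) xi ->
    inner (fun x => a x * (M - Mh) x) tau + e2 * inner (fun x => b x * (V - Vt) x) xi
    + inner eb (wd tau - xi) - inner ew (wd xi) = 0) ->
  N (M - Mh) + N (wd M - wd Mh) + N (V - Vt) + N (wd V - wd Vt) <=
    K * (mesh_size s * (N (wd (wd M)) + N (wd (wd V)))).
Proof.
have [K K0 HK] := stress_core; exists K => // s a b e2 M V Mh Vt eb ew hs ma mb aB bB e2B
  hM hM' hV hV' hMh hVt Leb Lew O1 O2 E.
have h0 : 0 <= mesh_size s by exact: bigmax_ge_id.
have NM0 := L2norm_ge0 L (wd (wd M)); have NV0 := L2norm_ge0 L (wd (wd V)).
apply: (HK s a b e2 _ M V Mh Vt eb ew) => //.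
- exact: mulr_ge0 h0 (addr_ge0 NM0 NV0).
- apply: (le_trans (poincare_cell_mean L0 hs hM')); apply: ler_wpM2l h0 _ _ _.
  rewrite lerDl; exact: NV0.
- apply: (le_trans (poincare_cell_mean L0 hs hV')); apply: ler_wpM2l h0 _ _ _.
  rewrite lerDr; exact: NM0.
Qed.

(** Testing with [tau' = P xi + fb] and [xi' = - fw], where [fb = P beta - betah]
    and [fw = P w - wh], turns the constraint terms into
    [N fb ^+ 2 + N fw ^+ 2 - (beta - P beta, xi)]. *)
Lemma multiplier_estimate : exists2 K : R, 0 <= K &
  forall (s : seq R) (a b : R -> R) (e2 : R) (eM eV beta w betah wh : R -> R),
  itv_partition 0 L s -> measurable_fun Omega a -> measurable_fun Omega b ->
  (forall x, Omega x -> `|a x| <= amax) ->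
  (forall x, Omega x -> `|b x| <= bmax) ->
  0 <= e2 <= E2 -> inL2 eM -> inL2 eV ->
  inH1 beta -> inH1 w -> carrier (Qh L s) betah -> carrier (Qh L s) wh ->
  (forall tau xi, carrier (Vh L s) tau -> carrier (Vh L s) xi ->
    inner (fun x => a x * eM x) tau + e2 * inner (fun x => b x * eV x) xi
    + inner (beta - betah) (wd tau - xi) - inner (w - wh) (wd xi) = 0) ->
  N (beta - betah) + N (w - wh) <=
    K * (N eM + N eV + mesh_size s * (N (wd beta) + N (wd w))).
Proof.
have LL : 0 <= L by exact: ltW.
pose K := amax * (L * (L + 1)) + E2 * bmax * L + L.
have K0 : 0 <= K by rewrite !addr_ge0// !mulr_ge0// addr_ge0.
exists (1 + 2 * K); first by rewrite addr_ge0// mulr_ge0.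
move=> s a b e2 eM eV beta w betah wh hs ma mb aB bB /andP[e20 e2E] LeM LeV hb hw qb qw E.
have h0 : 0 <= mesh_size s by exact: bigmax_ge_id.
have [Lb Lw Lbh Lwh] : [/\ inL2 beta, inL2 w, inL2 betah & inL2 wh].
  by split; [exact: hb.1|exact: hw.1|exact: qb.1|exact: qw.1].
have LPb := cell_mean_inL2 L s beta; have LPw := cell_mean_inL2 L s w.
have Lfb0 := inL2B LPb Lbh; have Lfw0 := inL2B LPw Lwh.
have [cb hcb] := is_step_B (cell_mean_step L s beta) (Qh_step hs qb).
have [cw hcw] := is_step_B (cell_mean_step L s w) (Qh_step hs qw).
set fb := step_fun s cb in hcb; set fw := step_fun s cw in hcw.
have Lfb : inL2 fb by exact: step_fun_inL2.
have Lfw : inL2 fw by exact: step_fun_inL2.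
have sfb : is_step L s fb by exists cb; exact: ae_on_refl.
have sfw : is_step L s fw by exists cw; exact: ae_on_refl.
have nfw : step_fun s (fun i => - cw i) = - fw := step_funN s cw.
pose xi := Prim (step_fun s (fun i => - cw i)).
have xiV : carrier (Vh L s) xi by exact: primitive_step_fun_Vh.
have Lnf : inL2 (- fw) by exact: inL2N.
have Lxi : inL2 xi by rewrite /xi nfw; exact: primitive_inL2.
have Nxi : N xi <= L * N fw by rewrite /xi nfw -(L2normN L fw); exact: L2norm_primitive.
have LPxi := cell_mean_inL2 L s xi.
have [c' hc'] := is_step_D (cell_mean_step L s xi) sfb.
pose tau := Prim (step_fun s c').
have tauV : carrier (Vh L s) tau by exact: primitive_step_fun_Vh.
have Lc' : inL2 (step_fun s c') by exact: step_fun_inL2.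
have Ltau : inL2 tau by exact: primitive_inL2.
have Ntau : N tau <= L * (L * N fw + N fb).
  rewrite (le_trans (L2norm_primitive L0 Lc'))// ler_wpM2l// -(L2norm_ae hc').
  by rewrite (le_trans (L2normD LPxi Lfb))// lerD// (le_trans (L2norm_cell_mean hs Lxi)).
have wtau : ae_on (wd tau - xi) ((cell_mean s xi - xi) + fb).
  apply: ae_on_trans (ae_onB (wd_primitive L0 Lc') (ae_on_refl L xi)) _.
  apply: ae_imply hc' => x /[apply] h1.
  rewrite (_ : (step_fun s c' - xi) x = step_fun s c' x - xi x)// -h1.
  rewrite (_ : (cell_mean s xi + fb) x = cell_mean s xi x + fb x)//.
  by rewrite (_ : ((cell_mean s xi - xi) + fb) x = cell_mean s xi x - xi x + fb x)//; ring.
have wxi : ae_on (wd xi) (- fw).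
  by rewrite /xi nfw; exact: wd_primitive.
have Leb := inL2B Lb Lbh; have Lew := inL2B Lw Lwh.
have LdP := inL2B LPxi Lxi.
(* beta - P beta is orthogonal to P xi and fb, and P xi - xi to P beta - betah; what
   remains of P xi - xi is - xi *)
have I1 : inner (beta - betah) (wd tau - xi) = - inner (beta - cell_mean s beta) xi + N fb ^+ 2.
  rewrite (inner_aer _ wtau).
  have h1 := inner_cell_mean hs Lb (cell_mean_step L s xi).
  have h2 := inner_cell_mean hs Lb sfb.
  have h3 := inner_cell_mean hs Lxi sfb.
  have h4 : inner (cell_mean s beta - betah) (cell_mean s xi - xi) = 0.
    by rewrite (inner_ael _ hcb) innerC -(opprB xi) innerNl ?h3 ?oppr0//; exact: inL2B.
  have h5 : inner (cell_mean s beta - betah) fb = N fb ^+ 2 by rewrite (inner_ael _ hcb) L2norm_sqr.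
  have E1 : beta - betah = (beta - cell_mean s beta) + (cell_mean s beta - betah) by rewrite addrA subrK.
  have LbP := inL2B Lb LPb.
  rewrite E1 innerDl//; last exact: inL2D.
  rewrite [X in X + _]innerDr// [X in _ + X]innerDr// h2 h4 h5.
  by rewrite [X in X + _ + _]innerBr// h1; ring.
have I2 : inner (w - wh) (wd xi) = - N fw ^+ 2.
  rewrite (inner_aer _ wxi) innerNr//; congr (- _).
  have h2 := inner_cell_mean hs Lw sfw.
  have h5 : inner (cell_mean s w - wh) fw = N fw ^+ 2 by rewrite (inner_ael _ hcw) L2norm_sqr.
  by move: h2 h5; rewrite !innerBl//; lra.
have := E _ _ tauV xiV; rewrite I1 I2 => EE.
have [Lae Nae] := L2norm_coef LeM ma aB amax0.
have [Lbe Nbe] := L2norm_coef LeV mb bB bmax0.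
set x := N fb in Ntau EE I1 *; set y := N fw in Nxi Ntau EE I2 *.
have x0 : 0 <= x by exact: L2norm_ge0.
have y0 : 0 <= y by exact: L2norm_ge0.
have Pb := poincare_cell_mean L0 hs hb; have Pw := poincare_cell_mean L0 hs hw.
have nb0 := L2norm_ge0 L (wd beta); have nw0 := L2norm_ge0 L (wd w).
have nM0 := L2norm_ge0 L eM; have nV0 := L2norm_ge0 L eV.
pose S := N eM + N eV + mesh_size s * (N (wd beta) + N (wd w)).
have S0 : 0 <= S by rewrite !addr_ge0// mulr_ge0// addr_ge0.
have MS : N eM <= S by rewrite /S -addrA lerDl addr_ge0// mulr_ge0// addr_ge0.
have VS : N eV <= S by rewrite /S addrAC lerDr addr_ge0// mulr_ge0// addr_ge0.
have bS : mesh_size s * N (wd beta) <= S.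
  by rewrite /S mulrDr (addrC (_ * _)) addrA lerDr !addr_ge0// mulr_ge0.
have xy : x + y <= 2 * (K * S).
  have LPbb := inL2B Lb LPb.
  have Nxi' : N xi <= L * (x + y) by rewrite (le_trans Nxi)// ler_wpM2l// lerDr.
  have Ntau' : N tau <= L * (L + 1) * (x + y).
    rewrite (le_trans Ntau)// -mulrA ler_wpM2l// mulrDl mul1r lerD ?lerDl//.
    by rewrite ler_wpM2l// lerDr.
  have t1 : - inner (fun x => a x * eM x) tau <= amax * S * (L * (L + 1) * (x + y)).
    rewrite (le_trans (ler_norm _))// normrN (le_trans (cauchy_schwarz Lae Ltau))//.
    by rewrite ler_pM ?L2norm_ge0// (le_trans Nae)// ler_wpM2l.
  have t2 : - inner (fun x => b x * eV x) xi <= bmax * S * (L * (x + y)).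
    rewrite (le_trans (ler_norm _))// normrN (le_trans (cauchy_schwarz Lbe Lxi))//.
    by rewrite ler_pM ?L2norm_ge0// (le_trans Nbe)// ler_wpM2l.
  have t3 : inner (beta - cell_mean s beta) xi <= S * (L * (x + y)).
    rewrite (le_trans (ler_inner LPbb Lxi))//.
    by rewrite ler_pM ?L2norm_ge0// (le_trans Pb).
  have t4 : e2 * - inner (fun x => b x * eV x) xi <= E2 * (bmax * S * (L * (x + y))).
    rewrite (le_trans (ler_wpM2l e20 t2))// ler_wpM2r//.
    by rewrite !mulr_ge0// addr_ge0.
  have t5 : x ^+ 2 + y ^+ 2 <= K * S * (x + y).
    have -> : K * S * (x + y) = amax * S * (L * (L + 1) * (x + y)) +
      E2 * (bmax * S * (L * (x + y))) + S * (L * (x + y)) by rewrite /K; ring.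
    exact: multiplier_balance EE t1 t4 t3.
  by apply: sum_le_of_sqr => //; rewrite mulr_ge0.
have f1 : N (beta - betah) <= mesh_size s * N (wd beta) + x.
  rewrite (le_trans (L2norm_triangle Lb Lbh LPb))// lerD//.
  by rewrite (L2norm_ae hcb).
have f2 : N (w - wh) <= mesh_size s * N (wd w) + y.
  rewrite (le_trans (L2norm_triangle Lw Lwh LPw))// lerD//.
  by rewrite (L2norm_ae hcw).
rewrite -/S mulrDl mul1r -mulrA.
apply: (@le_trans _ _ (mesh_size s * (N (wd beta) + N (wd w)) + (x + y))).
  by rewrite mulrDr addrACA lerD.
by rewrite lerD// /S lerDr addr_ge0.
Qed.

End Solution.
End Estimates.

(** * Bounded functionals of Bochner integrable maps *)

Section BochnerFunctional.
Context {R : realType} {U : zmodType}.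
Local Notation mu := (@lebesgue_measure R).

Lemma strongly_measurable_carrier (J : set R) (X : nspace R U) u :
  strongly_measurable J X u -> {ae mu, forall t, J t -> carrier X (u t)}.
Proof. by move=> [s _]; apply: ae_imply => t /[apply] -[]. Qed.

(** Strong measurability gives a Borel version of [p \o u]. Dividing it by [C]
    before comparing with the norm of [u] avoids scaling an integral whose
    integrand need not be measurable. *)
Lemma bochner_functional (J : set R) (X : nspace R U) (u : R -> U) (p : U -> R) (C : R) :
  measurable J -> 0 < C -> L1_Bochner J X u ->
  (forall a b, carrier X a -> carrier X b -> `|p a - p b| <= C * nnorm X (a - b)) ->
  (forall a, carrier X a -> `|p a| <= C * nnorm X a) ->
  exists2 m : R -> R, mu.-integrable J (EFin \o m) &
    {ae mu, forall t, J t -> p (u t) = m t}.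
Proof.
move=> mJ C0 [su uoo] lip bnd.
have [m [mm pm]] := strongly_measurable_lipschitz mJ su lip.
exists m => //.
have iC : mu.-integrable J (EFin \o (fun t => C^-1 * m t)).
  apply/integrableP; split.
    by apply/measurable_EFinP; exact: measurable_funM.
  apply: le_lt_trans uoo; rewrite /L1_norm.
  have -> : (\int[mu]_(t in J) (nnorm X (u t))%:E =
      \int[mu]_(t in J) (`|nnorm X (u t)|)%:E)%E.
    apply: ae_eq_integral_nomeas => //.
    apply: ae_imply (strongly_measurable_carrier su) => t /[apply] cu.
    rewrite ger0_norm// -(pmulr_rge0 _ C0).
    exact: le_trans (normr_ge0 _) (bnd _ cu).
  apply: ge0_ae_le_integral_nomeas => //.
  apply: ae_imply2 (strongly_measurable_carrier su) pm => t cu pm Jt /=.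
  rewrite lee_fin -pm// normrM gtr0_norm ?invr_gt0// ler_pdivrMl//.
  by apply: (le_trans (bnd _ (cu Jt))); rewrite ler_wpM2l ?ler_norm// ltW.
have -> : EFin \o m = (fun t => C%:E * (EFin \o (fun t => (C^-1 * m t)%R)) t)%E.
  by apply/funext => t /=; rewrite -EFinM mulrA divff ?mul1r// gt_eqF.
exact: integrableZl.
Qed.

End BochnerFunctional.

Section VolterraUnique.
Context {R : realType}.
Local Notation mu := (@lebesgue_measure R).

(** The difference of two solutions satisfies the homogeneous equation. The
    functions [m] and [m'] are Borel versions of the solutions, for which the
    integral is additive. *)
Lemma volterra_unique (T K : R) (k : R -> R -> R) (F b b' m m' : R -> R) : 0 <= T ->
  (forall t, 0 <= t <= T -> measurable_fun `[0, t] (k t)) ->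
  (forall t s, 0 <= s -> s <= t -> t <= T -> `|k t s| <= K) ->
  mu.-integrable `[0, T] (EFin \o m) -> mu.-integrable `[0, T] (EFin \o m') ->
  {ae mu, forall t, `[0, T]%classic t -> b t = m t} ->
  {ae mu, forall t, `[0, T]%classic t -> b' t = m' t} ->
  {ae mu, forall t, `[0, T]%classic t ->
    b t = F t + \int[mu]_(s in `[0, t]) (k t s * b s)} ->
  {ae mu, forall t, `[0, T]%classic t ->
    b' t = F t + \int[mu]_(s in `[0, t]) (k t s * b' s)} ->
  {ae mu, forall t, `[0, T]%classic t -> b t = b' t}.
Proof.
move=> T0 mk kK im im' bm bm' eb eb'.
pose d t := m t - m' t.
have id : mu.-integrable `[0, T] (EFin \o d).
  have -> : EFin \o d = ((EFin \o m) \- (EFin \o m'))%E.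
    by apply/funext => t /=; rewrite EFinB.
  exact: integrableB.
have sub t : t <= T -> `[0, t] `<=` `[0, T].
  by move=> tT; apply: subset_itv; rewrite bnd_simp.
have ik t g : 0 <= t <= T -> mu.-integrable `[0, T] (EFin \o g) ->
    mu.-integrable `[0, t] (EFin \o (fun s => k t s * g s)).
  move=> /andP[t0 tT] ig.
  have igt : mu.-integrable `[0, t] (EFin \o g) by apply: integrableS ig => //; exact: sub.
  apply: (@le_integrableR _ _ _ (fun s => K * `|g s|)) => //.
  - apply: measurable_funM; first by apply: mk; rewrite t0.
    exact: integrable_measR igt.
  - have -> : EFin \o (fun s => K * `|g s|) = (fun s => K%:E * (EFin \o (fun s => `|g s|)%R) s)%E.
      by apply/funext => s /=; rewrite EFinM.
    by apply: integrableZl => //; exact: integrable_norm igt.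
  - move=> s; rewrite /= in_itv/= => /andP[s0 st].
    by rewrite normrM ler_wpM2r// kK.
have conv t g f : 0 <= t <= T -> {ae mu, forall t, `[0, T]%classic t -> g t = f t} ->
    \int[mu]_(s in `[0, t]) (k t s * g s) = \int[mu]_(s in `[0, t]) (k t s * f s).
  move=> /andP[t0 tT] gf; apply: ae_eq_Rintegral_nomeas => //.
  by apply: ae_imply gf => s gf st; rewrite gf//; exact: (sub t tT).
have dE : {ae mu, forall t, `[0, T]%classic t -> d t = \int[mu]_(s in `[0, t]) (k t s * d s)}.
  have h1 := ae_conj bm bm'.
  have h2 := ae_conj eb eb'.
  apply: ae_imply2 h1 h2 => t h1 h2 Jt.
  have [h1a h1b] := h1 Jt; have [h2a h2b] := h2 Jt.
  have tT : 0 <= t <= T by move: Jt; rewrite /= in_itv.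
  rewrite /d -h1a -h1b h2a h2b (conv t b m)// (conv t b' m')//.
  rewrite opprD addrACA subrr add0r -RintegralB//; try exact: ik.
  by apply: eq_Rintegral => s _; rewrite mulrBr.
have d0 : {ae mu, forall t, `[0, T]%classic t -> d t = 0}.
  apply: (@volterra_zero _ T K) => //; apply: ae_imply dE => t h Jt.
  have tT : 0 <= t <= T by move: Jt; rewrite /= in_itv.
  have /andP[t0 tT'] := tT.
  have idt : mu.-integrable `[0, t] (EFin \o d) by apply: integrableS id => //; exact: sub.
  have iad : mu.-integrable `[0, t] (EFin \o (fun s => `|d s|)) by exact: integrable_norm.
  have ikd := ik t d tT id.
  rewrite h//; have h1 := @le_normr_Rintegral _ _ _ mu _ _ (measurable_itv `[0, t]) ikd.
  apply: (le_trans h1); rewrite -RintegralZl//; apply: le_Rintegral => //.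
  - exact: integrable_norm ikd.
  - have -> : EFin \o (fun s => K * `|d s|) = (fun s => K%:E * (EFin \o (fun s => `|d s|)%R) s)%E.
      by apply/funext => s /=; rewrite EFinM.
    exact: integrableZl.
  - move=> s; rewrite /= in_itv/= => /andP[s0 st].
    by rewrite normrM ler_wpM2r// kK.
have h1 := ae_conj bm bm'.
apply: ae_imply2 h1 d0 => t h1 h2 Jt; have [-> ->] := h1 Jt.
by apply/eqP; rewrite -subr_eq0; apply/eqP; exact: h2.
Qed.

End VolterraUnique.

Section Functionals.
Context {R : realType}.
Variable L : R.
Hypothesis L0 : 0 < L.
Local Notation mu := (@lebesgue_measure R).
Local Notation inner := (L2_inner L).
Local Notation N := (nnorm (L2 L)).
Local Notation inL2 := (carrier (L2 L)).
Local Notation inH1 := (carrier (H1 L)).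
Local Notation ae_on := (ae_on L).
Local Notation wd := (weak_derivative L).
Local Notation F := (R -> R).

Lemma prod_norm_ge (U V : zmodType) (X : nspace R U) (Y : nspace R V) p :
  nnorm X p.1 <= nnorm (prod_space X Y) p /\ nnorm Y p.2 <= nnorm (prod_space X Y) p.
Proof.
rewrite /=; split; apply: (le_trans (ler_norm _)); rewrite -sqrtr_sqr ler_wsqrtr//.
  by rewrite lerDl sqr_ge0.
by rewrite lerDr sqr_ge0.
Qed.

Lemma prod_norm_le (U V : zmodType) (X : nspace R U) (Y : nspace R V) p :
  0 <= nnorm X p.1 -> 0 <= nnorm Y p.2 ->
  nnorm (prod_space X Y) p <= nnorm X p.1 + nnorm Y p.2.
Proof.
move=> h1 h2; rewrite /= -[leRHS]ger0_norm ?addr_ge0// -sqrtr_sqr ler_wsqrtr// sqrrD.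
by rewrite lerD2r lerDl mulrn_wge0// mulr_ge0.
Qed.

Lemma flux_balance (x1 x2 x3 y1 y2 y3 : R) :
  x1 - x2 - x3 - (y1 - y2 - y3) = x1 - y1 - (x2 - y2) - (x3 - y3).
Proof. by ring. Qed.

(** The bilinear form [B] of the first equation, applied to the stresses
    contained in the unknown [x]. *)
Definition flux (eta v : F) (x : (F * F) * (F * F)) : R :=
  inner (wd x.1.1 - x.1.2) eta - inner (wd x.1.2) v.

Variables (X Y : nspace R F).
Hypothesis XH1 : carrier X `<=` inH1.
Hypothesis Xn : nnorm X = nnorm (H1 L).
Local Notation XX := (prod_space (prod_space X X) (prod_space Y Y)).

Lemma flux_bound eta v : inL2 eta -> inL2 v -> forall x,
  inH1 x.1.1 -> inH1 x.1.2 ->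
  `|flux eta v x| <= (2 * N eta + N v + 1) * nnorm XX x.
Proof.
move=> Le Lv x h1 h2.
have L1 := wd_inL2 h1; have L2' := wd_inL2 h2.
have [n1 n2] := nnormH1_ge L x.1.1; have [n3 n4] := nnormH1_ge L x.1.2.
have [p1 _] := prod_norm_ge (prod_space X X) (prod_space Y Y) x.
have [p2 p3] := prod_norm_ge X X x.1.
rewrite Xn in p2 p3.
set n := nnorm XX x in p1 *.
have w1 : N (wd x.1.1) <= n by exact: le_trans (le_trans n2 p2) p1.
have w2 : N x.1.2 <= n by exact: le_trans (le_trans n3 p3) p1.
have w3 : N (wd x.1.2) <= n by exact: le_trans (le_trans n4 p3) p1.
have n0 : 0 <= n by exact: le_trans (L2norm_ge0 L _) w1.
rewrite /flux innerBl//; last exact: h2.1.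
have c1 := cauchy_schwarz L1 Le; have c2 := cauchy_schwarz h2.1 Le.
have c3 := cauchy_schwarz L2' Lv.
apply: (@le_trans _ _ (n * N eta + n * N eta + n * N v)).
  apply: (le_trans (ler_normB _ _)); apply: lerD.
    apply: (le_trans (ler_normB _ _)); apply: lerD.
      by apply: (le_trans c1); exact: ler_wpM2r (L2norm_ge0 L _) _ _ w1.
    by apply: (le_trans c2); exact: ler_wpM2r (L2norm_ge0 L _) _ _ w2.
  by apply: (le_trans c3); exact: ler_wpM2r (L2norm_ge0 L _) _ _ w3.
have -> : (2 * N eta + N v + 1) * n = n * N eta + n * N eta + n * N v + n by ring.
by rewrite lerDl.
Qed.

Lemma fluxB eta v : inL2 eta -> inL2 v -> forall x y,
  inH1 x.1.1 -> inH1 x.1.2 -> inH1 y.1.1 -> inH1 y.1.2 ->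
  flux eta v x - flux eta v y = flux eta v (x - y).
Proof.
move=> Le Lv x y hx1 hx2 hy1 hy2; rewrite /flux.
have L1 := wd_inL2 hx1; have L2' := wd_inL2 hx2.
have L3 := wd_inL2 hy1; have L4 := wd_inL2 hy2.
rewrite (_ : (x - y).1.1 = x.1.1 - y.1.1)// (_ : (x - y).1.2 = x.1.2 - y.1.2)//.
rewrite (inner_ael _ (wdB hx2 hy2)).
rewrite (inner_ael _ (ae_onB (wdB hx1 hy1) (ae_on_refl L (x.1.2 - y.1.2)))).
have l1 := hx1.1; have l2 := hx2.1; have l3 := hy1.1; have l4 := hy2.1.
rewrite !innerBl//; try exact: inL2B.
exact: flux_balance.
Qed.

Lemma flux_integrable T eta v u : inL2 eta -> inL2 v ->
  L1_Bochner `[0, T] XX u ->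
  exists2 m : R -> R, mu.-integrable `[0, T] (EFin \o m) &
    {ae mu, forall t, `[0, T]%classic t -> flux eta v (u t) = m t}.
Proof.
move=> Le Lv hu.
have C0 : 0 < 2 * N eta + N v + 1.
  by rewrite ltr_wpDl// addr_ge0 ?L2norm_ge0// mulr_ge0 ?L2norm_ge0.
apply: (bochner_functional (C := 2 * N eta + N v + 1) _ C0 hu) => //.
- move=> a b [[a1 a2] _] [[b1 b2] _].
  have [ha1 ha2 hb1 hb2] := And4 (XH1 a1) (XH1 a2) (XH1 b1) (XH1 b2).
  rewrite fluxB//; apply: flux_bound => //; exact: inH1B.
- by move=> a [[a1 a2] _]; apply: flux_bound => //; exact: XH1.
Qed.

End Functionals.

(** * The total error at a fixed time *)

Section AEMeasurable.
Context {R : realType}.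
Local Notation mu := (@lebesgue_measure R).
Implicit Types (J : set R) (p q : R -> R).

Definition ae_measurable J p :=
  exists m : R -> R, measurable_fun J m /\ {ae mu, forall t, J t -> p t = m t}.

Lemma ae_measurableD J p q : ae_measurable J p -> ae_measurable J q ->
  ae_measurable J (fun t => p t + q t).
Proof.
move=> [m [mm pm]] [m' [mm' qm']]; exists (fun t => m t + m' t); split.
  exact: measurable_funD.
by apply: ae_imply2 pm qm' => t h h' Jt; rewrite h// h'.
Qed.

Lemma ge0_integralD_ae J p q : measurable J ->
  (forall t, 0 <= p t) -> (forall t, 0 <= q t) ->
  ae_measurable J p -> ae_measurable J q ->
  (\int[mu]_(t in J) (p t + q t)%:E =
   \int[mu]_(t in J) (p t)%:E + \int[mu]_(t in J) (q t)%:E)%E.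
Proof.
move=> mJ p0 q0 [m [mm pm]] [m' [mm' qm']].
have E f g : (forall t, 0 <= f t) -> {ae mu, forall t, J t -> f t = g t} ->
    (\int[mu]_(t in J) (f t)%:E = \int[mu]_(t in J) (`|g t|)%:E)%E.
  move=> f0 fg; apply: ae_eq_integral_nomeas => //.
  by apply: ae_imply fg => t fg Jt; rewrite -fg// ger0_norm.
rewrite (E p m)// (E q m')// -ge0_integralD//; first last.
- by apply/measurable_EFinP; exact: measurableT_comp.
- by apply/measurable_EFinP; exact: measurableT_comp.
apply: ae_eq_integral_nomeas => //.
by apply: ae_imply2 pm qm' => t h h' Jt; rewrite -h// -h'// !ger0_norm.
Qed.

Lemma ge0_integralD4_ae J (p1 p2 p3 p4 : R -> R) : measurable J ->
  (forall t, 0 <= p1 t) -> (forall t, 0 <= p2 t) ->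
  (forall t, 0 <= p3 t) -> (forall t, 0 <= p4 t) ->
  ae_measurable J p1 -> ae_measurable J p2 ->
  ae_measurable J p3 -> ae_measurable J p4 ->
  (\int[mu]_(t in J) (p1 t + p2 t + p3 t + p4 t)%:E =
   \int[mu]_(t in J) (p1 t)%:E + \int[mu]_(t in J) (p2 t)%:E +
   \int[mu]_(t in J) (p3 t)%:E + \int[mu]_(t in J) (p4 t)%:E)%E.
Proof.
move=> mJ h1 h2 h3 h4 m1 m2 m3 m4.
have m12 := ae_measurableD m1 m2; have m123 := ae_measurableD m12 m3.
have h12 t : 0 <= p1 t + p2 t by rewrite addr_ge0.
have h123 t : 0 <= p1 t + p2 t + p3 t by rewrite addr_ge0.
by rewrite (ge0_integralD_ae mJ h123 h4 m123 m4) (ge0_integralD_ae mJ h12 h3 m12 m3)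
  (ge0_integralD_ae mJ h1 h2 m1 m2).
Qed.

Lemma ge0_integralZ_ae J p (c : R) : measurable J -> 0 <= c -> (forall t, 0 <= p t) ->
  ae_measurable J p ->
  (\int[mu]_(t in J) (c * p t)%:E = c%:E * \int[mu]_(t in J) (p t)%:E)%E.
Proof.
move=> mJ c0 p0 [m [mm pm]].
have pm' : {ae mu, forall t, J t -> p t = `|m t|}.
  by apply: ae_imply pm => t h Jt; rewrite -h// ger0_norm.
rewrite (@ae_eq_integral_nomeas _ _ _ mu J (fun t => (c * p t)%:E) (fun t => c%:E * (`|m t|)%:E)%E)//.
  rewrite ge0_integralZl//; first last.
  - by apply/measurable_EFinP; exact: measurableT_comp.
  congr (_ * _)%E; apply: ae_eq_integral_nomeas => //.
  by apply: ae_imply pm' => t /[apply] ->.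
by apply: ae_imply pm' => t /[apply] ->; rewrite EFinM.
Qed.

Lemma measurable_inv_pos (D : set R) (f : R -> R) : measurable_fun D f ->
  (forall x, D x -> 0 < f x) -> measurable_fun D (fun x => (f x)^-1).
Proof.
move=> mf f0; apply: (@eq_measurable_fun _ _ _ _ _ (fun x => f x `^ (-1))).
  by move=> x /set_mem Dx; rewrite powR_inv1// ltW// f0.
by apply: (@measurableT_comp _ _ _ _ _ _ (fun y : R => y `^ (-1))) => //; exact: measurable_powR.
Qed.

(** Continuity of the kernel on the triangle is restricted to a slice of fixed
    [t]. *)
Lemma within_slice (T : R) (k : R -> R -> R) (t : R) :
  {within [set p : R * R | 0 <= p.2 <= p.1 /\ p.1 <= T],
     continuous (fun p : R * R => k p.1 p.2)} ->
  t <= T -> measurable_fun `[0, t] (k t).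
Proof.
move=> kc tT; apply: subspace_continuous_measurable_fun => //.
apply/subspace_continuousP => x xt.
have xt' : 0 <= x <= t by move: xt; rewrite /= in_itv.
move/subspace_continuousP : kc => /(_ (t, x)) /= kc.
have {}kc := kc (conj xt' tT).
apply: (@cvg_comp _ _ _ (fun y => (t, y)) (fun p : R * R => k p.1 p.2) _
  (within [set p : R * R | 0 <= p.2 <= p.1 /\ p.1 <= T] (nbhs (t, x)))); last exact: kc.
move=> P; rewrite /within /= => hP.
case: hP => -[A B] /= [nA nB] AB.
apply: filterS nB => y By yt; apply: (AB (t, y)) => /=.
  by split => //; exact: nbhs_singleton nA.
by split => //; move: yt; rewrite in_itv.
Qed.

End AEMeasurable.

Section Pointwise.
Context {R : realType}.
Variable L : R.
Hypothesis L0 : 0 < L.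
Local Notation Omega := `]0, L[%classic.
Local Notation inner := (L2_inner L).
Local Notation N := (nnorm (L2 L)).
Local Notation inL2 := (carrier (L2 L)).
Local Notation inH1 := (carrier (H1 L)).
Local Notation ae_on := (ae_on L).
Local Notation wd := (weak_derivative L).
Local Notation F := (R -> R).

Lemma wd_congr (u v : F) : inH1 u -> inL2 v -> ae_on u v -> ae_on (wd v) (wd u).
Proof.
move=> hu Lv uv; apply: wd_ae Lv _.
by apply: iwd_ae uv (ae_on_refl L (wd u)) (wd_inL2 hu) (wdP hu).
Qed.

(** Only the second derivative enters the final estimate, so measurability in
    time is needed for this seminorm alone. *)
Lemma H2_lipschitz (u v : F) : carrier (H2 L) u -> carrier (H2 L) v ->
  `|N (wd (wd u)) - N (wd (wd v))| <= 1 * nnorm (H2 L) (u - v).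
Proof.
move=> [hu hu'] [hv hv']; rewrite mul1r.
have L1 := wd_inL2 hu'; have L2' := wd_inL2 hv'.
apply: (le_trans (L2norm_lipschitz L1 L2')).
have E2 := wdB hu' hv'; have h2 := inH1B hu hv.
have E1 := wd_congr (inH1B hu' hv') (wd_inL2 h2) (ae_on_sym (wdB hu hv)).
rewrite -(L2norm_ae (ae_on_trans E1 E2)) /= -[leLHS]ger0_norm ?L2norm_ge0// -sqrtr_sqr ler_wsqrtr//.
by rewrite lerDr addr_ge0// sqr_ge0.
Qed.

Lemma H2_ge (u : F) : N (wd (wd u)) <= nnorm (H2 L) u.
Proof.
rewrite /= -[leLHS]ger0_norm ?L2norm_ge0// -sqrtr_sqr ler_wsqrtr//.
by rewrite lerDr addr_ge0// sqr_ge0.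
Qed.

Lemma H1_lipschitz (u v : F) : inH1 u -> inH1 v ->
  `|N (wd u) - N (wd v)| <= 1 * nnorm (H1 L) (u - v).
Proof.
move=> hu hv; rewrite mul1r.
apply: (le_trans (L2norm_lipschitz (wd_inL2 hu) (wd_inL2 hv))).
by rewrite -(L2norm_ae (wdB hu hv)); exact: (nnormH1_ge L (u - v)).2.
Qed.

(** The part of the regularity norms that the error estimate consumes. *)
Definition smoothness (x : (F * F) * (F * F)) : R :=
  N (wd (wd x.1.1)) + N (wd (wd x.1.2)) + N (wd x.2.1) + N (wd x.2.2).

Lemma inner_step_fun0 (s : seq R) (f : F) : itv_partition 0 L s -> inL2 f ->
  inner f (step_fun s (fun=> 0)) = 0.
Proof. by move=> hs Lf; rewrite (inner_step_fun hs)// big1// => i _; rewrite mul0r. Qed.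

Lemma equation2_balance (x1 x1' x2 x2' y1 y1' y2 y2' e : R) :
  x1 + e * x2 + y1 - y2 = 0 -> x1' + e * x2' + y1' - y2' = 0 ->
  x1 - x1' + e * (x2 - x2') + (y1 - y1') - (y2 - y2') = 0.
Proof. by rewrite mulrBr; lra. Qed.

Lemma sub_cancel_l (a b c d : R) : a = 0 -> c = 0 -> a - b = c - d -> b = d.
Proof. by lra. Qed.

Lemma sub_cancel_r (a b c d : R) : b = 0 -> d = 0 -> a - b = c - d -> a = c.
Proof. by lra. Qed.

Lemma flux_step_fun_r (s : seq R) c x y : itv_partition 0 L s ->
  inH1 x.1.1 -> inH1 x.1.2 -> inH1 y.1.1 -> inH1 y.1.2 ->
  flux L (step_fun s (fun=> 0)) c x = flux L (step_fun s (fun=> 0)) c y ->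
  inner (wd x.1.2) c = inner (wd y.1.2) c.
Proof.
move=> hs x1 x2 y1 y2.
have h1 := inner_step_fun0 hs (inL2B (wd_inL2 x1) (inH1_inL2 x2)).
have h2 := inner_step_fun0 hs (inL2B (wd_inL2 y1) (inH1_inL2 y2)).
exact: sub_cancel_l h1 h2.
Qed.

Lemma flux_step_fun_l (s : seq R) c x y : itv_partition 0 L s ->
  inH1 x.1.2 -> inH1 y.1.2 ->
  flux L c (step_fun s (fun=> 0)) x = flux L c (step_fun s (fun=> 0)) y ->
  inner (wd x.1.1 - x.1.2) c = inner (wd y.1.1 - y.1.2) c.
Proof.
move=> hs x2 y2.
exact: sub_cancel_r (inner_step_fun0 hs (wd_inL2 x2)) (inner_step_fun0 hs (wd_inL2 y2)).
Qed.

Lemma error_split1 (K1 K2 h a1 a2 a3 a4 x : R) : 0 <= K1 -> 0 <= K2 -> 0 <= h ->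
  0 <= a1 -> 0 <= a2 -> 0 <= a3 -> 0 <= a4 -> x <= K1 * (h * (a1 + a2)) ->
  x <= (K1 + K2 * (K1 + 1)) * (h * (a1 + a2 + a3 + a4)).
Proof.
move=> k1 k2 h0 p1 p2 p3 p4 hx; apply: (le_trans hx).
rewrite ler_pM ?mulr_ge0 ?addr_ge0//; first by rewrite lerDl mulr_ge0// addr_ge0.
by rewrite ler_wpM2l// -addrA lerDl addr_ge0.
Qed.

Lemma error_split2 (K1 K2 h a1 a2 a3 a4 x1 x2 x3 x4 y : R) : 0 <= K1 -> 0 <= K2 -> 0 <= h ->
  0 <= a1 -> 0 <= a2 -> 0 <= a3 -> 0 <= a4 -> 0 <= x2 -> 0 <= x4 ->
  x1 + x2 + x3 + x4 <= K1 * (h * (a1 + a2)) ->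
  y <= K2 * (x1 + x3 + h * (a3 + a4)) ->
  y <= (K1 + K2 * (K1 + 1)) * (h * (a1 + a2 + a3 + a4)).
Proof.
move=> k1 k2 h0 p1 p2 p3 p4 q2 q4 hx hy; apply: (le_trans hy).
have A0 : 0 <= h * (a1 + a2) by rewrite mulr_ge0// addr_ge0.
have B0 : 0 <= h * (a3 + a4) by rewrite mulr_ge0// addr_ge0.
have -> : h * (a1 + a2 + a3 + a4) = h * (a1 + a2) + h * (a3 + a4) by ring.
move: (h * (a1 + a2)) (h * (a3 + a4)) A0 B0 hx => A B A0 B0 hx.
apply: (@le_trans _ _ (K2 * ((K1 + 1) * (A + B)))).
  rewrite ler_wpM2l// mulrDl mul1r mulrDr.
  have := mulr_ge0 k1 B0; lra.
by rewrite mulrA ler_wpM2r ?addr_ge0// lerDr.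
Qed.

(** Orthogonality of the stress errors and the difference of the second equations
    are the hypotheses of [stress_estimate] and [multiplier_estimate]; finite
    element test functions are admissible in the continuous problem too. *)
Lemma pointwise_error (amin amax bmax epsmax : R) :
  0 < amin -> 0 <= amax -> 0 <= bmax -> 0 <= epsmax ->
  exists2 K : R, 0 <= K &
  forall (eps : R) (s : seq R) (I kappa : F) (x xh : (F * F) * (F * F)),
  0 < eps <= epsmax -> itv_partition 0 L s ->
  measurable_fun Omega (fun y => (I y)^-1) -> measurable_fun Omega (fun y => (kappa y)^-1) ->
  (forall y, Omega y -> amin <= (I y)^-1 <= amax) ->
  (forall y, Omega y -> 0 <= (kappa y)^-1 <= bmax) ->
  carrier (H2 L) x.1.1 -> carrier (H2 L) x.1.2 -> inH1 x.2.1 -> inH1 x.2.2 ->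
  carrier (Vh L s) xh.1.1 -> carrier (Vh L s) xh.1.2 ->
  carrier (Qh L s) xh.2.1 -> carrier (Qh L s) xh.2.2 ->
  (forall c c', flux L (step_fun s c) (step_fun s c') x = flux L (step_fun s c) (step_fun s c') xh) ->
  (forall tau xi, inH1 tau -> inH1 xi -> mixed_equation2 L eps I kappa (fun=> x) 0 tau xi) ->
  (forall tau xi, carrier (Vh L s) tau -> carrier (Vh L s) xi ->
    mixed_equation2 L eps I kappa (fun=> xh) 0 tau xi) ->
  nnorm (prod_space (H1 L) (H1 L)) (x.1 - xh.1) <= K * (mesh_size s * smoothness x) /\
  nnorm (prod_space (L2 L) (L2 L)) (x.2 - xh.2) <= K * (mesh_size s * smoothness x).
Proof.
move=> amin0 amax0 bmax0 epsmax0.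
have E20 : 0 <= epsmax ^+ 2 by rewrite sqr_ge0.
have [K1 K10 H1'] := stress_estimate L0 amin0 amax0 bmax0 E20.
have [K2 K20 H2'] := multiplier_estimate L0 amax0 bmax0 E20.
exists (K1 + K2 * (K1 + 1)).
  by rewrite addr_ge0// mulr_ge0// addr_ge0.
move=> eps s I kappa [[M V] [be w]] [[Mh Vt] [bh wh]] /= /andP[eps0 epsM] hs mI mk IB kB
  [hM hM'] [hV hV'] hbe hw hMh hVt hbh hwh hflux eq2 eq2h.
have e2B : 0 <= eps ^+ 2 <= epsmax ^+ 2.
  by rewrite sqr_ge0/= lerXn2r ?nnegrE// ltW.
have [LM LV LMh LVt] : [/\ inL2 M, inL2 V, inL2 Mh & inL2 Vt].
  by split; [exact: hM.1|exact: hV.1|exact: hMh.1.1|exact: hVt.1.1].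
have [Lbe Lw Lbh Lwh] : [/\ inL2 be, inL2 w, inL2 bh & inL2 wh].
  by split; [exact: hbe.1|exact: hw.1|exact: hbh.1|exact: hwh.1].
have [LM' LV' LMh' LVt'] : [/\ inL2 (wd M), inL2 (wd V), inL2 (wd Mh) & inL2 (wd Vt)].
  by split; apply: wd_inL2 => //; [exact: hMh.1|exact: hVt.1].
have IB' y : Omega y -> `|(I y)^-1| <= amax.
  by move=> Oy; have /andP[h1 h2] := IB y Oy; rewrite ger0_norm// (le_trans (ltW amin0)).
have kB' y : Omega y -> `|(kappa y)^-1| <= bmax.
  by move=> Oy; have /andP[h1 h2] := kB y Oy; rewrite ger0_norm.
have O1 c : inner (wd V - wd Vt) (step_fun s c) = 0.
  have h := flux_step_fun_r (x := ((M, V), (be, w))) (y := ((Mh, Vt), (bh, wh))) hs hM hV hMh.1 hVt.1 (hflux (fun=> 0) c).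
  by rewrite (innerBl LV' LVt' (step_fun_inL2 L s c)) h; exact: subrr.
have O2 c : inner ((wd M - V) - (wd Mh - Vt)) (step_fun s c) = 0.
  have h := flux_step_fun_l (x := ((M, V), (be, w))) (y := ((Mh, Vt), (bh, wh))) hs hV hVt.1 (hflux c (fun=> 0)).
  by rewrite (innerBl (inL2B LM' LV) (inL2B LMh' LVt) (step_fun_inL2 L s c)) h; exact: subrr.
have E tau xi : carrier (Vh L s) tau -> carrier (Vh L s) xi ->
    inner (fun y => (I y)^-1 * (M - Mh) y) tau
    + eps ^+ 2 * inner (fun y => (kappa y)^-1 * (V - Vt) y) xi
    + inner (be - bh) (wd tau - xi) - inner (w - wh) (wd xi) = 0.
  move=> ht hx; have h1 := eq2 _ _ ht.1 hx.1; have h2 := eq2h _ _ ht hx.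
  move: h1 h2; rewrite /mixed_equation2 /=.
  have Lt : inL2 tau := ht.1.1; have Lx : inL2 xi := hx.1.1.
  have Lwt := wd_inL2 ht.1; have Lwx := wd_inL2 hx.1.
  have [Lm1 _] := L2norm_coef LM mI IB' amax0; have [Lm2 _] := L2norm_coef LMh mI IB' amax0.
  have [Lv1 _] := L2norm_coef LV mk kB' bmax0; have [Lv2 _] := L2norm_coef LVt mk kB' bmax0.
  have -> : (fun y => M y / I y) = (fun y => (I y)^-1 * M y) by apply/funext => y; rewrite mulrC.
  have -> : (fun y => Mh y / I y) = (fun y => (I y)^-1 * Mh y) by apply/funext => y; rewrite mulrC.
  have -> : (fun y => (I y)^-1 * (M - Mh) y) = (fun y => (I y)^-1 * M y) - (fun y => (I y)^-1 * Mh y).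
    by apply/funext => y; rewrite (_ : (M - Mh) y = M y - Mh y)// mulrBr.
  have -> : (fun y => (kappa y)^-1 * (V - Vt) y) = (fun y => (kappa y)^-1 * V y) - (fun y => (kappa y)^-1 * Vt y).
    by apply/funext => y; rewrite (_ : (V - Vt) y = V y - Vt y)// mulrBr.
  move=> h1 h2.
  rewrite (innerBl Lm1 Lm2 Lt) (innerBl Lv1 Lv2 Lx) (innerBl Lw Lwh Lwx).
  rewrite (innerBl Lbe Lbh (inL2B Lwt Lx)).
  exact: equation2_balance h1 h2.
have S1 := H1' s _ _ _ M V Mh Vt (be - bh) (w - wh) hs mI mk IB kB e2B hM hM' hV hV' hMh hVt
  (inL2B Lbe Lbh) (inL2B Lw Lwh) O1 O2 E.
have S2 := H2' s _ _ _ (M - Mh) (V - Vt) be w bh wh hs mI mk IB' kB' e2B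
  (inL2B LM LMh) (inL2B LV LVt) hbe hw hbh hwh E.
rewrite /smoothness /=.
have h0 : 0 <= mesh_size s by exact: bigmax_ge_id.
have n1 := L2norm_ge0 L (wd (wd M)); have n2 := L2norm_ge0 L (wd (wd V)).
have n3 := L2norm_ge0 L (wd be); have n4 := L2norm_ge0 L (wd w).
have n5 := L2norm_ge0 L (wd M - wd Mh); have n6 := L2norm_ge0 L (wd V - wd Vt).
have n7 := L2norm_ge0 L (M - Mh); have n8 := L2norm_ge0 L (V - Vt).
have g1 : nnorm (prod_space (H1 L) (H1 L)) (M - Mh, V - Vt) <=
    N (M - Mh) + N (wd M - wd Mh) + N (V - Vt) + N (wd V - wd Vt).
  have [p1 _] := nnormH1_ge L (M - Mh); have [p2 _] := nnormH1_ge L (V - Vt).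
  apply: (le_trans (prod_norm_le (X := H1 L) (Y := H1 L) (p := (M - Mh, V - Vt)) (le_trans n7 p1) (le_trans n8 p2))).
  rewrite -[leRHS]addrA; apply: lerD; apply: (le_trans (nnormH1_le L _)); apply: lerD (lexx _) _.
    by rewrite (L2norm_ae (wdB hM hMh.1)).
  by rewrite (L2norm_ae (wdB hV hVt.1)).
have g2 : nnorm (prod_space (L2 L) (L2 L)) (be - bh, w - wh) <= N (be - bh) + N (w - wh).
  exact: (prod_norm_le (X := L2 L) (Y := L2 L) (p := (be - bh, w - wh)) (L2norm_ge0 L (be - bh)) (L2norm_ge0 L (w - wh))).
split; [apply: (le_trans g1)|apply: (le_trans g2)].
  exact: error_split1 K10 K20 h0 n1 n2 n3 n4 S1.
exact: error_split2 K10 K20 h0 n1 n2 n3 n4 n5 n6 S1 S2.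
Qed.

End Pointwise.

(** * Integration in time *)

Section Assembly.
Context {R : realType}.
Local Notation mu := (@lebesgue_measure R).
Local Notation F := (R -> R).
Local Notation J T := `[0, T]%classic.

(** Both unknowns satisfy the same Volterra equation for the fixed test pair, with
    the same load as inhomogeneity. *)
Lemma flux_eq (L T K : R) (k : R -> R -> R) (X Y : nspace R F) (fE gE : R -> F)
    (eps : R) (I kappa : F) (u uh : R -> (F * F) * (F * F)) (eta v : F) :
  0 < L -> 0 <= T ->
  (forall t, 0 <= t <= T -> measurable_fun `[0, t] (k t)) ->
  (forall t s, 0 <= s -> s <= t -> t <= T -> `|k t s| <= K) ->
  carrier X `<=` carrier (H1 L) -> nnorm X = nnorm (H1 L) ->
  carrier Y `<=` carrier (L2 L) -> carrier X (cst 0) ->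
  mixed_solution L T (H1 L) (L2 L) eps I kappa k fE gE u ->
  mixed_solution L T X Y eps I kappa k fE gE uh ->
  carrier Y eta -> carrier Y v ->
  {ae mu, forall t, J T t -> flux L eta v (u t) = flux L eta v (uh t)}.
Proof.
move=> L0 T0 mk kK XH Xn YL X0 [Bu eu] [Buh euh] Ye Yv.
have Le := YL _ Ye; have Lv := YL _ Yv.
have [m im um] := @flux_integrable _ L (H1 L) (L2 L) (fun _ h => h) erefl T eta v u Le Lv Bu.
have [m' im' um'] := @flux_integrable _ L X Y XH Xn T eta v uh Le Lv Buh.
have H0 : carrier (H1 L) (cst 0) := XH _ X0.
apply: (volterra_unique (F := fun t => - L2_inner L (fE t) v - L2_inner L (gE t) eta)
  T0 mk kK im im' um um').
  apply: ae_imply eu => t h Jt.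
  exact: (h Jt (cst 0) (cst 0) eta v H0 H0 Le Lv).1.
apply: ae_imply euh => t h Jt.
exact: (h Jt (cst 0) (cst 0) eta v X0 X0 Ye Yv).1.
Qed.

(** The null set of [flux_eq] depends on the test pair. Only the finitely many
    cell indicators are used, and then linearity extends the identity to all
    piecewise constants at once. *)
Lemma flux_eq_steps (L T K : R) (k : R -> R -> R) (s : seq R) (fE gE : R -> F)
    (eps : R) (I kappa : F) (u uh : R -> (F * F) * (F * F)) :
  0 < L -> 0 <= T -> itv_partition 0 L s ->
  (forall t, 0 <= t <= T -> measurable_fun `[0, t] (k t)) ->
  (forall t s, 0 <= s -> s <= t -> t <= T -> `|k t s| <= K) ->
  mixed_solution L T (H1 L) (L2 L) eps I kappa k fE gE u ->
  mixed_solution L T (Vh L s) (Qh L s) eps I kappa k fE gE uh ->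
  {ae mu, forall t, J T t -> forall c c',
    flux L (step_fun s c) (step_fun s c') (u t) = flux L (step_fun s c) (step_fun s c') (uh t)}.
Proof.
move=> L0 T0 hs mk kK hu huh.
have V0 : carrier (Vh L s) (cst 0).
  have := affine_Vh s L0 0 0; congr (carrier _ _).
  by apply/funext => x /=; rewrite mul0r addr0.
have VH : carrier (Vh L s) `<=` carrier (H1 L) by move=> x [].
have QL : carrier (Qh L s) `<=` carrier (L2 L) by move=> x [].
have base eta v := @flux_eq L T K k (Vh L s) (Qh L s) fE gE eps I kappa u uh eta v L0 T0 mk kK
  VH erefl QL V0 hu huh.
have Q0 := step_fun_Qh hs (fun=> 0).
have Qi i : (i < size s)%N -> carrier (Qh L s) (cell_indicator s i).
  by move=> i_n; rewrite cell_indicatorE//; exact: step_fun_Qh.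
have A : {ae mu, forall t, forall i, (i < size s)%N -> J T t ->
    flux L (cell_indicator s i) (step_fun s (fun=> 0)) (u t) = flux L (cell_indicator s i) (step_fun s (fun=> 0)) (uh t)}.
  apply: (@ae_foralln _ _ R mu (fun i t => (i < size s)%N -> J T t -> _ = _)) => i.
  have [i_n|i_n] := boolP (i < size s)%N; last by apply: aeW => t ii; case/negP: i_n.
  by apply: ae_imply (base _ _ (Qi _ i_n) Q0).
have B : {ae mu, forall t, forall i, (i < size s)%N -> J T t ->
    flux L (step_fun s (fun=> 0)) (cell_indicator s i) (u t) = flux L (step_fun s (fun=> 0)) (cell_indicator s i) (uh t)}.
  apply: (@ae_foralln _ _ R mu (fun i t => (i < size s)%N -> J T t -> _ = _)) => i.
  have [i_n|i_n] := boolP (i < size s)%N; last by apply: aeW => t ii; case/negP: i_n.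
  by apply: ae_imply (base _ _ Q0 (Qi _ i_n)).
have cu := strongly_measurable_carrier hu.1.1.
have cuh := strongly_measurable_carrier huh.1.1.
have C : {ae mu, forall t, J T t -> carrier (H1 L) (u t).1.1 /\ carrier (H1 L) (u t).1.2 /\
   carrier (H1 L) (uh t).1.1 /\ carrier (H1 L) (uh t).1.2}.
  apply: ae_imply2 cu cuh => t h h' Jt.
  have [[h1 h2] _] := h Jt; have [[h3 h4] _] := h' Jt.
  by split; [|split; [|split]] => //; apply: VH.
have AB := ae_imply2 (fun t (h : forall i, _ -> _ -> _ = _) (h' : forall i, _ -> _ -> _ = _) => conj h h') A B.
apply: ae_imply2 AB C => t [At Bt] Ct Jt c c'.
have [h1 [h2 [h3 h4]]] := Ct Jt.
have [g1 g2 g3 g4] : [/\ carrier (L2 L) (weak_derivative L (u t).1.1 - (u t).1.2),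
   carrier (L2 L) (weak_derivative L (u t).1.2),
   carrier (L2 L) (weak_derivative L (uh t).1.1 - (uh t).1.2) &
   carrier (L2 L) (weak_derivative L (uh t).1.2)].
  split; [exact: inL2B (wd_inL2 h1) (inH1_inL2 h2)|exact: wd_inL2|
    exact: inL2B (wd_inL2 h3) (inH1_inL2 h4)|exact: wd_inL2].
have O1 : L2_inner L ((weak_derivative L (u t).1.1 - (u t).1.2) -
    (weak_derivative L (uh t).1.1 - (uh t).1.2)) (step_fun s c) = 0.
  apply: (orthogonal_steps hs (inL2B g1 g3)) => i i_n.
  have Lu := cell_indicator_inL2 L i_n.
  have h := flux_step_fun_l hs h2 h4 (At i i_n Jt).
  by rewrite (innerBl g1 g3 Lu) h; exact: subrr.
have O2 : L2_inner L (weak_derivative L (u t).1.2 - weak_derivative L (uh t).1.2) (step_fun s c') = 0.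
  apply: (orthogonal_steps hs (inL2B g2 g4)) => i i_n.
  have Lu := cell_indicator_inL2 L i_n.
  have h := flux_step_fun_r hs h1 h2 h3 h4 (Bt i i_n Jt).
  by rewrite (innerBl g2 g4 Lu) h; exact: subrr.
move: O1 O2; rewrite (innerBl g1 g3 (step_fun_inL2 L s c)) (innerBl g2 g4 (step_fun_inL2 L s c')).
move=> /eqP; rewrite subr_eq0 => /eqP e1 /eqP; rewrite subr_eq0 => /eqP e2.
by rewrite /flux e1 e2.
Qed.

Lemma bochner_ae_measurable (T : R) (X : nspace R F) (u : R -> F) (p : F -> R) :
  L1_Bochner (J T) X u ->
  (forall a b, carrier X a -> carrier X b -> `|p a - p b| <= 1 * nnorm X (a - b)) ->
  ae_measurable (J T) (fun t => p (u t)).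
Proof. by move=> [su _] lip; exact: strongly_measurable_lipschitz su lip. Qed.

Lemma norm_integral_le (L T : R) (X : nspace R F) (u : R -> F) (p : F -> F) :
  (forall v, nnorm (L2 L) (p v) <= nnorm X v) ->
  (\int[mu]_(t in J T) (nnorm (L2 L) (p (u t)))%:E <= L1_norm (J T) X u)%E.
Proof.
move=> h; have N0 v := L2norm_ge0 L (p v).
apply: ge0_ae_le_integral_nomeas => //.
- by move=> t _; rewrite lee_fin; exact: N0.
- by move=> t _; rewrite lee_fin; exact: le_trans (N0 _) (h _).
- by apply: aeW => t _; rewrite lee_fin; exact: h.
Qed.

End Assembly.

Theorem proposition3p2 (R : realType) (L T epsmax nu : R)
  (E E' : R -> R) (k : R -> R -> R) (I A kappa : R -> R -> R)
  (hL : 0 < L) (hT : 0 <= T) (hepsmax : 0 < epsmax) (hnu : 0 < 1 + nu)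
  (hE0 : 0 < E 0)
  (hE' : derivative_on `[0, T] E E')
  (hk : forall t s : R, k t s = E' (t - s) / E 0)
  (hkcont : {within [set p : R * R | 0 <= p.2 <= p.1 /\ p.1 <= T],
     continuous (fun p : R * R => k p.1 p.2)})
  (hkbnd : exists K : R, forall t s : R, 0 <= s -> s <= t -> t <= T ->
     `|k t s| <= K)
  (hIA : exists c0 c1 : R, 0 < c0 /\
     forall eps : R, 0 < eps <= epsmax -> forall x : R, 0 < x < L ->
       c0 <= I eps x <= c1 /\ c0 <= A eps x <= c1)
  (hImeas : forall eps : R, 0 < eps <= epsmax -> measurable_fun `]0, L[ (I eps))
  (hAmeas : forall eps : R, 0 < eps <= epsmax -> measurable_fun `]0, L[ (A eps))
  (hkappa : forall eps x, kappa eps x = A eps x / (2 * (1 + nu)))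
  (hreg : exists C : R, forall (eps : R) (f g : R -> R -> R)
     (u : R -> ((R -> R) * (R -> R)) * ((R -> R) * (R -> R))),
     let fE t x := f t x / E 0 in let gE t x := g t x / E 0 in
     0 < eps <= epsmax ->
     L1_Bochner `[0, T] (prod_space (H1 L) (H1 L)) (fun t => (f t, g t)) ->
     mixed_solution L T (H1 L) (L2 L) eps (I eps) (kappa eps) k fE gE u ->
     regularity_estimate L T C fE gE u) :
  exists C : R, 0 < C /\
    forall (eps : R) (s : seq R) (f g : R -> R -> R)
      (u uh : R -> ((R -> R) * (R -> R)) * ((R -> R) * (R -> R))),
      let fE t x := f t x / E 0 in let gE t x := g t x / E 0 in
      0 < eps <= epsmax ->
      itv_partition 0 L s ->
      L1_Bochner `[0, T] (prod_space (H1 L) (H1 L)) (fun t => (f t, g t)) ->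
      mixed_solution L T (H1 L) (L2 L) eps (I eps) (kappa eps) k fE gE u ->
      mixed_solution L T (Vh L s) (Qh L s) eps (I eps) (kappa eps) k fE gE uh ->
      (L1_norm `[0%R, T] (prod_space (H1 L) (H1 L)) (fun t => (u t).1 - (uh t).1)%R
       + L1_norm `[0%R, T] (prod_space (L2 L) (L2 L)) (fun t => (u t).2 - (uh t).2)%R
       <= C%:E * (mesh_size s)%:E
          * (L1_norm `[0%R, T] (H1 L) fE + L1_norm `[0%R, T] (H1 L) gE))%E.
Proof.
have [K kK] := hkbnd; have [c0 [c1 [c00 hc]]] := hIA; have [Creg reg] := hreg.
have nu2 : 0 < 2 * (1 + nu) by rewrite mulr_gt0.
(* c1 has to be replaced by a bound that is positive before any thickness is given *)
have C1 : 0 < `|c1| + c0 by rewrite ltr_wpDl.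
have amin0 : 0 < (`|c1| + c0)^-1 by rewrite invr_gt0.
have amax0 : 0 <= c0^-1 by rewrite invr_ge0 ltW.
have bmax0 : 0 <= 2 * (1 + nu) / c0 by rewrite divr_ge0 ?ltW.
have [Kp Kp0 pw] := pointwise_error hL amin0 amax0 bmax0 (ltW hepsmax).
exists (2 * Kp * `|Creg| + 1); split.
  by rewrite ltr_wpDl// mulr_ge0// mulr_ge0.
move=> eps s f g u uh fE gE heps hs hfg hu huh.
have mk t : 0 <= t <= T -> measurable_fun `[0, t] (k t).
  by move=> /andP[_ tT]; exact: within_slice hkcont tT.
have fx := flux_eq_steps hL hT hs mk kK hu huh.
have [rM rV rb rw regle] := reg eps f g u heps hfg hu.
have IA x : `]0, L[%classic x -> c0 <= I eps x <= c1 /\ c0 <= A eps x <= c1.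
  by rewrite /= in_itv/= => xL; exact: hc.
have Ip x : `]0, L[%classic x -> 0 < I eps x.
  by move=> /IA[/andP[h _] _]; exact: lt_le_trans c00 h.
have Ap x : `]0, L[%classic x -> 0 < A eps x.
  by move=> /IA[_ /andP[h _]]; exact: lt_le_trans c00 h.
have mI : measurable_fun `]0, L[ (fun x => (I eps x)^-1).
  by apply: measurable_inv_pos => //; exact: hImeas.
have kE x : (kappa eps x)^-1 = 2 * (1 + nu) * (A eps x)^-1.
  by rewrite hkappa invfM invrK mulrC.
have mkap : measurable_fun `]0, L[ (fun x => (kappa eps x)^-1).
  have -> : (fun x => (kappa eps x)^-1) = (fun x => 2 * (1 + nu) * (A eps x)^-1).
    by apply/funext => x; rewrite kE.
  apply: measurable_funM => //; apply: measurable_inv_pos => //; exact: hAmeas.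
have IB x : `]0, L[%classic x -> (`|c1| + c0)^-1 <= (I eps x)^-1 <= c0^-1.
  move=> Ox; have [/andP[h1 h2] _] := IA x Ox; have Ipx := Ip x Ox.
  rewrite !lef_pV2 ?posrE// h1 andbT (le_trans h2)// (le_trans (ler_norm c1))//.
  by rewrite lerDl ltW.
have kB x : `]0, L[%classic x -> 0 <= (kappa eps x)^-1 <= 2 * (1 + nu) / c0.
  move=> Ox; have [_ /andP[h1 h2]] := IA x Ox; have Apx := Ap x Ox.
  rewrite kE; apply/andP; split; first by rewrite mulr_ge0 ?ltW// invr_gt0.
  by apply: ler_wpM2l; [exact: ltW|rewrite lef_pV2 ?posrE].
pose pA t := smoothness L (u t).
have pA0 t : 0 <= pA t by rewrite /pA /smoothness !addr_ge0// L2norm_ge0.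
have cM := strongly_measurable_carrier rM.1; have cV := strongly_measurable_carrier rV.1.
have cb := strongly_measurable_carrier rb.1; have cw := strongly_measurable_carrier rw.1.
have cuh := strongly_measurable_carrier huh.1.1.
pose h := mesh_size s.
have h0 : 0 <= h by exact: bigmax_ge_id.
have main : {ae (@lebesgue_measure R), forall t, `[0, T]%classic t ->
   nnorm (prod_space (H1 L) (H1 L)) ((u t).1 - (uh t).1) <= Kp * h * pA t /\
   nnorm (prod_space (L2 L) (L2 L)) ((u t).2 - (uh t).2) <= Kp * h * pA t}.
  have c12 := ae_conj cM cV.
  have c34 := ae_conj cb cw.
  have c1234 := ae_conj c12 c34.
  have e1 := ae_conj hu.2 huh.2.
  have e2 := ae_conj fx cuh.
  have e3 := ae_conj e1 e2.
  apply: ae_imply2 c1234 e3 => t hc1 hc2 Jt.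
  have [[q1 q2] [q3 q4]] := hc1 Jt; have [[q5 q6] [q7 q8]] := hc2 Jt.
  have [[q9 q10] [q11 q12]] := q8.
  have z1 : carrier (L2 L) (cst 0) by exact: inL2_cst.
  have z2 : carrier (Qh L s) (step_fun s (fun=> 0)) by exact: step_fun_Qh.
  have := pw eps s (I eps) (kappa eps) (u t) (uh t) heps hs mI mkap IB kB q1 q2 q3 q4 q9 q10 q11 q12 q7.
  rewrite !mulrA; apply.
  - by move=> tau xi ht hx; exact: (q5 tau xi _ _ ht hx z1 z1).2.
  - by move=> tau xi ht hx; exact: (q6 tau xi _ _ ht hx z2 z2).2.
have m1 := bochner_ae_measurable rM (@H2_lipschitz R L).
have m2 := bochner_ae_measurable rV (@H2_lipschitz R L).
have m3 := bochner_ae_measurable rb (@H1_lipschitz R L).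
have m4 := bochner_ae_measurable rw (@H1_lipschitz R L).
have m12 := ae_measurableD m1 m2; have m123 := ae_measurableD m12 m3.
have mJ : measurable (`[0, T]%classic : set R) by exact: measurable_itv.
have mA : ae_measurable `[0, T] pA := ae_measurableD m123 m4.
pose IA0 := (\int[lebesgue_measure]_(t in `[0%R, T]) (pA t)%:E)%E.
have IAle : (IA0 <= Creg%:E * (L1_norm `[0%R, T] (H1 L) fE + L1_norm `[0%R, T] (H1 L) gE))%E.
  apply: le_trans regle; rewrite /IA0 /pA /smoothness.
  have E4 := ge0_integralD4_ae mJ (fun t => L2norm_ge0 L _) (fun t => L2norm_ge0 L _)
    (fun t => L2norm_ge0 L _) (fun t => L2norm_ge0 L _) m1 m2 m3 m4.
  rewrite E4; apply: leeD; [apply: leeD; [apply: leeD|]|].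
  - exact: norm_integral_le (@H2_ge R L).
  - exact: norm_integral_le (@H2_ge R L).
  - exact: norm_integral_le (fun v => (nnormH1_ge L v).2).
  - exact: norm_integral_le (fun v => (nnormH1_ge L v).2).
have bound (p : R -> R) : (forall t, 0 <= p t) ->
    {ae (@lebesgue_measure R), forall t, `[0, T]%classic t -> p t <= Kp * h * pA t} ->
    (\int[lebesgue_measure]_(t in `[0%R, T]) (p t)%:E <= (Kp * h)%:E * IA0)%E.
  move=> p0 pl; rewrite -ge0_integralZ_ae//; last exact: mulr_ge0.
  apply: ge0_ae_le_integral_nomeas => //.
  - by move=> t _; rewrite lee_fin; exact: p0.
  - by move=> t _; rewrite lee_fin; apply: mulr_ge0 (pA0 t); exact: mulr_ge0.
have b1 := bound (fun t => nnorm (prod_space (H1 L) (H1 L)) ((u t).1 - (uh t).1)) (fun t => sqrtr_ge0 _)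
  (ae_imply (fun t (hh : _ -> _ /\ _) (Jt : `[0, T]%classic t) => (hh Jt).1) main).
have b2 := bound (fun t => nnorm (prod_space (L2 L) (L2 L)) ((u t).2 - (uh t).2)) (fun t => sqrtr_ge0 _)
  (ae_imply (fun t (hh : _ -> _ /\ _) (Jt : `[0, T]%classic t) => (hh Jt).2) main).
apply: (le_trans (leeD b1 b2)).
set Y := (L1_norm _ _ fE + _)%E in IAle *.
have Y0 : (0 <= Y)%E.
  by apply: adde_ge0; apply: integral_ge0 => t _; rewrite lee_fin sqrtr_ge0.
have Kh0 : 0 <= Kp * h by exact: mulr_ge0.
have IA00 : (0 <= IA0)%E by apply: integral_ge0 => t _; rewrite lee_fin.
rewrite -ge0_muleDl ?lee_fin// -EFinD -EFinM.
apply: (@le_trans _ _ ((Kp * h + Kp * h)%:E * (`|Creg|%:E * Y))%E).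
  rewrite lee_wpmul2l ?lee_fin ?addr_ge0//; apply: (le_trans IAle).
  by rewrite lee_wpmul2r// lee_fin ler_norm.
rewrite muleA -EFinM; apply: lee_wpmul2r => //; rewrite lee_fin -/h.
have -> : (2 * Kp * `|Creg| + 1) * h = (Kp * h + Kp * h) * `|Creg| + h by ring.
by rewrite lerDl.
Qed.
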